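(* For any local $C^*$-algebras $A_1$, $A_2$ and $B$ there is a semigroup isomorphism $$W(A_1\oplus A_2,B)\cong W(A_1,B)\oplus W(A_2,B).$$
   Context: A pre-$C^*$-algebra $A$ is a local $C^*$-algebra if there is a family $\{A_i\}_{i\in I}$ of $C^*$-subalgebras of $A$ such that for all $i,j\in I$ there is $k\in I$ with $A_i,A_j\subset A_k$, and $A=\bigcup_{i}A_i$. For such $A$, $M_\infty(A)=\bigcup_nM_n(A)$ is again a local $C^*$-algebra. All ($C^*$- and local $C^*$-)algebras are assumed separable. A c.p.c. order zero map between local $C^*$-algebras is a completely positive contractive linear map $\phi$ with $\phi(a)\phi(b)=0$ whenever $a,b$ are positive and $ab=0$. For c.p.c. order zero maps $\phi,\psi:A\to B$ write $\phi\precsim\psi$ if there is a sequence $(b_n)$ in $B$ with $\|b_n^*\psi(a)b_n-\phi(a)\|\to0$ for every $a\in A$; $\phi\sim\psi$ means $\phi\precsim\psi\precsim\phi$. $W(A,B)$ is the set of $\sim$-classes of c.p.c. order zero maps $A\to M_\infty(B)$, with addition $[\phi]+[\psi]=[\phi\,\hat\oplus\,\psi]$, where $(\phi\,\hat\oplus\,\psi)(a)=\phi(a)\oplus\psi(a)\in M_2(M_\infty(B))\cong M_\infty(B)$. *)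

(* Defs.v *)
From HB Require Import structures.
From mathcomp Require Import all_boot all_order all_algebra complex.
From mathcomp Require Import all_classical all_reals all_analysis.

Set Implicit Arguments.
Unset Strict Implicit.
Unset Printing Implicit Defensive.

Import Order.TTheory GRing.Theory Num.Theory numFieldNormedType.Exports.

Local Open Scope classical_set_scope.
Local Open Scope ring_scope.
Local Open Scope complex_scope.

(* Non-unital complex *-algebras. *)
HB.mixin Record Lmodule_isStarAlgebra (R : realType) A
    of GRing.Lmodule R[i] A := {
  smul : A -> A -> A;
  star : A -> A;
  smulA : associative smul;
  smulDl : left_distributive smul +%R;
  smulDr : right_distributive smul +%R;
  smulZl : forall (c : R[i]) (x y : A), smul (c *: x) y = c *: smul x y;
  smulZr : forall (c : R[i]) (x y : A), smul x (c *: y) = c *: smul x y;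
  starK : involutive star;
  starD : {morph star : x y / x + y};
  starZ : forall (c : R[i]) (x : A), star (c *: x) = c^* *: star x;
  starM : forall x y : A, star (smul x y) = smul (star y) (star x)
}.

#[short(type="starAlgType")]
HB.structure Definition StarAlgebra (R : realType) :=
  {A of Lmodule_isStarAlgebra R A & GRing.Lmodule R[i] A}.

Reserved Notation "x ** y" (at level 40, left associativity).
Notation "x ** y" := (smul x y) : ring_scope.

(* A *-algebra with a distinguished real function, its norm. No law is
   attached to the norm here; the laws are stated by [cstar_norm]. *)
HB.mixin Record hasCnorm (R : realType) A of StarAlgebra R A := {
  cnorm : A -> R
}.

#[short(type="normedStarAlgType")]
HB.structure Definition NormedStarAlgebra (R : realType) :=
  {A of hasCnorm R A & StarAlgebra R A}.

Section StarAlgebraTheory.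
Context {R : realType} {A : starAlgType R}.
Implicit Types x y : A.

Lemma smul0r x : 0 ** x = 0.
Proof. by have := smulZl 0 0 x; rewrite !scale0r. Qed.

Lemma smulr0 x : x ** 0 = 0.
Proof. by have := smulZr 0 x 0; rewrite !scale0r. Qed.

Lemma star0 : star (0 : A) = 0.
Proof. by have := starZ 0 (0 : A); rewrite rmorph0 !scale0r. Qed.

Lemma smul_suml (I : Type) (r : seq I) (F : I -> A) x :
  (\sum_(i <- r) F i) ** x = \sum_(i <- r) F i ** x.
Proof.
by elim/big_rec2: _ => [|i y z _ <-]; rewrite ?smul0r // smulDl.
Qed.

Lemma smul_sumr (I : Type) (r : seq I) (F : I -> A) x :
  x ** (\sum_(i <- r) F i) = \sum_(i <- r) x ** F i.
Proof.
by elim/big_rec2: _ => [|i y z _ <-]; rewrite ?smulr0 // smulDr.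
Qed.

Lemma star_sum (I : Type) (r : seq I) (F : I -> A) :
  star (\sum_(i <- r) F i) = \sum_(i <- r) star (F i).
Proof. by elim/big_rec2: _ => [|i y z _ <-]; rewrite ?star0 // starD. Qed.

End StarAlgebraTheory.

Section LocalCstar.
Context {R : realType} (A : starAlgType R) (N : A -> R).

Definition cstar_norm : Prop :=
  [/\ forall x, 0 <= N x /\ (N x = 0 -> x = 0),
      forall x y, N (x + y) <= N x + N y,
      forall (c : R[i]) x, N (c *: x) = complex.Re `|c| * N x,
      forall x y, N (x ** y) <= N x * N y &
      forall x, N (star x ** x) = N x ^+ 2].

Definition cnorm_complete (S : set A) : Prop :=
  forall u : nat -> A, (forall n, S (u n)) ->
    (forall e : R, 0 < e ->
       exists n0, forall m n, (n0 <= m)%N -> (n0 <= n)%N -> N (u m - u n) < e) ->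
    exists2 l, S l & N (u n - l) @[n --> \oo] --> (0 : R).

Definition cstar_subalgebra (S : set A) : Prop :=
  [/\ S 0, forall (c : R[i]) x y, S x -> S y -> S (c *: x + y),
      forall x y, S x -> S y -> S (x ** y),
      forall x, S x -> S (star x) & cnorm_complete S].

Definition local_cstar_norm : Prop :=
  cstar_norm /\
  exists (I : Type) (F : I -> set A),
    [/\ forall i, cstar_subalgebra (F i),
        forall i j, exists k, F i `<=` F k /\ F j `<=` F k &
        \bigcup_i F i = setT].

Definition cnorm_separable : Prop :=
  exists2 D : set A, countable D &
    forall x (e : R), 0 < e -> exists2 d, D d & N (x - d) < e.

End LocalCstar.

Definition separable_local_cstar (R : realType) (A : normedStarAlgType R) :=
  local_cstar_norm (@cnorm R A) /\ cnorm_separable (@cnorm R A).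

Section DirectSum.
Context {R : realType}.

Section Algebra.
Context (A1 A2 : starAlgType R).
Implicit Types x y z : (A1 * A2)%type.

Definition pair_smul x y : A1 * A2 := (x.1 ** y.1, x.2 ** y.2).
Definition pair_star x : A1 * A2 := (star x.1, star x.2).

Lemma pair_smulA : associative pair_smul.
Proof. by move=> x y z; rewrite /pair_smul !smulA. Qed.
Lemma pair_smulDl : left_distributive pair_smul +%R.
Proof. by move=> x y z; rewrite /pair_smul !smulDl. Qed.
Lemma pair_smulDr : right_distributive pair_smul +%R.
Proof. by move=> x y z; rewrite /pair_smul !smulDr. Qed.
Lemma pair_smulZl (c : R[i]) x y : pair_smul (c *: x) y = c *: pair_smul x y.
Proof. by rewrite /pair_smul !smulZl. Qed.
Lemma pair_smulZr (c : R[i]) x y : pair_smul x (c *: y) = c *: pair_smul x y.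
Proof. by rewrite /pair_smul !smulZr. Qed.
Lemma pair_starK : involutive pair_star.
Proof. by case=> x y; rewrite /pair_star !starK. Qed.
Lemma pair_starD : {morph pair_star : x y / x + y}.
Proof. by move=> x y; rewrite /pair_star !starD. Qed.
Lemma pair_starZ (c : R[i]) x : pair_star (c *: x) = c^* *: pair_star x.
Proof. by rewrite /pair_star !starZ. Qed.
Lemma pair_starM x y : pair_star (pair_smul x y) = pair_smul (pair_star y) (pair_star x).
Proof. by rewrite /pair_star !starM. Qed.

HB.instance Definition _ := Lmodule_isStarAlgebra.Build R (A1 * A2)%type
  pair_smulA pair_smulDl pair_smulDr pair_smulZl pair_smulZr pair_starK pair_starD pair_starZ pair_starM.
End Algebra.

HB.instance Definition _ (A1 A2 : normedStarAlgType R) :=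
  hasCnorm.Build R (A1 * A2)%type
    (fun x => Num.max (cnorm x.1) (cnorm x.2)).

End DirectSum.

(* M_oo(B), the union of the M_n(B) along the corner embeddings
   x |-> diag(x, 0): infinite matrices vanishing outside a finite corner. *)
Definition corner_supported (V : nmodType) : {pred nat -> nat -> V} :=
  [pred f | `[< exists n, forall i j, (n <= i)%N || (n <= j)%N -> f i j = 0 >]].

Record Minf (V : nmodType) := MkMinf {
  Minf_val :> nat -> nat -> V;
  Minf_valP : Minf_val \in @corner_supported V
}.

Section MinfLmodule.
Context (K : pzRingType) (V : lmodType K).

HB.instance Definition _ := [isSub for @Minf_val V].
HB.instance Definition _ := [Choice of Minf V by <:].

Lemma corner_supported_submod : submod_closed (@corner_supported V).
Proof.
split=> [|c f g /asboolP[m fm] /asboolP[n gn]]; apply/asboolP.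
  by exists 0%N.
exists (maxn m n) => i j; rewrite !geq_max => ij.
have -> : (c *: f + g) i j = c *: f i j + g i j by [].
rewrite fm ?gn ?scaler0 ?addr0 //.
  by case/orP: ij => /andP[mi ni]; rewrite ?mi ?ni ?orbT.
by case/orP: ij => /andP[mi ni]; rewrite ?mi ?ni ?orbT.
Qed.

HB.instance Definition _ := GRing.isSubmodClosed.Build _ _ (@corner_supported V)
  corner_supported_submod.
HB.instance Definition _ := [SubChoice_isSubLmodule of Minf V by <:].

End MinfLmodule.

Section MinfAlgebra.
Context {R : realType} (B : starAlgType R).
Implicit Types x y z : Minf B.

Lemma MinfP x y : (forall i j, x i j = y i j) <-> x = y.
Proof.
split=> [xy|-> //]; apply/val_inj/funext => i.
by apply/funext => j; apply: xy.
Qed.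

Lemma Minf_corner x :
  exists n, forall i j, (n <= i)%N || (n <= j)%N -> x i j = 0.
Proof. exact/asboolP/Minf_valP. Qed.

Lemma MinfD x y i j : (x + y) i j = x i j + y i j.
Proof. by []. Qed.

Lemma MinfZ (c : R[i]) x i j : (c *: x) i j = c *: x i j.
Proof. by []. Qed.

Definition Minf_prodf x y i j : B := \sum_(k \in [set: nat]) x i k ** y k j.

Lemma Minf_prodfE x y n : (forall i j, (n <= i)%N || (n <= j)%N -> x i j = 0) ->
  forall i j, Minf_prodf x y i j = \sum_(k < n) x i k ** y k j.
Proof.
move=> xn i j; rewrite (fsbig_ord _ _ (fun k => x i k ** y k j)).
apply/esym/fsbig_widen => // k [_ /=] /negP; rewrite -leqNgt => nk.
by rewrite xn ?nk ?orbT // smul0r.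
Qed.

Lemma Minf_mul_subproof x y : Minf_prodf x y \in @corner_supported B.
Proof.
have [m xm] := Minf_corner x; have [n yn] := Minf_corner y.
apply/asboolP; exists (maxn m n) => i j ij.
rewrite (Minf_prodfE _ xm) big1 // => k _.
move: ij; rewrite !geq_max => /orP[] /andP[mi nj].
  by rewrite xm ?mi // smul0r.
by rewrite yn ?nj ?orbT // smulr0.
Qed.

Definition Minf_mul x y : Minf B := MkMinf (Minf_mul_subproof x y).

Lemma Minf_star_subproof x : (fun i j => star (x j i)) \in @corner_supported B.
Proof.
have [m xm] := Minf_corner x; apply/asboolP; exists m => i j ij.
by rewrite xm ?star0 // orbC.
Qed.

Definition Minf_star x : Minf B := MkMinf (Minf_star_subproof x).

Lemma Minf_mulE x y n :
  (forall i j, (n <= i)%N || (n <= j)%N -> x i j = 0) ->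
  forall i j, Minf_mul x y i j = \sum_(k < n) x i k ** y k j.
Proof. exact: Minf_prodfE. Qed.

Lemma Minf_common x y : exists n,
  (forall i j, (n <= i)%N || (n <= j)%N -> x i j = 0) /\
  (forall i j, (n <= i)%N || (n <= j)%N -> y i j = 0).
Proof.
have [m xm] := Minf_corner x; have [n yn] := Minf_corner y.
exists (maxn m n); split=> i j; rewrite !geq_max => ij.
  by rewrite xm //; case/orP: ij => /andP[ni _]; rewrite ni ?orbT.
by rewrite yn //; case/orP: ij => /andP[_ ni]; rewrite ni ?orbT.
Qed.

Lemma Minf_mulA : associative Minf_mul.
Proof.
move=> x y z; have [n [xn yn]] := Minf_common x y.
apply/MinfP => i j; rewrite (Minf_mulE _ xn).
have xyn i' j' : (n <= i')%N || (n <= j')%N -> Minf_mul x y i' j' = 0.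
  move=> ij; rewrite (Minf_mulE _ xn) big1 // => k _.
  case/orP: ij => ni; first by rewrite xn ?ni // smul0r.
  by rewrite yn ?ni ?orbT // smulr0.
rewrite (Minf_mulE _ xyn).
under eq_bigr do rewrite (Minf_mulE _ yn) smul_sumr.
under [RHS]eq_bigr do rewrite (Minf_mulE _ xn) smul_suml.
rewrite exchange_big; apply: eq_bigr => k _; apply: eq_bigr => l _.
by rewrite smulA.
Qed.

Lemma Minf_mulDl : left_distributive Minf_mul +%R.
Proof.
move=> x y z; have [n [xn yn]] := Minf_common x y.
have xyn i' j' : (n <= i')%N || (n <= j')%N -> (x + y) i' j' = 0.
  by move=> ij; rewrite MinfD xn ?yn ?addr0.
apply/MinfP => i j; rewrite MinfD (Minf_mulE _ xyn) (Minf_mulE _ xn).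
rewrite (Minf_mulE _ yn) -big_split; apply: eq_bigr => k _ /=.
by rewrite -smulDl.
Qed.

Lemma Minf_mulDr : right_distributive Minf_mul +%R.
Proof.
move=> x y z; have [n xn] := Minf_corner x.
apply/MinfP => i j; rewrite MinfD !(Minf_mulE _ xn) -big_split.
by apply: eq_bigr => k _ /=; rewrite -smulDr.
Qed.

Lemma Minf_mulZl (c : R[i]) x y : Minf_mul (c *: x) y = c *: Minf_mul x y.
Proof.
have [n xn] := Minf_corner x.
have cxn i' j' : (n <= i')%N || (n <= j')%N -> (c *: x) i' j' = 0.
  by move=> ij; rewrite MinfZ xn ?scaler0.
apply/MinfP => i j; rewrite MinfZ (Minf_mulE _ cxn) (Minf_mulE _ xn) scaler_sumr.
by apply: eq_bigr => k _; rewrite -smulZl.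
Qed.

Lemma Minf_mulZr (c : R[i]) x y : Minf_mul x (c *: y) = c *: Minf_mul x y.
Proof.
have [n xn] := Minf_corner x.
apply/MinfP => i j; rewrite MinfZ !(Minf_mulE _ xn) scaler_sumr.
by apply: eq_bigr => k _; rewrite -smulZr.
Qed.

Lemma Minf_starK : involutive Minf_star.
Proof. by move=> x; apply/MinfP => i j /=; rewrite starK. Qed.

Lemma Minf_starD : {morph Minf_star : x y / x + y}.
Proof. by move=> x y; apply/MinfP => i j; rewrite MinfD /= -starD. Qed.

Lemma Minf_starZ (c : R[i]) x : Minf_star (c *: x) = c^* *: Minf_star x.
Proof. by apply/MinfP => i j; rewrite MinfZ /= -starZ. Qed.

Lemma Minf_starM x y : Minf_star (Minf_mul x y) = Minf_mul (Minf_star y) (Minf_star x).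
Proof.
have [n [xn yn]] := Minf_common x y.
have ysn i' j' : (n <= i')%N || (n <= j')%N -> Minf_star y i' j' = 0.
  by move=> ij; rewrite /= yn ?star0 // orbC.
apply/MinfP => i j; rewrite (Minf_mulE _ ysn).
transitivity (star (Minf_mul x y j i)) => //.
rewrite (Minf_mulE _ xn) star_sum.
by apply: eq_bigr => k _; rewrite starM.
Qed.

HB.instance Definition _ := Lmodule_isStarAlgebra.Build R (Minf B)
  Minf_mulA Minf_mulDl Minf_mulDr Minf_mulZl Minf_mulZr Minf_starK Minf_starD Minf_starZ Minf_starM.

Lemma Minf_corner_subproof (b : B) :
  (fun i j => if (i == 0%N) && (j == 0%N) then b else 0)
    \in @corner_supported B.
Proof. by apply/asboolP; exists 1%N => -[|i] [|j]. Qed.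

Definition Minf_corner_embed (b : B) : Minf B := MkMinf (Minf_corner_subproof b).

(* The direct sum M_oo(B) x M_oo(B) -> M_2(M_oo(B)) = M_oo(B); the last
   identification is the one induced by the bijection {0, 1} x nat -> nat,
   (e, k) |-> 2k + e. *)
Lemma Minf_hsum_subproof x y :
  (fun i j => if odd i == odd j then (if odd i then y else x) i./2 j./2 else 0)
    \in @corner_supported B.
Proof.
have [n [xn yn]] := Minf_common x y.
apply/asboolP; exists n.*2 => i j ij; case: eqP => // _.
have ij2 : (n <= i./2)%N || (n <= j./2)%N.
  by case/orP: ij => /half_leq; rewrite doubleK => ->; rewrite ?orbT.
by case: (odd i); [exact: yn|exact: xn].
Qed.

Definition Minf_hsum x y : Minf B := MkMinf (Minf_hsum_subproof x y).

End MinfAlgebra.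

(* For a local C*-algebra B, M_oo(B) is a local C*-algebra for exactly one
   norm, the union of the C*-norms of the M_n(B) (an injective *-homomorphism
   of C*-algebras is isometric, so the norm is determined by the algebra); it
   extends the norm of B. The default of [xget] plays no role for such B. *)
Definition Minf_norm (R : realType) (B : normedStarAlgType R) : Minf B -> R :=
  xget (fun=> 0) [set N : Minf B -> R |
    local_cstar_norm N /\ forall b, N (Minf_corner_embed b) = cnorm b].

HB.instance Definition _ (R : realType) (B : normedStarAlgType R) :=
  hasCnorm.Build R (Minf B) (@Minf_norm R B).

Section OrderZero.
Context {R : realType}.

(* In a local C*-algebra the positive elements are exactly the x^* x. *)
Definition cpositive (A : starAlgType R) (a : A) : Prop :=
  exists x : A, a = star x ** x.

(* X = Y^* Y in M_n(A). *)
Definition mx_cpositive (A : starAlgType R) n (X : 'M[A]_n) : Prop :=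
  exists Y : 'M[A]_n, X = \matrix_(i, j) \sum_k star (Y k i) ** Y k j.

Definition completely_positive (A B : starAlgType R) (phi : A -> B) : Prop :=
  forall n (X : 'M[A]_n), mx_cpositive X -> mx_cpositive (map_mx phi X).

Definition cpc_order_zero (A B : normedStarAlgType R) (phi : A -> B) : Prop :=
  [/\ linear phi, completely_positive phi,
      forall a, cnorm (phi a) <= cnorm a &
      forall a b, cpositive a -> cpositive b -> a ** b = 0 ->
        phi a ** phi b = 0].

Definition csubequiv (A B : normedStarAlgType R) (phi psi : A -> B) : Prop :=
  exists b : nat -> B, forall a : A,
    cnorm (star (b n) ** psi a ** b n - phi a) @[n --> \oo] --> (0 : R).

Definition cequiv (A B : normedStarAlgType R) (phi psi : A -> B) : Prop :=
  csubequiv phi psi /\ csubequiv psi phi.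

End OrderZero.

Section BivariantCuntz.
Context {R : realType} (A B : normedStarAlgType R).

Definition Wclass (phi : A -> Minf B) : set (A -> Minf B) :=
  [set psi | cpc_order_zero psi /\ cequiv psi phi].

Definition W : set (set (A -> Minf B)) :=
  [set Wclass phi | phi in [set phi | cpc_order_zero phi]].

(* Since the class of the direct sum of representatives does not depend on
   their choice, the union is that class when S and T are in W. *)
Definition Wadd (S T : set (A -> Minf B)) : set (A -> Minf B) :=
  \bigcup_(phi in S) \bigcup_(psi in T)
    Wclass (fun a => Minf_hsum (phi a) (psi a)).

End BivariantCuntz.

Arguments Wclass {R A B} phi _.
Arguments W {R} A B _.
Arguments Wadd {R A B} S T _.

Definition semigroup_isomorphic (T U : Type) (S : set T) (addS : T -> T -> T)
    (S' : set U) (addS' : U -> U -> U) : Prop :=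
  exists f : T -> U, set_bij S S' f /\
    forall x y, S x -> S y -> f (addS x y) = addS' (f x) (f y).

Definition pair_add (T U : Type) (addT : T -> T -> T) (addU : U -> U -> U)
    (x y : T * U) : T * U := (addT x.1 y.1, addU x.2 y.2).

(* Main.v *)
(* The isomorphism sends [phi] to the pair of classes of its restrictions phi_1,
   phi_2 to A1 and A2; the inverse sends ([phi_1], [phi_2]) to the class of
   phi_1 (+) phi_2. Injectivity is the only hard point: from phi_i <~ psi_i one
   needs phi <~ psi. The ranges of psi_1 and psi_2 are orthogonal, so if d_i lies in
   the right ideal generated by the range of psi_i then d = d_1 + d_2 satisfies
   d* psi(a) d = d_1* psi_1(a_1) d_1 + d_2* psi_2(a_2) d_2.
   Hence it suffices to choose the implementing elements in that ideal while
   keeping the maps d* psi(.) d uniformly bounded. This relies on the identity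
   psi(ab) psi(c) = psi(a) psi(bc), proved by slicing the spectrum of b, and on
   functions of psi(f) for approximate units f, which show that <~ can be tested on
   finite sets; transitivity and reflexivity of <~ follow as well. In M_oo(B),
   2 x 2 matrix tricks replace most of the theory of positive elements. *)

(* The structure theorem, which writes an order zero map as h pi with h central and pi a
   *-homomorphism, is bypassed: it would need multipliers of a complete algebra. All functional
   calculus comes from square roots [(1 - w) * (1 - w) = 1 - z], for [z] of norm at most 1 in the
   unitization, and from polynomials. A self-adjoint [k] counts as lying between 0 and 1 when
   [1 - (k + k)] has norm at most 1; this norm test replaces spectrum and order. Sharp norm bounds
   come from the growth of the powers of a self-adjoint element, whose norm is multiplicative on the
   exponents 2^n. The obstacle behind the estimates is that the elements implementing <~ carry no
   bound, so an approximation on a dense set need not extend to the whole algebra. *)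
Require Import Defs.
From HB Require Import structures.
From mathcomp Require Import all_boot all_order all_algebra complex ring lra zify.
From mathcomp Require Import all_classical all_reals all_analysis.
From Stdlib Require Ncring Ncring_tac.

Set Implicit Arguments.
Unset Strict Implicit.
Unset Printing Implicit Defensive.

Import Order.TTheory GRing.Theory Num.Theory numFieldNormedType.Exports.

Local Open Scope classical_set_scope.
Local Open Scope ring_scope.
Local Open Scope complex_scope.

(* Ingredients of the instances needed by [non_commutative_ring]; instance search
   does not see through the algebraic hierarchy, so that they are redeclared for
   each carrier. *)
Definition nc_ops (U : nzRingType) :
  @Ncring.Ring_ops U 0 1 +%R *%R (fun x y => x - y) -%R eq.
Proof. by constructor. Defined.

Lemma nc_ring (U : nzRingType) :
  @Ncring.Ring U 0 1 +%R *%R (fun x y => x - y) -%R eq (nc_ops U).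
Proof.
split; try by typeclasses eauto.
- exact: add0r.
- exact: addrC.
- exact: addrA.
- exact: mul1r.
- exact: mulr1.
- exact: mulrA.
- exact: mulrDl.
- by move=> x y z; exact: mulrDr.
- by [].
- exact: subrr.
Qed.

(** * Complex moduli and C*-norms *)

Section ComplexModulus.
Context {R : realType}.
Implicit Types c d : R[i].

Definition cabs c : R := complex.Re `|c|.

Lemma cabsE c : cabs c = Normc.normc c.
Proof. by case: c. Qed.

Lemma cabs_ge0 c : 0 <= cabs c.
Proof. by rewrite /cabs normc_def /= sqrtr_ge0. Qed.

Lemma cabsM c d : cabs (c * d) = cabs c * cabs d.
Proof. by rewrite !cabsE Normc.normcM. Qed.

Lemma cabsD c d : cabs (c + d) <= cabs c + cabs d.
Proof. by rewrite !cabsE le_normcD. Qed.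

Lemma cabs0_eq c : cabs c = 0 -> c = 0.
Proof. by rewrite cabsE => /Normc.eq0_normc. Qed.

Lemma cabs_real (r : R) : cabs r%:C = `|r|.
Proof. by rewrite /cabs normc_def /= expr0n /= addr0 sqrtr_sqr. Qed.

Lemma cabs_conj c : cabs c^* = cabs c.
Proof. by case: c => a b; rewrite /cabs !normc_def /= sqrrN. Qed.

Lemma conj_i : Num.conj ('i : R[i]) = - 'i.
Proof. by apply/eqP; rewrite eq_complex /= oppr0 !eqxx. Qed.

Lemma scale_half2 (V : lmodType R[i]) (x : V) : (2^-1 : R)%:C *: (x + x) = x.
Proof.
rewrite scalerDr -scalerDl -rmorphD /=.
have -> : (2^-1 + 2^-1 : R) = 1 by field.
by rewrite scale1r.
Qed.

Lemma cabsN c : cabs (- c) = cabs c.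
Proof. by case: c => a b; rewrite /cabs !normc_def /= !sqrrN. Qed.

Lemma conj_real (r : R) : Num.conj (r%:C) = r%:C.
Proof. exact: conjc_real. Qed.

Lemma cabs_i : cabs 'i = 1.
Proof. by rewrite /cabs normc_def /= expr0n expr1n add0r sqrtr1. Qed.

Lemma cabs_Re c : `|complex.Re c| <= cabs c.
Proof.
rewrite /cabs normc_def /= -sqrtr_sqr ler_wsqrtr // lerDl.
exact: sqr_ge0.
Qed.

Lemma cabs_Im c : `|complex.Im c| <= cabs c.
Proof.
rewrite /cabs normc_def /= -sqrtr_sqr ler_wsqrtr // lerDr.
exact: sqr_ge0.
Qed.

Lemma cabs_le_ReIm c : cabs c <= `|complex.Re c| + `|complex.Im c|.
Proof.
have {1}-> : c = (complex.Re c)%:C + 'i * (complex.Im c)%:C.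
  by case: c => a b; simpc.
by rewrite (le_trans (cabsD _ _)) // cabsM cabs_i mul1r !cabs_real.
Qed.

End ComplexModulus.

Section CstarNorm.
Context {R : realType} {A : starAlgType R} {N : A -> R}.
Hypothesis hN : cstar_norm N.
Implicit Types x y : A.

Lemma cn_ge0 x : 0 <= N x.
Proof. by case: hN => h *; case: (h x). Qed.

Lemma cn_eq0 x : N x = 0 -> x = 0.
Proof. by case: hN => /(_ x)[_ ?]. Qed.

Lemma cnD x y : N (x + y) <= N x + N y.
Proof. by case: hN => _ h *; exact: h. Qed.

Lemma cnZ c x : N (c *: x) = cabs c * N x.
Proof. by case: hN => _ _ h *; exact: h. Qed.

Lemma cnM x y : N (x ** y) <= N x * N y.
Proof. by case: hN => _ _ _ h _; exact: h. Qed.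

Lemma cnS x : N (star x ** x) = N x ^+ 2.
Proof. by case: hN => _ _ _ _ h; exact: h. Qed.

Lemma cnZr (r : R) x : N (r%:C *: x) = `|r| * N x.
Proof. by rewrite cnZ cabs_real. Qed.

Lemma cnMn x n : N (x *+ n) = n%:R * N x.
Proof.
have -> : x *+ n = ((n%:R : R)%:C) *: x by rewrite rmorph_nat scaler_nat.
by rewrite cnZr normr_nat.
Qed.

Lemma cn0 : N 0 = 0.
Proof. by rewrite -(scale0r 0) (cnZr 0) normr0 mul0r. Qed.

Lemma cnN x : N (- x) = N x.
Proof.
have -> : - x = (- 1 : R)%:C *: x by rewrite rmorphN1 scaleN1r.
by rewrite cnZr normrN1 mul1r.
Qed.

Lemma cnB x y : N (x - y) <= N x + N y.
Proof. by rewrite -(cnN y) cnD. Qed.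

Lemma cn_distC x y : N (x - y) = N (y - x).
Proof. by rewrite -cnN opprB. Qed.

Lemma cn_split z x y : N (x - y) <= N (x - z) + N (z - y).
Proof. by rewrite -[x - y](subrKA z) cnD. Qed.

Lemma cn_le_dist x y : N x <= N y + N (x - y).
Proof. by rewrite -{1}(subrK y x) addrC cnD. Qed.

Lemma cn_star_le x : N (star x) <= N x.
Proof.
have [->|x0] := eqVneq (star x) 0; first by rewrite cn0 cn_ge0.
have pos : 0 < N (star x).
  by rewrite lt_neqAle cn_ge0 andbT eq_sym; apply: contra x0 => /eqP/cn_eq0 ->.
rewrite -(ler_pM2l pos) -expr2 -cnS starK [leRHS]mulrC.
exact: cnM.
Qed.

Lemma cn_star x : N (star x) = N x.
Proof. by apply/eqP; rewrite eq_le cn_star_le -{1}(starK x) cn_star_le. Qed.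

Lemma cn_sq x : N (x ** star x) = N x ^+ 2.
Proof. by rewrite -{1}(starK x) cnS cn_star. Qed.

Lemma cn_sum (I : Type) (r : seq I) (P : pred I) (F : I -> A) :
  N (\sum_(i <- r | P i) F i) <= \sum_(i <- r | P i) N (F i).
Proof.
elim/big_rec2: _ => [|i y z _ h]; first by rewrite cn0.
by rewrite (le_trans (cnD _ _)) // lerD2l.
Qed.

Lemma cn_small0 x : (forall e, 0 < e -> N x <= e) -> x = 0.
Proof.
move=> h; apply: cn_eq0; apply/le_anti; rewrite cn_ge0 andbT.
by apply/ler_addgt0Pr => e e0; rewrite add0r h.
Qed.

Lemma cnM3 x y z : N (x ** y ** z) <= N x * N y * N z.
Proof.
by rewrite (le_trans (cnM _ _)) // ler_wpM2r ?cn_ge0 ?cnM.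
Qed.

Lemma starN x : star (- x) = - star x.
Proof. by apply/eqP; rewrite -addr_eq0 -starD addNr star0. Qed.

Lemma starB x y : star (x - y) = star x - star y.
Proof. by rewrite starD starN. Qed.

Lemma smulNl x y : (- x) ** y = - (x ** y).
Proof. by apply/eqP; rewrite -addr_eq0 -smulDl addNr smul0r. Qed.

Lemma smulNr x y : x ** (- y) = - (x ** y).
Proof. by apply/eqP; rewrite -addr_eq0 -smulDr addNr smulr0. Qed.

Lemma smulBl x y z : (x - y) ** z = x ** z - y ** z.
Proof. by rewrite smulDl smulNl. Qed.

Lemma smulBr x y z : x ** (y - z) = x ** y - x ** z.
Proof. by rewrite smulDr smulNr. Qed.

(** Cartesian decomposition: [x + star x] and ['i *: (x - star x)] are self-adjoint, which reduces
    linear statements to self-adjoint elements. *)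
Lemma sa_decomp x : x =
  (2^-1 : R)%:C *: ((x + star x) + - 'i *: ('i *: (x - star x))).
Proof.
rewrite scalerA mulNr -expr2 sqr_i opprK scale1r addrACA subrr addr0.
by rewrite scale_half2.
Qed.

End CstarNorm.

(** * The unitization *)

Definition unitz (R : realType) (A : starAlgType R) : Type := (R[i]^o * A)%type.

Section UnitizationAlgebra.
Context {R : realType} (A : starAlgType R).
Implicit Types u v w : unitz A.

HB.instance Definition _ := GRing.Lmodule.copy (unitz A) (R[i]^o * A)%type.

Definition unitz_one : unitz A := (1, 0).
Definition unitz_mul u v : unitz A :=
  (u.1 * v.1, u.1 *: v.2 + v.1 *: u.2 + u.2 ** v.2).

Lemma unitz_mulA : associative unitz_mul.
Proof.
move=> u v w; congr pair; rewrite /= ?mulrA //.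
rewrite !scalerDr !smulDl !smulDr !scalerA !smulZl !smulZr -!smulA.
rewrite [w.1 * u.1]mulrC [w.1 * v.1]mulrC -!addrA.
congr (_ + (_ + _)).
by rewrite addrCA; congr (_ + _); rewrite [RHS]addrCA; congr (_ + _); exact: addrCA.
Qed.

Lemma unitz_mul1r : left_id unitz_one unitz_mul.
Proof.
by case=> l a; rewrite /unitz_mul /= mul1r scale1r scaler0 smul0r !addr0.
Qed.

Lemma unitz_mulr1 : right_id unitz_one unitz_mul.
Proof.
by case=> l a; rewrite /unitz_mul /= mulr1 scale1r scaler0 smulr0 add0r addr0.
Qed.

Lemma unitz_mulDl : left_distributive unitz_mul +%R.
Proof.
move=> u v w; congr pair; rewrite /= ?mulrDl //.
rewrite scalerDl scalerDr smulDl [RHS]addrACA; congr (_ + _).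
exact: addrACA.
Qed.

Lemma unitz_mulDr : right_distributive unitz_mul +%R.
Proof.
move=> u v w; congr pair; rewrite /= ?mulrDr //.
rewrite scalerDl scalerDr smulDr [RHS]addrACA; congr (_ + _).
exact: addrACA.
Qed.

Lemma unitz_one_neq0 : unitz_one != 0.
Proof. by apply/eqP => -[/eqP]; rewrite oner_eq0. Qed.

HB.instance Definition _ := GRing.Zmodule_isNzRing.Build (unitz A)
  unitz_mulA unitz_mul1r unitz_mulr1 unitz_mulDl unitz_mulDr unitz_one_neq0.

Lemma unitz_scaleAl (c : R[i]) u v : c *: (u * v) = (c *: u) * v.
Proof.
congr pair; rewrite /= ?scalerAl //.
by rewrite !scalerDr smulZl !scalerA [v.1 * c]mulrC.
Qed.

Lemma unitz_scaleAr (c : R[i]) u v : c *: (u * v) = u * (c *: v).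
Proof.
congr pair; rewrite /= ?scalerAr //.
by rewrite !scalerDr smulZr !scalerA [u.1 * c]mulrC.
Qed.

HB.instance Definition _ :=
  GRing.Lmodule_isLalgebra.Build R[i] (unitz A) unitz_scaleAl.
HB.instance Definition _ :=
  GRing.Lalgebra_isAlgebra.Build R[i] (unitz A) unitz_scaleAr.

Definition unitz_star u : unitz A := (u.1^*, star u.2).

Definition uin (a : A) : unitz A := (0, a).
Definition uact u (a : A) : A := u.1 *: a + u.2 ** a.
Definition ract (a : A) u : A := u.1 *: a + a ** u.2.

Lemma uinD a b : uin (a + b) = uin a + uin b.
Proof. by congr pair; rewrite /= addr0. Qed.
Lemma uinN a : uin (- a) = - uin a.
Proof. by congr pair; rewrite /= oppr0. Qed.
Lemma uinB a b : uin (a - b) = uin a - uin b.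
Proof. by rewrite uinD uinN. Qed.
Lemma uinZ c a : uin (c *: a) = c *: uin a.
Proof. by congr pair; rewrite /= scaler0. Qed.
Lemma uinM a b : uin (a ** b) = uin a * uin b.
Proof. by congr pair; rewrite /= ?mul0r // !scale0r !add0r. Qed.
Lemma uin0 : uin 0 = 0. Proof. by []. Qed.
(** Identities in [A] that involve multipliers are verified after transport to [unitz A], where ring
    rewriting is available. *)
Lemma uin_inj : injective uin. Proof. by move=> a b []. Qed.
Lemma uin_uact u a : uin (uact u a) = u * uin a.
Proof. by congr pair; rewrite /= ?mulr0 // scale0r addr0. Qed.
Lemma uin_ract a u : uin (ract a u) = uin a * u.
Proof. by congr pair; rewrite /= ?mul0r // scale0r add0r. Qed.
Lemma unitz_starK : involutive unitz_star.
Proof. by case=> l a; rewrite /unitz_star /= starK conjcK. Qed.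
Lemma unitz_starD : {morph unitz_star : x y / x + y}.
Proof. by move=> u v; congr pair; rewrite /= ?starD ?rmorphD. Qed.
Lemma unitz_starZ c u : unitz_star (c *: u) = c^* *: unitz_star u.
Proof. by congr pair; rewrite /= ?starZ ?rmorphM. Qed.
Lemma unitz_starM u v : unitz_star (u * v) = unitz_star v * unitz_star u.
Proof.
congr pair; rewrite /= ?rmorphM 1?mulrC //.
by rewrite !starD !starZ starM [in RHS](addrC (v.1^* *: _)).
Qed.
Lemma unitz_star_uin a : unitz_star (uin a) = uin (star a).
Proof. by congr pair; exact: conjc0. Qed.

End UnitizationAlgebra.

(* Completeness is only asked locally, in [uncomplete]. *)
Record ucstar (R : realType) (U : algType R[i]) (st : U -> U) (N : U -> R) :
    Prop := UCstar {
  ustK : involutive st;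
  ustD : {morph st : x y / x + y};
  ustZ : forall (c : R[i]) x, st (c *: x) = c^* *: st x;
  ustM : forall x y, st (x * y) = st y * st x;
  un_ge0 : forall x, 0 <= N x;
  un_eq0 : forall x, N x = 0 -> x = 0;
  unD : forall x y, N (x + y) <= N x + N y;
  unZ : forall (c : R[i]) x, N (c *: x) = cabs c * N x;
  unM : forall x y, N (x * y) <= N x * N y;
  unS : forall x, N (st x * x) = N x ^+ 2;
  uncomplete : forall z, exists S : set U,
    [/\ S z, S 0, forall c x y, S x -> S y -> S (c *: x + y),
        forall x y, S x -> S y -> S (x * y) &
        forall v : nat -> U, (forall n, S (v n)) ->
        (forall e : R, 0 < e -> exists n0, forall m n,
           (n0 <= m)%N -> (n0 <= n)%N -> N (v m - v n) < e) ->
        exists l, forall e : R, 0 < e -> exists n0, forall n,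
           (n0 <= n)%N -> N (v n - l) < e]
}.

Section UnitizationNorm.
Context {R : realType} (A : starAlgType R) (N : A -> R).
Implicit Types u v : unitz A.

(* The maximum with the modulus of the scalar part makes the norm definite also
   when A has a unit. *)
Definition opnorm u : R :=
  sup [set r | exists2 v : A, N v <= 1 & r = N (uact u v)].
Definition unorm u : R := Num.max (cabs u.1) (opnorm u).

Hypothesis hN : cstar_norm N.

Lemma uact_bound u a : N (uact u a) <= (cabs u.1 + N u.2) * N a.
Proof.
rewrite (le_trans (cnD hN _ _)) // (cnZ hN) mulrDl lerD2l.
exact: cnM.
Qed.

Lemma opnorm_has_sup u :
  has_sup [set r | exists2 v : A, N v <= 1 & r = N (uact u v)].
Proof.
split; first by exists (N (uact u 0)), 0; rewrite ?(cn0 hN).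
exists (cabs u.1 + N u.2) => _ [v v1 ->].
rewrite (le_trans (uact_bound _ _)) // ler_piMr //.
by rewrite addr_ge0 ?cabs_ge0 ?cn_ge0.
Qed.

Lemma opnorm_ge0 u : 0 <= opnorm u.
Proof.
apply: (@le_trans _ _ (N (uact u 0))); first exact: cn_ge0.
apply: ub_le_sup; first by case: (opnorm_has_sup u).
by exists 0 => //; rewrite (cn0 hN).
Qed.

Lemma uactZ u c a : uact u (c *: a) = c *: uact u a.
Proof. by rewrite /uact scalerDr smulZr !scalerA mulrC. Qed.

Lemma uact_opnorm u a : N (uact u a) <= opnorm u * N a.
Proof.
have [a0|a0] := eqVneq (N a) 0.
  rewrite a0 mulr0 (cn_eq0 hN a0) /uact scaler0 smulr0 addr0.
  by rewrite (cn0 hN).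
have ap : 0 < N a by rewrite lt_neqAle eq_sym a0 cn_ge0.
have : N (uact u (((N a)^-1)%:C *: a)) <= opnorm u.
  apply: ub_le_sup; first by case: (opnorm_has_sup u).
  exists (((N a)^-1)%:C *: a) => //.
  by rewrite (cnZr hN) ger0_norm ?invr_ge0 ?cn_ge0 // mulVf.
rewrite uactZ (cnZr hN) ger0_norm ?invr_ge0 ?cn_ge0 //.
by rewrite ler_pdivrMl // mulrC.
Qed.

Lemma opnorm_le u K : 0 <= K -> (forall a, N (uact u a) <= K * N a) ->
  opnorm u <= K.
Proof.
move=> K0 h; apply: ge_sup; first by case: (opnorm_has_sup u).
by move=> _ [v v1 ->]; rewrite (le_trans (h v)) // ler_piMr.
Qed.

Lemma uact_unorm u a : N (uact u a) <= unorm u * N a.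
Proof.
by rewrite (le_trans (uact_opnorm _ _)) // ler_wpM2r ?cn_ge0 // le_max lexx orbT.
Qed.

Lemma unorm_le u K : cabs u.1 <= K -> (forall a, N (uact u a) <= K * N a) ->
  unorm u <= K.
Proof.
move=> uK h; rewrite ge_max uK opnorm_le //.
exact: le_trans (cabs_ge0 _) uK.
Qed.

Lemma cabs_unorm u : cabs u.1 <= unorm u.
Proof. by rewrite le_max lexx. Qed.

Lemma unorm_ge0 u : 0 <= unorm u.
Proof. exact: le_trans (cabs_ge0 _) (cabs_unorm u). Qed.

Lemma uactM u v a : uact (u * v) a = uact u (uact v a).
Proof. by apply: uin_inj; rewrite !uin_uact mulrA. Qed.

Lemma uactD u v a : uact (u + v) a = uact u a + uact v a.
Proof. by apply: uin_inj; rewrite uinD !uin_uact mulrDl. Qed.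

Lemma uactZl c u a : uact (c *: u) a = c *: uact u a.
Proof. by apply: uin_inj; rewrite uinZ !uin_uact scalerAl. Qed.

Lemma unorm_uin a : unorm (uin a) = N a.
Proof.
apply/eqP; rewrite eq_le; apply/andP; split.
  apply: unorm_le => [|b]; first by rewrite (cabs_real 0) normr0 cn_ge0.
  by rewrite /uact scale0r add0r cnM.
have [->|a0] := eqVneq a 0; first by rewrite (cn0 hN) unorm_ge0.
have pos : 0 < N (star a).
  rewrite lt_neqAle cn_ge0 // andbT eq_sym (cn_star hN).
  by apply: contra a0 => /eqP/(cn_eq0 hN) ->.
rewrite -(ler_pM2r pos) (le_trans _ (uact_unorm _ _)) //.
by rewrite /uact scale0r add0r (cn_sq hN) (cn_star hN) expr2.
Qed.

Lemma uact_sq u a :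
  N (uact u a) ^+ 2 <= unorm (unitz_star u * u) * N a ^+ 2.
Proof.
rewrite -(cnS hN).
have -> : star (uact u a) ** uact u a
    = star a ** uact (unitz_star u * u) a.
  apply: uin_inj; rewrite !uinM !uin_uact -!unitz_star_uin uin_uact.
  by rewrite unitz_starM !mulrA.
rewrite (le_trans (cnM hN _ _)) // (cn_star hN) mulrC expr2 mulrA.
by rewrite ler_wpM2r ?cn_ge0 ?uact_unorm.
Qed.

Lemma unormM u v : unorm (u * v) <= unorm u * unorm v.
Proof.
apply: unorm_le => [|a].
  by rewrite cabsM ler_pM ?cabs_ge0 ?cabs_unorm.
rewrite uactM (le_trans (uact_unorm _ _)) // -mulrA.
by rewrite ler_wpM2l ?unorm_ge0 ?uact_unorm.
Qed.

Lemma unorm_eq0 u : unorm u = 0 -> u = 0.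
Proof.
move=> u0; have : cabs u.1 = 0.
  by apply/le_anti; rewrite cabs_ge0 -u0 cabs_unorm.
move/cabs0_eq; case: u u0 => l a /= + l0; rewrite l0 => u0.
have : N a = 0 by rewrite -unorm_uin.
by move/(cn_eq0 hN) ->.
Qed.

Lemma unormD u v : unorm (u + v) <= unorm u + unorm v.
Proof.
apply: unorm_le => [|a].
  by rewrite (le_trans (cabsD _ _)) // lerD ?cabs_unorm.
by rewrite uactD (le_trans (cnD hN _ _)) // mulrDl lerD ?uact_unorm.
Qed.

Lemma unormZ_le c u : unorm (c *: u) <= cabs c * unorm u.
Proof.
apply: unorm_le => [|a].
  by rewrite cabsM ler_wpM2l ?cabs_ge0 ?cabs_unorm.
by rewrite uactZl (cnZ hN) -mulrA ler_wpM2l ?cabs_ge0 ?uact_unorm.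
Qed.

Lemma unormZ c u : unorm (c *: u) = cabs c * unorm u.
Proof.
apply/le_anti; rewrite unormZ_le /=.
have [->|c0] := eqVneq c 0.
  by rewrite (cabs_real 0) normr0 mul0r unorm_ge0.
have cp : 0 < cabs c.
  rewrite lt_neqAle cabs_ge0 andbT eq_sym.
  by apply: contra c0 => /eqP/cabs0_eq ->.
have := unormZ_le c^-1 (c *: u); rewrite scalerA mulVf // scale1r.
have -> : cabs c^-1 = (cabs c)^-1.
  apply: (mulfI (lt0r_neq0 cp)); rewrite -cabsM (divff c0) (divff (lt0r_neq0 cp)).
  by rewrite (cabs_real 1) normr1.
by rewrite ler_pdivlMl.
Qed.

(** The maximum is attained either by the scalar part, where this is the identity for complex
    moduli, or by the operator norm, where it follows from [uact_sq]. *)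
Lemma unormS_ge u : unorm u ^+ 2 <= unorm (unitz_star u * u).
Proof.
have [|le1] := leP (cabs u.1) (opnorm u); last first.
  rewrite /unorm max_l ?(ltW le1) //.
  rewrite (le_trans _ (cabs_unorm _)) //= cabsM cabs_conj expr2.
  exact: lexx.
move=> le1; rewrite {1}/unorm max_r //.
rewrite -[leRHS]sqr_sqrtr ?unorm_ge0 // ler_pXn2r ?nnegrE ?sqrtr_ge0 ?opnorm_ge0 //.
apply: opnorm_le; rewrite ?sqrtr_ge0 // => a.
rewrite -(@ler_pXn2r _ 2) ?nnegrE ?mulr_ge0 ?sqrtr_ge0 ?cn_ge0 //.
by rewrite exprMn sqr_sqrtr ?unorm_ge0 // uact_sq.
Qed.

Lemma unorm_star_le u : unorm (unitz_star u) <= unorm u.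
Proof.
apply: unorm_le => [|a]; first by rewrite /= cabs_conj cabs_unorm.
have [->|x0] := eqVneq (uact (unitz_star u) a) 0.
  by rewrite (cn0 hN) mulr_ge0 ?unorm_ge0 ?cn_ge0.
set b := uact _ a in x0 *.
have pos : 0 < N b.
  rewrite lt_neqAle cn_ge0 // andbT eq_sym.
  by apply: contra x0 => /eqP/(cn_eq0 hN) ->.
rewrite -(ler_pM2r pos) -expr2 -(cnS hN).
have -> : star b ** b = star a ** uact u b.
  apply: uin_inj; rewrite !uinM !uin_uact -!unitz_star_uin /b uin_uact.
  by rewrite unitz_starM unitz_starK !mulrA.
rewrite (le_trans (cnM hN _ _)) // (cn_star hN) [unorm u * _]mulrC -mulrA.
by rewrite ler_wpM2l ?cn_ge0 ?uact_unorm.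
Qed.

Lemma unormS u : unorm (unitz_star u * u) = unorm u ^+ 2.
Proof.
apply/le_anti; rewrite unormS_ge andbT (le_trans (unormM _ _)) // expr2.
by rewrite ler_wpM2r ?unorm_ge0 ?unorm_star_le.
Qed.

Lemma real_cauchy (v : nat -> R) :
  (forall e, 0 < e -> exists n0, forall m n, (n0 <= m)%N -> (n0 <= n)%N ->
     `|v m - v n| < e) ->
  exists l, forall e, 0 < e -> exists n0, forall n, (n0 <= n)%N -> `|v n - l| < e.
Proof.
move=> h; have cv : cvgn v.
  apply/cauchy_cvgP/cauchy_exP => e e0; have [n0 hn0] := h e e0.
  by exists (v n0); exists n0 => // k /= hk; apply: hn0.
exists (limn v) => e e0.
have /cvgrPdist_lt/(_ e e0)[n0 _ hn0] : v @ \oo --> limn v by [].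
by exists n0 => n hn; rewrite distrC hn0.
Qed.

Lemma unorm1 : unorm 1 <= 1.
Proof.
apply: unorm_le => [|a]; first by rewrite (cabs_real 1) normr1.
by rewrite /uact scale1r smul0r addr0 mul1r.
Qed.

Lemma unorm_ucstar : local_cstar_norm N -> ucstar (@unitz_star R A) unorm.
Proof.
case=> _ [I [F [sF dF cF]]]; split.
- exact: unitz_starK.
- exact: unitz_starD.
- exact: unitz_starZ.
- exact: unitz_starM.
- exact: unorm_ge0.
- exact: unorm_eq0.
- exact: unormD.
- exact: unormZ.
- exact: unormM.
- exact: unormS.
move=> z; have [i _ Fz] : (\bigcup_i F i) z.2 by rewrite cF.
have [F0 FZ FM _ Fc] := sF i.
(* Completeness is componentwise: [unorm] dominates the scalar part, hence also controls the part in
   [A], which is [u - u.1 *: 1], and [F i] is complete. *)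
exists [set u | F i u.2]; split=> //.
- by move=> c x y Sx Sy; apply: FZ.
- move=> x y Sx Sy; rewrite /= -addrA; apply: (FZ) => //.
  by apply: FZ => //; apply: FM.
move=> v Sv hv.
have [lr hlr] : exists l : R, forall e, 0 < e -> exists n0, forall n,
    (n0 <= n)%N -> `|complex.Re (v n).1 - l| < e.
  apply: real_cauchy => e /hv[n0 hn0]; exists n0 => m n hm hn.
  rewrite -raddfB (le_lt_trans (cabs_Re _)) //.
  by rewrite (le_lt_trans (cabs_unorm (v m - v n))) ?hn0.
have [li hli] : exists l : R, forall e, 0 < e -> exists n0, forall n,
    (n0 <= n)%N -> `|complex.Im (v n).1 - l| < e.
  apply: real_cauchy => e /hv[n0 hn0]; exists n0 => m n hm hn.
  rewrite -raddfB (le_lt_trans (cabs_Im _)) //.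
  by rewrite (le_lt_trans (cabs_unorm (v m - v n))) ?hn0.
have uin2 u : uin u.2 = u - u.1 *: 1.
  by congr pair; rewrite /= ?scaler0 ?subr0 // -[_ *: _]/(_ * _) mulr1 subrr.
have N2 u : N u.2 <= unorm u + cabs u.1.
  rewrite -unorm_uin uin2 (le_trans (unormD _ _)) // lerD2l -scaleNr unormZ.
  by rewrite cabsN ler_piMr ?cabs_ge0 ?unorm1.
have [l2 _ hl2] : exists2 l, F i l & N ((v n).2 - l) @[n --> \oo] --> (0 : R).
  apply: Fc => // e e0.
  have e2 : 0 < e / 2 by rewrite divr_gt0.
  have [n0 hn0] := hv _ e2; exists n0 => m n hm hn.
  rewrite (le_lt_trans (N2 (v m - v n))) // [ltRHS]splitr ltrD ?hn0 //.
  by rewrite (le_lt_trans (cabs_unorm _)) ?hn0.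
exists ((lr +i* li)%C, l2) => e e0.
have e3 : 0 < e / 3 by rewrite divr_gt0.
have [n1 h1] := hlr _ e3; have [n2 h2] := hli _ e3.
have /cvgr0Pnorm_lt/(_ _ e3)[n3 _ h3] := hl2.
exists (maxn n1 (maxn n2 n3)) => n; rewrite !geq_max => /and3P[m1 m2 m3].
set d := v n - _.
have le_d : unorm d <= cabs d.1 + N d.2.
  rewrite -(unorm_uin d.2) -[leLHS]/(unorm d) -{1}(subrK (d.1 *: 1) d) -uin2.
  rewrite addrC (le_trans (unormD _ _)) // lerD2r unormZ.
  by rewrite ler_piMr ?cabs_ge0 ?unorm1.
rewrite (le_lt_trans le_d) //.
have -> : e = e / 3 + e / 3 + e / 3 by field.
rewrite ltrD //; last by have := h3 n m3; rewrite ger0_norm ?cn_ge0.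
rewrite (le_lt_trans (cabs_le_ReIm _)) // ltrD //.
  by rewrite /d raddfB /= h1.
by rewrite /d raddfB /= h2.
Qed.

End UnitizationNorm.

(** * Functional calculus in unital C*-algebras *)

(** Stands in for the spectral radius formula. With [c = 1 + d], Bernoulli alone gives only growth
    of order 2^n; squaring it bounds the power of exponent 2^(n+1) below by a multiple of 4^n, which
    beats [K * 2 ^+ n]. *)
Lemma growth_le1 (R : realType) (c K : R) : 0 <= c ->
  (forall n, c ^+ (2 ^ n)%N <= K * 2 ^+ n) -> c <= 1.
Proof.
move=> c0 h; rewrite leNgt; apply/negP => c1.
pose d := c - 1; have d0 : 0 < d by rewrite subr_gt0.
have bern m : 1 + m%:R * d <= c ^+ m.
  elim: m => [|m ih]; first by rewrite mul0r addr0 expr0.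
  rewrite exprS (@le_trans _ _ (c * (1 + m%:R * d))) //; last first.
    by rewrite ler_wpM2l.
  have -> : c = 1 + d by rewrite /d addrC subrK.
  have : 0 <= m%:R * d * d by rewrite !mulr_ge0 ?(ltW d0).
  by rewrite -natr1; lra.
have sq n : (2 ^+ n * d) ^+ 2 <= 2 * K * 2 ^+ n.
  have := h n.+1; rewrite exprS -mulrA [K * (_ * _)]mulrCA mulrA.
  apply: le_trans; rewrite expnSr exprM ler_pXn2r ?nnegrE ?exprn_ge0 ?mulr_ge0 ?exprn_ge0 ?(ltW d0) //.
  by rewrite -natrX (le_trans _ (bern _)) // lerDr.
have sq' n : 2 ^+ n <= 2 * K / d ^+ 2.
  rewrite ler_pdivlMr ?exprn_gt0 // -(@ler_pM2r _ (2 ^+ n)) ?exprn_gt0 //.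
  by rewrite (le_trans _ (sq n)) // exprMn; lra.
have h0 : 0 <= 2 * K / d ^+ 2 by rewrite (le_trans _ (sq' 0%N)).
have [n hn] : exists n : nat, 2 * K / d ^+ 2 < n%:R.
  by exists (Num.bound (2 * K / d ^+ 2)); exact: archi_boundP.
have nn : n%:R <= 2 ^+ n :> R by rewrite -natrX ler_nat ltnW // ltn_expl.
by have := lt_le_trans hn (le_trans nn (sq' n)); rewrite ltxx.
Qed.

Section UnitalCstar.
Context {R : realType} {U : algType R[i]} {st : U -> U} {N : U -> R}.
Hypothesis hU : ucstar st N.
Implicit Types x y z : U.

#[local] Instance nc_opsU :
  @Ncring.Ring_ops U 0 1 +%R *%R (fun x y => x - y) -%R eq := nc_ops U.
#[local] Instance nc_ringU :
  @Ncring.Ring U 0 1 +%R *%R (fun x y => x - y) -%R eq nc_opsU := nc_ring U.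

Local Notation half := ((2^-1 : R)%:C).

Lemma unZr (r : R) x : N (r%:C *: x) = `|r| * N x.
Proof. by rewrite (unZ hU) cabs_real. Qed.

Lemma un0 : N 0 = 0.
Proof. by rewrite -(scale0r 0) (unZr 0) normr0 mul0r. Qed.

Lemma unN x : N (- x) = N x.
Proof. by rewrite -scaleN1r -(rmorphN1 (real_complex R)) unZr normrN1 mul1r. Qed.

Lemma unB x y : N (x - y) <= N x + N y.
Proof. by rewrite -(unN y) (unD hU). Qed.

Lemma un_distC x y : N (x - y) = N (y - x).
Proof. by rewrite -unN opprB. Qed.

Lemma un_sum (I : Type) (r : seq I) (P : pred I) (F : I -> U) :
  N (\sum_(i <- r | P i) F i) <= \sum_(i <- r | P i) N (F i).
Proof.
elim/big_rec2: _ => [|i y z _ h]; first by rewrite un0.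
by rewrite (le_trans (unD hU _ _)) // lerD2l.
Qed.

Lemma un_small0 x : (forall e, 0 < e -> N x <= e) -> x = 0.
Proof.
move=> h; apply: (un_eq0 hU); apply/le_anti; rewrite (un_ge0 hU) andbT.
by apply/ler_addgt0Pr => e e0; rewrite add0r h.
Qed.

Lemma un_half x : N (half *: x) = N x / 2.
Proof. by rewrite unZr ger0_norm ?invr_ge0 // mulrC. Qed.

Lemma ust0 : st 0 = 0.
Proof. by rewrite -[X in st X](scale0r 0) (ustZ hU) rmorph0 scale0r. Qed.

Lemma ustN x : st (- x) = - st x.
Proof. by apply/eqP; rewrite -addr_eq0 -(ustD hU) addNr ust0. Qed.

Lemma ustB x y : st (x - y) = st x - st y.
Proof. by rewrite (ustD hU) ustN. Qed.

Lemma ustZr (r : R) x : st (r%:C *: x) = r%:C *: st x.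
Proof. by rewrite (ustZ hU) conj_real. Qed.

Lemma ust1 : st 1 = 1.
Proof. by rewrite -[LHS]mulr1 -{2}(ustK hU 1) -(ustM hU) mulr1 (ustK hU). Qed.

Lemma ust_sum (I : Type) (r : seq I) (P : pred I) (F : I -> U) :
  st (\sum_(i <- r | P i) F i) = \sum_(i <- r | P i) st (F i).
Proof. by elim/big_rec2: _ => [|i y z _ <-]; rewrite ?ust0 // (ustD hU). Qed.

Lemma ustX x n : st x = x -> st (x ^+ n) = x ^+ n.
Proof.
move=> sx; elim: n => [|n ih]; first by rewrite expr0 ust1.
by rewrite exprS (ustM hU) ih sx -exprS exprSr.
Qed.

Lemma un1 : N 1 = 1.
Proof.
have /eqP : N 1 = N 1 ^+ 2 by rewrite -(unS hU) ust1 mulr1.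
rewrite -subr_eq0 -{1}(mulr1 (N 1)) expr2 -mulrBr mulf_eq0 => /orP[/eqP h|].
  by have /eqP := un_eq0 hU h; rewrite oner_eq0.
by rewrite subr_eq0 eq_sym => /eqP.
Qed.

Lemma un_star_le x : N (st x) <= N x.
Proof.
have [->|x0] := eqVneq (st x) 0; first by rewrite un0 (un_ge0 hU).
have pos : 0 < N (st x).
  rewrite lt_neqAle (un_ge0 hU) andbT eq_sym.
  by apply: contra x0 => /eqP/(un_eq0 hU) ->.
rewrite -(ler_pM2l pos) -expr2 -(unS hU) (ustK hU) [leRHS]mulrC.
exact: (unM hU).
Qed.

Lemma un_star x : N (st x) = N x.
Proof. by apply/eqP; rewrite eq_le un_star_le -{1}(ustK hU x) un_star_le. Qed.

Lemma un_sq x : N (x * st x) = N x ^+ 2.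
Proof. by rewrite -{1}(ustK hU x) (unS hU) un_star. Qed.

Lemma un_sa x : st x = x -> N (x * x) = N x ^+ 2.
Proof. by move=> sx; rewrite -{1}sx (unS hU). Qed.

Lemma unX x n : N x <= 1 -> N (x ^+ n) <= 1.
Proof.
move=> x1; elim: n => [|n ih]; first by rewrite expr0 un1.
by rewrite exprS (le_trans (unM hU _ _)) // mulr_ile1 ?(un_ge0 hU).
Qed.

Lemma unM_le1 x y : N x <= 1 -> N y <= 1 -> N (x * y) <= 1.
Proof. by move=> *; rewrite (le_trans (unM hU _ _)) // mulr_ile1 ?(un_ge0 hU). Qed.

Lemma un_half_add x y c : N x <= c -> N y <= c -> N (half *: (x + y)) <= c.
Proof.
move=> hx hy; rewrite un_half ler_pdivrMr // (le_trans (unD hU _ _)) //.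
by rewrite mulr_natr mulr2n lerD.
Qed.

Definition uclosed (P : set U) :=
  forall l, (forall e, 0 < e -> exists2 x, P x & N (l - x) < e) -> P l.

(** The equation reads w = (z + w^2) / 2 and is solved by iteration from 0. The last clause is an
    induction principle for the limit: self-adjointness, commutation and membership in ideals all
    pass from [z] to [w] through it. *)
Lemma usqrt_ex z : N z <= 1 -> exists w,
  [/\ (1 - w) * (1 - w) = 1 - z, N w <= 1 &
    forall P : set U, uclosed P -> P 0 ->
      (forall x, P x -> P (half *: (z + x * x))) -> P w].
Proof.
move=> z1.
pose fix w n := if n is m.+1 then half *: (z + w m * w m) else 0.
(* [1 - e n] is the same iteration run on the number 1, so it majorizes the norms. At this boundary
   value there is no geometric contraction, and [e n] decays only like 2 / n. *)
pose fix e n : R := if n is m.+1 then e m - e m ^+ 2 / 2 else 1.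
have e01 n : 0 <= e n <= 1.
  by elim: n => [|n /andP[e0 e1]] /=; rewrite ?ler01 ?lexx //; apply/andP; split; nra.
have Nw n : N (w n) <= 1 - e n.
  elim: n => [|n ih] /=; first by rewrite un0 subrr.
  rewrite un_half ler_pdivrMr // (le_trans (unD hU _ _)) //.
  have : N (w n * w n) <= (1 - e n) * (1 - e n).
    by rewrite (le_trans (unM hU _ _)) // ler_pM ?(un_ge0 hU).
  lra.
have Nw1 n : N (w n) <= 1 by have := Nw n; have := e01 n; lra.
have Nsq x y : N (x * x - y * y) <= N (x - y) * (N x + N y).
  have -> : x * x - y * y = x * (x - y) + (x - y) * y.
    by Ncring_tac.non_commutative_ring.
  rewrite (le_trans (unD hU _ _)) // [leRHS]mulrDr lerD //.
    by rewrite mulrC (unM hU).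
  exact: (unM hU).
have wS n : w n.+1 = half *: (z + w n * w n) by [].
have Nd n : N (w n.+1 - w n) <= e n - e n.+1.
  elim: n => [|n ih].
    rewrite /= subr0 mulr0 addr0 un_half expr1n; lra.
  rewrite (wS n.+1) -[X in _ - X]/(half *: (z + w n * w n)).
  rewrite -scalerBr opprD addrACA subrr add0r un_half ler_pdivrMr //.
  rewrite (le_trans (Nsq _ _)) //.
  apply: (@le_trans _ _ ((e n - e n.+1) * (1 - e n.+1 + (1 - e n)))).
    by rewrite ler_pM ?addr_ge0 ?(un_ge0 hU) // lerD.
  have : e n.+1 = e n - e n ^+ 2 / 2 by [].
  have : e n.+2 = e n.+1 - e n.+1 ^+ 2 / 2 by [].
  move: (e n) (e n.+1) (e n.+2) => a b c -> ?; lra.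
have Nwd m n : N (w (n + m)%N - w n) <= e n - e (n + m)%N.
  elim: m => [|m ih]; first by rewrite addn0 !subrr un0.
  rewrite addnS -[w _.+1 - _](subrKA (w (n + m)%N)) (le_trans (unD hU _ _)) //.
  have := Nd (n + m)%N; move: ih; lra.
have e_small n : e n <= 2 / n.+1%:R.
  elim: n => [|n ih]; first by rewrite /= divr1 ler1n.
  (* The induction uses that t - t^2 / 2 increases on [0, 1], so the comparison value 2 / m must
     already be at most 1. *)
  case: n ih => [_|n ih]; first by rewrite /= expr1n; lra.
  set m : R := n.+2%:R in ih; rewrite -[n.+3%:R]natr1 -/m.
  have m2 : 2 <= m by rewrite ler_nat.
  have m0 : 0 < m by lra.
  have t1 : 2 / m <= 1 by rewrite ler_pdivrMr // mul1r.
  apply: (@le_trans _ _ (2 / m - (2 / m) ^+ 2 / 2)).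
    have := e01 n.+1; rewrite -[e n.+2]/(e n.+1 - e n.+1 ^+ 2 / 2).
    move: ih t1; set x := e n.+1; set t := 2 / m => xt t1 /andP[x0 x1].
    have : 0 <= (t - x) * (1 - (t + x) / 2) by rewrite mulr_ge0; lra.
    lra.
  rewrite ler_pdivlMr ?addr_gt0 //.
  have -> : (2 / m - (2 / m) ^+ 2 / 2) * (m + 1) = 2 - 2 / m ^+ 2.
    by field; rewrite gt_eqF.
  by rewrite gerBl divr_ge0 ?exprn_ge0 // ltW.
have e_lim (d : R) : 0 < d -> exists n0, forall n, (n0 <= n)%N -> e n < d.
  move=> d0; have h0 : 0 <= 2 / d by rewrite divr_ge0 ?ltW.
  exists (Num.bound (2 / d)) => n hn; rewrite (le_lt_trans (e_small n)) //.
  rewrite ltr_pdivrMr // mulrC -ltr_pdivrMr // (lt_le_trans (archi_boundP h0)) //.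
  by rewrite ler_nat ltnW.
have [S [Sz S0 SZ SM Sc]] := uncomplete hU z.
have Sw n : S (w n).
  elim: n => [//|n ih]; rewrite wS -[_ *: _]addr0; apply: (SZ) => //.
  by rewrite -[z]scale1r; apply: (SZ) => //; apply: SM.
have [l hl] : exists l, forall d, 0 < d -> exists n0, forall n,
    (n0 <= n)%N -> N (w n - l) < d.
  apply: Sc => // d /e_lim[n0 hn0]; exists n0.
  have key m n : (n0 <= n)%N -> (n <= m)%N -> N (w m - w n) < d.
    move=> hn /subnKC <-; rewrite (le_lt_trans (Nwd _ _)) //.
    have := hn0 n hn; have := e01 (n + (m - n))%N; lra.
  move=> m n hm hn; have [mn|nm] := leqP n m; first exact: key.
  by rewrite un_distC key // ltnW.
have l1 : N l <= 1.
  apply/ler_addgt0Pr => d /hl[n0 /(_ n0 (leqnn _)) hn0].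
  have := unD hU (w n0) (l - w n0); rewrite [w n0 + _]addrC subrK un_distC.
  by have := Nw1 n0; move: hn0; lra.
have lE : l = half *: (z + l * l).
  apply/eqP; rewrite -subr_eq0; apply/eqP/un_small0 => d d0.
  have d2 : 0 < d / 2 by rewrite divr_gt0.
  have [n0 hn0] := hl _ d2.
  rewrite -(subrKA (w n0.+1)) (le_trans (unD hU _ _)) //.
  rewrite wS -scalerBr opprD addrACA subrr add0r un_half -wS un_distC.
  have := hn0 n0.+1 (leqnSn _); have := hn0 n0 (leqnn _).
  have : N (w n0 * w n0 - l * l) <= N (w n0 - l) * 2.
    rewrite (le_trans (Nsq _ _)) // ler_wpM2l ?(un_ge0 hU) //.
    by have := Nw1 n0; lra.
  lra.
exists l; split=> //.
  have h2 : l + l = z + l * l by rewrite {1 2}lE -scalerDr scale_half2.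
  transitivity (1 - (l + l) + l * l); first by Ncring_tac.non_commutative_ring.
  by rewrite h2 opprD addrA subrK.
move=> P Pc P0 PS; apply: Pc => d /hl[n0 hn0]; exists (w n0).
  by elim: n0 {hn0} => //= n0 ih; apply: PS.
by rewrite un_distC hn0.
Qed.


Lemma uclosed_eq (f g : U -> U) (K : R) :
  (forall x y, N (f x - f y) <= K * N (x - y)) ->
  (forall x y, N (g x - g y) <= K * N (x - y)) ->
  uclosed [set x | f x = g x].
Proof.
move=> hf hg l h /=; apply/eqP; rewrite -subr_eq0; apply/eqP/un_small0 => e e0.
have K0 : 0 < `|K| + 1 by rewrite ltr_wpDl.
have [x /= fg hx] := h (e / (2 * (`|K| + 1))) (ltac:(by rewrite divr_gt0 ?mulr_gt0)).
rewrite -(subrKA (f x)) {2}fg (le_trans (unD hU _ _)) //.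
have : N (l - x) * (`|K| + 1) <= e / 2.
  by rewrite -ler_pdivlMr // -mulrA -invfM ltW.
have := hf l x; have := hg x l; rewrite (un_distC x l).
have : K * N (l - x) <= `|K| * N (l - x) by rewrite ler_wpM2r ?(un_ge0 hU) ?ler_norm.
have := un_ge0 hU (l - x); lra.
Qed.

Lemma un_mulBl x y z : N (x * y - x * z) <= N x * N (y - z).
Proof. by rewrite -mulrBr (unM hU). Qed.

Lemma un_mulBr x y z : N (y * x - z * x) <= N x * N (y - z).
Proof. by rewrite -mulrBl mulrC (unM hU). Qed.

(** Closed left ideals pass from an element to its functions vanishing at 0. Applied to
    annihilators, see [uann_ideal], they carry orthogonality relations through the slicing below. *)
Definition uleft_ideal (J : set U) :=
  [/\ uclosed J, J 0, forall x y, J x -> J y -> J (x + y),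
      forall (c : R[i]) x, J x -> J (c *: x) & forall x y, J y -> J (x * y)].

Lemma uann_ideal v : uleft_ideal [set x | x * v = 0].
Proof.
split=> /=; [|by rewrite mul0r|by move=> x y hx hy; rewrite mulrDl hx hy addr0| |].
- apply: (@uclosed_eq (fun x => x * v) (fun=> 0) (N v)) => x y.
    exact: un_mulBr.
  by rewrite subrr un0 mulr_ge0 ?(un_ge0 hU).
- by move=> c x hx; rewrite -scalerAl hx scaler0.
- by move=> x y hy; rewrite -mulrA hy mulr0.
Qed.

Lemma usqrt z : st z = z -> N z <= 1 -> exists w,
  [/\ (1 - w) * (1 - w) = 1 - z, st w = w, N w <= 1,
    forall a, z * a = a * z -> w * a = a * w &
    forall J, uleft_ideal J -> J z -> J w].
Proof.
move=> sz /usqrt_ex[w [ww w1 hw]]; exists w; split=> //.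
- apply: (hw [set x | st x = x]) => [||x /= sx]; last 1 first.
  - by rewrite ustZr (ustD hU) (ustM hU) sx sz.
  - apply: (@uclosed_eq st id 1) => x y; last by rewrite mul1r.
    by rewrite -ustB un_star mul1r.
  - exact: ust0.
- move=> a za; apply: (hw [set x | x * a = a * x]); rewrite /= ?mul0r ?mulr0 //.
    apply: (@uclosed_eq (fun x => x * a) (fun x => a * x) (N a)) => x y.
      exact: un_mulBr.
    exact: un_mulBl.
  move=> x /= xa; rewrite -scalerAl -scalerAr; congr (_ *: _).
  by rewrite mulrDl mulrDr za -mulrA xa !mulrA xa.
- move=> J [Jc J0 JD JZ JM] Jz; apply: hw => // x Jx.
  by apply: JZ; apply: JD => //; apply: JM.
Qed.

(* y + i s is unitary. *)
Lemma ucomplement y : st y = y -> N y <= 1 -> exists s,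
  [/\ s * s = 1 - y * y, st s = s, N s <= 1, y * s = s * y & N (s * s - y * y) <= 1].
Proof.
move=> sy y1; have [||w [ww sw w1 cw _]] := @usqrt (y * y).
- by rewrite (ustM hU) sy.
- exact: unM_le1.
pose s := 1 - w; have ss : st s = s by rewrite ustB ust1 sw.
have ys : y * s = s * y.
  by rewrite /s mulrBr mulrBl mulr1 mul1r cw // mulrA.
have s2 : s * s = 1 - y * y := ww.
pose j := 'i *: s; pose u := y + j; pose v := y - j.
have jj : j * j = - (s * s).
  have ii : 'i * 'i = -1 :> R[i] by rewrite -expr2 sqr_i.
  by rewrite -scalerAl -scalerAr scalerA ii scaleN1r.
have yj : y * j = j * y by rewrite -scalerAl -scalerAr ys.
have su : st u = v.
  rewrite (ustD hU) (ustZ hU) sy ss /v /j -scaleNr; congr (_ + _ *: _).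
  exact: conj_i.
have vu : v * u = 1.
  transitivity (y * y - j * j + (y * j - j * y)).
    by rewrite /u /v; Ncring_tac.non_commutative_ring.
  by rewrite yj subrr jj opprK s2 addr0 addrC subrK.
have Nu : N u <= 1.
  rewrite -(@ler_pXn2r _ 2) ?nnegrE ?(un_ge0 hU) // -(unS hU) su vu un1.
  by rewrite expr1n.
have Nv : N v <= 1 by rewrite -su un_star.
exists s; split=> //.
  have <- : N j = N s by rewrite (unZ hU) cabs_i mul1r.
  have -> : j = half *: (u - v).
    rewrite -[LHS]scale_half2; congr (_ *: _).
    by rewrite /u /v; Ncring_tac.non_commutative_ring.
  by apply: un_half_add; rewrite ?unN.
rewrite -unN.
have -> : - (s * s - y * y) = half *: (u * u + v * v).
  rewrite opprB -[LHS]scale_half2 -jj; congr (_ *: _).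
  by rewrite /u /v; Ncring_tac.non_commutative_ring.
by apply: un_half_add; apply: unM_le1.
Qed.

Lemma un_pow2 x n : st x = x -> N (x ^+ (2 ^ n)%N) = N x ^+ (2 ^ n)%N.
Proof.
move=> sx; elim: n => [|n ih]; first by rewrite !expr1.
by rewrite expnSr exprM expr2 un_sa ?ustX // ih -exprM.
Qed.

(** [m] is the absolute value of [b]. Its positivity, the bound on [1 - (m + m)], comes from a
    second square root [m = r * r] and [ucomplement] applied to [r]. *)
Lemma uabs b : st b = b -> N b <= 1 -> exists m,
  [/\ m * m = b * b, st m = m /\ N m <= 1, N (1 - (m + m)) <= 1,
    forall a, b * a = a * b -> m * a = a * m &
    forall J, uleft_ideal J -> J (1 - b * b) -> J (1 - m)].
Proof.
move=> sb b1; have [s [ss _ s1 _ _]] := ucomplement sb b1.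
have [||w [ww sw w1 cw Jw]] := @usqrt (1 - b * b).
- by rewrite ustB ust1 (ustM hU) sb.
- by rewrite -ss unM_le1.
pose m := 1 - w; have mm : m * m = b * b by rewrite /m ww subKr.
have sm : st m = m by rewrite ustB ust1 sw.
have m1 : N m <= 1.
  by rewrite -(@ler_pXn2r _ 2) ?nnegrE ?(un_ge0 hU) // expr1n -un_sa // mm unM_le1.
have [w' [ww' sw' _ _ _]] := usqrt sw w1.
pose r := 1 - w'; have sr : st r = r by rewrite ustB ust1 sw'.
have rr : r * r = m by [].
have r1 : N r <= 1.
  by rewrite -(@ler_pXn2r _ 2) ?nnegrE ?(un_ge0 hU) // expr1n -un_sa // rr.
have [s' [ss' _ _ _ h']] := ucomplement sr r1.
exists m; split=> //.
- by rewrite ss' rr in h'; rewrite opprD addrA.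
- move=> a ba; rewrite /m mulrBl mulrBr mul1r mulr1 cw //.
  by rewrite mulrBl mulrBr mul1r mulr1 -mulrA ba mulrA ba -mulrA.
by move=> J hJ Jb; rewrite subKr; apply: Jw.
Qed.

(* In functional calculus the elements below are 1 - 2 b_+ and b_+ |b| = b_+^2, so
   the powers of 1 - 2 b_+ grow at most linearly. *)
Lemma un_reflect_pos b m : st b = b -> N b <= 1 -> st m = m -> m * m = b * b ->
  N m <= 1 -> m * b = b * m -> N (1 - (m + m)) <= 1 -> N (1 - (m + b)) <= 1.
Proof.
move=> sb b1 sm mm m1 mb m2; set x := 1 - (m + b).
have step n : (m + b) * x ^+ n = (m + b) * (1 - (m + m)) ^+ n.
  elim: n => [|n ih]; first by rewrite !expr0.
  have h : (m + b) * x = (m + b) * (1 - (m + m)).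
    transitivity ((m + b) - m * m - b * b - (m * b + b * m)).
      by rewrite /x; Ncring_tac.non_commutative_ring.
    by rewrite -mm mb; Ncring_tac.non_commutative_ring.
  have h' : (m + b) * (1 - (m + m)) = (1 - (m + m)) * (m + b).
    transitivity ((m + b) - (m * m + m * m) - (b * m + b * m)).
      by Ncring_tac.non_commutative_ring.
    by rewrite -mb; Ncring_tac.non_commutative_ring.
  by rewrite exprS mulrA h h' -mulrA ih mulrA -h' -mulrA -exprS.
have sx : st x = x by rewrite ustB ust1 (ustD hU) sm sb.
have grow n : N (x ^+ n) <= 1 + 2 * n%:R.
  elim: n => [|n ih]; first by rewrite expr0 un1 mulr0 addr0.
  have -> : x ^+ n.+1 = x ^+ n - (m + b) * (1 - (m + m)) ^+ n.
    by rewrite -step exprS {1}/x mulrBl mul1r.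
  rewrite (le_trans (unB _ _)) // -[n.+1%:R]natr1 [2 * _]mulrDr mulr1 addrA lerD //.
  rewrite (le_trans (unM hU _ _)) // -[leRHS]mulr1 ler_pM ?(un_ge0 hU) ?unX //.
  by rewrite (le_trans (unD hU _ _)) // (natrD _ 1 1) lerD.
apply: (@growth_le1 _ _ 3) => [|n]; first exact: un_ge0 hU _.
rewrite -un_pow2 // (le_trans (grow _)) // natrX.
have : 1 <= 2 ^+ n :> R by rewrite exprn_ege1 // ler1n.
lra.
Qed.

Lemma u2_eq0 x : x + x = 0 -> x = 0.
Proof. by move=> h; rewrite -[x]scale_half2 h scaler0. Qed.

(* In functional calculus, p = min (2 k) 1 and q = max (2 k - 1) 0. *)
Lemma uslice k : st k = k -> N (1 - (k + k)) <= 1 -> exists p q,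
  [/\ st p = p /\ N (1 - (p + p)) <= 1, st q = q /\ N (1 - (q + q)) <= 1,
    p + q = k + k, (1 - p) * q = 0 &
    forall J, uleft_ideal J -> (J k -> J p /\ J q) /\
      (J (1 - k) -> J (1 - p) /\ J (1 - q))].
Proof.
move=> sk k1; pose b := 1 - (k + k).
have sb : st b = b by rewrite ustB ust1 (ustD hU) sk.
have [m [mm [sm m1] m2 cm Jm]] := uabs sb k1.
have mb : m * b = b * m by apply: cm.
(* As [m] is the modulus of 1 - 2 k, [c] is the minimum of k and 1 - k. *)
pose w := 1 - m; pose c := half *: w.
have cc : c + c = w by rewrite -scalerDr scale_half2.
have kc : k * c = c * k.
  rewrite -scalerAl -scalerAr /w mulrBl mulrBr mul1r mulr1 cm //.
  by rewrite /b; Ncring_tac.non_commutative_ring.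
have sc : st c = c by rewrite ustZr ustB ust1 sm.
exists (k + c), (k - c); split.
- rewrite (ustD hU) sk sc; split=> //; rewrite -unN.
  have -> : - (1 - (k + c + (k + c))) = 1 - (m + b).
    have -> : m = 1 - (c + c) by rewrite cc subKr.
    by rewrite /b; Ncring_tac.non_commutative_ring.
  exact: un_reflect_pos.
- rewrite ustB sk sc; split=> //.
  have -> : 1 - (k - c + (k - c)) = 1 - (m + (- b)).
    have -> : m = 1 - (c + c) by rewrite cc subKr.
    by rewrite /b; Ncring_tac.non_commutative_ring.
  apply: un_reflect_pos; rewrite ?ustN ?sb ?unN ?mulrNN ?mulrN ?mulNr ?mb //.
- by rewrite addrACA subrr addr0.
(* Four times the product is [(1 - b * b)] minus 1 - (1 - 2 c)^2, up to commutators of [k] and [c];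
   and 1 - 2 c is [m], with [m * m = b * b]. *)
- apply: u2_eq0; apply: u2_eq0.
  transitivity ((1 - b * b) - (1 - (1 - (c + c)) * (1 - (c + c)))
      + (k * c - c * k) + (k * c - c * k) + (k * c - c * k) + (k * c - c * k)).
    by rewrite /b; Ncring_tac.non_commutative_ring.
  by rewrite kc cc -/w subKr mm !subrr !addr0.
move=> J hJ; have [_ _ JD JZ JM] := hJ.
have JN x : J x -> J (- x) by rewrite -scaleN1r; apply: JZ.
have Jc : J (1 - b * b) -> J c by move=> h; apply: JZ; apply: Jm.
split=> Jk.
  have {}Jc : J c.
    apply: Jc; have -> : 1 - b * b = ((1 + 1) * (1 + 1) * (1 - k)) * k.
      by rewrite /b; Ncring_tac.non_commutative_ring.
    exact: JM.
  by split; apply: JD => //; apply: JN.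
have {}Jc : J c.
  apply: Jc; have -> : 1 - b * b = ((1 + 1) * (1 + 1) * k) * (1 - k).
    by rewrite /b; Ncring_tac.non_commutative_ring.
  exact: JM.
by split; rewrite opprD ?opprK addrA; apply: JD => //; apply: JN.
Qed.

Lemma sum_shift (F : nat -> U) a b :
  \sum_(a <= i < a + b) F i = \sum_(0 <= i < b) F (i + a)%N.
Proof. by rewrite -{1}[a]add0n big_addn addKn. Qed.

(* In functional calculus, r i is 2^n k - i truncated to [0, 1]. *)
Lemma uslices n k : st k = k -> N (1 - (k + k)) <= 1 -> exists r : nat -> U,
  [/\ forall i, (i < 2 ^ n)%N -> st (r i) = r i /\ N (1 - (r i + r i)) <= 1,
    forall i j, (i < j)%N -> (j < 2 ^ n)%N -> (1 - r i) * r j = 0,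
    \sum_(0 <= i < 2 ^ n) r i = k *+ (2 ^ n) &
    forall J i, uleft_ideal J -> (i < 2 ^ n)%N -> (J k -> J (r i)) /\
      (J (1 - k) -> J (1 - r i))].
Proof.
elim: n k => [|n ih] k sk k1.
  exists (fun=> k); split=> //; first by move=> i j ij; rewrite ltnS leqn0 => /eqP j0; rewrite j0 in ij.
  by rewrite big_nat1.
have [p [q [[sp p1] [sq q1] pq pq0 Jpq]]] := uslice sk k1.
have [rp [rp1 rp2 rp3 rp4]] := ih p sp p1.
have [rq [rq1 rq2 rq3 rq4]] := ih q sq q1.
have e2 : (2 ^ n.+1 = 2 ^ n + 2 ^ n)%N by rewrite expnS mul2n addnn.
have subl i : (2 ^ n <= i)%N -> (i < 2 ^ n.+1)%N -> (i - 2 ^ n < 2 ^ n)%N.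
  by move=> h1 h2; rewrite ltn_subLR // -e2.
exists (fun i => if (i < 2 ^ n)%N then rp i else rq (i - 2 ^ n)%N); split.
- by move=> i hi; case: ltnP => h; [exact: rp1|apply: rq1; exact: subl].
- move=> i j ij hj; case: (ltnP i) => hi; case: (ltnP j) => hj'.
  + exact: rp2.
  (* Two annihilators are used in turn: [q * (1 - p) = 0] passes to the slice [y] of [q], then
     [(1 - p) * y = 0] passes to the slices of [p]. Adjoints change sides because the ideals are
     left ideals. *)
  + have hJ := subl j hj' hj; set y := rq _.
    have sy : st y = y by case: (rq1 _ hJ).
    have y0 : y * (1 - p) = 0.
      apply: (proj1 (rq4 [set x | x * (1 - p) = 0] _ (uann_ideal _) hJ)).
      by rewrite /= -sq -{1}sp -{1}ust1 -ustB -(ustM hU) pq0 ust0.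
    apply: (proj2 (rp4 [set x | x * y = 0] _ (uann_ideal _) hi)).
    by rewrite /= -sy -{1}sp -{1}ust1 -ustB -(ustM hU) y0 ust0.
  + by have := leq_trans hj' hi; rewrite leqNgt (ltn_trans ij) // ltnS.
  + by apply: rq2; [rewrite ltn_sub2r // (leq_ltn_trans hi)|exact: subl].
- rewrite (big_cat_nat (n := (2 ^ n)%N)) ?leq_exp2l //= e2.
  rewrite (sum_shift _ (2 ^ n) (2 ^ n)).
  rewrite (@eq_big_nat _ _ _ _ _ _ rp) => [|i /andP[_ ->]] //.
  under [X in _ + X]eq_big_nat => i _ do rewrite ltnNge leq_addl /= addnK.
  by rewrite rp3 rq3 -mulrnDl pq mulrnDr -mulrnDl.
move=> J i hJ hi; have [J1 J2] := Jpq J hJ; case: ltnP => hi'.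
  have [h1 h2] := rp4 J i hJ hi'.
  by split=> [/J1[]|/J2[]] *; [apply: h1|apply: h2].
have [h1 h2] := rq4 J _ hJ (subl _ hi' hi).
by split=> [/J1[]|/J2[]] *; [apply: h1|apply: h2].
Qed.

(** The slices are shifted by one, with 1 in front and 0 behind, so that each has neighbours on both
    sides obeying the same relations; consecutive differences then form a partition of 1. *)
Lemma upartition n k : st k = k -> N (1 - (k + k)) <= 1 -> exists r : nat -> U,
  [/\ r 0%N = 1, forall i, N (r i) <= 1 /\ st (r i) = r i,
    forall i j, (i < j)%N -> r i * r j = r j /\ r j * r i = r j,
    forall i, (2 ^ n < i)%N -> r i = 0 &
    \sum_(0 <= i < 2 ^ n) r i.+1 = k *+ (2 ^ n)].
Proof.
move=> sk k1; have [r [r1 r2 r3 _]] := uslices n sk k1.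
pose f i := if i is j.+1 then if (j < 2 ^ n)%N then r j else 0 else 1.
have fst i : N (f i) <= 1 /\ st (f i) = f i.
  case: i => [|i] /=; first by rewrite un1 ust1.
  case: ifP => hi; last by rewrite un0 ust0.
  have [sr Nr] := r1 _ hi; split=> //.
  have -> : r i = half *: (1 - (1 - (r i + r i))).
    by rewrite subKr scale_half2.
  by apply: un_half_add; rewrite ?un1 ?unN.
have fl i j : (i < j)%N -> f i * f j = f j.
  case: j => // j; case: i => [|i] ij; first by rewrite mul1r.
  rewrite /f; case: (ifP (j < _)%N) => hj; last exact: mulr0.
  rewrite (ltn_trans _ hj) //; apply/eqP.
  by rewrite -subr_eq0 -opprB -{1}[r j]mul1r -mulrBl r2 ?oppr0.
exists f; split=> //.
- move=> i j ij; split; first exact: fl.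
  have [_ si] := fst i; have [_ sj] := fst j.
  by rewrite -{1}si -{1}sj -(ustM hU) fl.
- by case=> // i; rewrite /= ltnS ltnNge => ->.
by rewrite -r3; apply: eq_big_nat => i /andP[_ hi]; rewrite /= hi.
Qed.

Section OrthogonalSum.
Variables (I : finType) (P : pred I) (F : I -> U) (c : R).
Hypotheses (F0 : forall i j, P i -> P j -> i != j -> F i * F j = 0)
  (Fs : forall i, P i -> st (F i) = F i) (Fc : forall i, P i -> N (F i) <= c)
  (c0 : 0 < c).

Lemma orth_sumX n : (\sum_(i | P i) F i) ^+ n.+1 = \sum_(i | P i) F i ^+ n.+1.
Proof.
elim: n => [|n ih]; first by under [RHS]eq_bigr do rewrite expr1.
rewrite exprS ih mulr_suml; apply: eq_bigr => i Pi.
rewrite mulr_sumr (bigD1 i) //= big1 ?addr0 -?exprS // => j /andP[Pj ji].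
by rewrite exprS mulrA F0 ?mul0r // eq_sym.
Qed.

(** Powers of an orthogonal sum are sums of powers, so the power 2^n of the norm is at most [#|I|]
    times that of [c]; [growth_le1] absorbs the number of summands. *)
Lemma orth_sum_norm : N (\sum_(i | P i) F i) <= c.
Proof.
set S := \sum_(i | P i) F i.
have sS : st S = S by rewrite ust_sum; apply: eq_bigr.
rewrite -[leRHS]mul1r -ler_pdivrMr //.
apply: (@growth_le1 _ _ #|I|%:R) => [|n].
  by rewrite divr_ge0 ?(un_ge0 hU) ?ltW.
rewrite expr_div_n ler_pdivrMr ?exprn_gt0 // -un_pow2 //.
have [k ->] : exists k, (2 ^ n)%N = k.+1.
  by exists (2 ^ n).-1%N; rewrite prednK // expn_gt0.
rewrite orth_sumX (le_trans (un_sum _ _ _)) //.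
apply: (@le_trans _ _ (\sum_(i : I) c ^+ k.+1)).
  rewrite big_mkcond; apply: ler_sum => i _; case: ifP => Pi; last first.
    by rewrite exprn_ge0 ?ltW.
  apply: (@le_trans _ _ (N (F i) ^+ k.+1)); last first.
    by rewrite ler_pXn2r ?nnegrE ?(un_ge0 hU) ?Fc ?ltW.
  elim: k => [|k ih]; first by rewrite !expr1.
  rewrite exprS [leRHS]exprS (le_trans (unM hU _ _)) //.
  by rewrite ler_wpM2l ?(un_ge0 hU).
rewrite sumr_const -[_ *+ _]mulr_natl cardE -cardT -mulrA.
by rewrite ler_wpM2l // ler_peMl ?exprn_ge0 ?exprn_ege1 ?ler1n // ltW.
Qed.

End OrthogonalSum.

(* G is the Cesaro mean of the powers of 1 - T. *)
Lemma ucesaro T m : N (1 - T) <= 1 -> (0 < m)%N -> exists G Q,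
  [/\ 1 - G = T * Q /\ T * Q = Q * T, N (T * G) <= 2 / m%:R,
    N G <= 1, N Q <= m%:R &
    st T = T -> st G = G /\ st Q = Q].
Proof.
move=> C1 m0; set C := 1 - T in C1.
have mR : 0 < m%:R :> R by rewrite ltr0n.
pose a := (m%:R^-1 : R)%:C.
(* Geometric sums telescope, [T * S j = 1 - C ^+ j]: hence T G = (1 - C^m) / m is small, while 1 -
   G, the mean of the 1 - C^j, is divisible by [T]. *)
pose S j := \sum_(i < j) C ^+ i.
have TS j : T * S j = 1 - C ^+ j.
  by rewrite -[RHS]opprB subrX1 -mulNr opprB /C subKr.
have CT : C * T = T * C by rewrite /C mulrBl mulrBr mul1r mulr1.
have ST j : S j * T = 1 - C ^+ j.
  rewrite -TS /S mulr_suml mulr_sumr; apply: eq_bigr => i _.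
  elim: (nat_of_ord i) => [|k ih]; first by rewrite mulr1 mul1r.
  by rewrite exprSr -mulrA CT mulrA ih -mulrA.
have NS j : N (S j) <= j%:R.
  rewrite (le_trans (un_sum _ _ _)) // -[leRHS]mulr1.
  rewrite (@le_trans _ _ (\sum_(i < j) 1)) ?ler_sum // => [i _|]; first exact: unX.
  by rewrite sumr_const card_ord mulr1.
have Na x : N (a *: x) = N x / m%:R by rewrite unZr ger0_norm ?invr_ge0 ?ltW // mulrC.
have a1 : a *: (1 *+ m) = 1 :> U.
  rewrite -scaler_nat scalerA -(rmorph_nat (real_complex R)) -rmorphM /=.
  by rewrite mulVf ?gt_eqF // scale1r.
exists (a *: S m), (a *: \sum_(j < m) S j); split.
- have key : 1 - a *: S m = a *: \sum_(j < m) (1 - C ^+ j).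
    by rewrite sumrB sumr_const card_ord scalerBr a1.
  rewrite key -scalerAr -scalerAl mulr_sumr mulr_suml.
  by split; congr (_ *: _); apply: eq_bigr => j _; rewrite ?TS ?ST.
- rewrite -scalerAr TS Na ler_pM2r ?invr_gt0 // (le_trans (unB _ _)) // un1.
  by rewrite -[leRHS]/(1 + 1) lerD2l unX.
- by rewrite Na ler_pdivrMr // mul1r.
- rewrite Na ler_pdivrMr // (le_trans (un_sum _ _ _)) //.
  rewrite (@le_trans _ _ (\sum_(i < m) m%:R)) ?ler_sum // => [i _|].
    by rewrite (le_trans (NS _)) // ler_nat ltnW.
  by rewrite sumr_const card_ord mulr_natr.
move=> sT; have sC : st C = C by rewrite ustB ust1 sT.
have sS j : st (S j) = S j by rewrite ust_sum; apply: eq_bigr => i _; rewrite ustX.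
by rewrite !ustZr sS ust_sum; split=> //; congr (_ *: _); apply: eq_bigr.
Qed.

End UnitalCstar.

(** * Columns in M_oo(B) *)

Section MinfColumns.
Context {R : realType} {B : starAlgType R}.
Implicit Types x y z : Minf B.

Lemma Minf_support x : exists n, forall m, (n <= m)%N ->
  forall i j, (m <= i)%N || (m <= j)%N -> x i j = 0.
Proof.
have [n hn] := Minf_corner x; exists n => m nm i j ij; apply: hn.
by case/orP: ij => h; rewrite (leq_trans nm h) ?orbT.
Qed.

Lemma MinfME x y n : (forall i j, (n <= i)%N || (n <= j)%N -> x i j = 0) ->
  forall i j, (x ** y) i j = \sum_(k < n) x i k ** y k j.
Proof. exact: Minf_mulE. Qed.

Lemma Minf_vcat_subproof x y :
  (fun i j => (if odd i then y else x) i./2 j) \in @corner_supported B.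
Proof.
have [n [xn yn]] := Minf_common x y.
apply/asboolP; exists n.*2 => i j ij.
have ij2 : (n <= i./2)%N || (n <= j)%N.
  case/orP: ij => [/half_leq|h]; first by rewrite doubleK => ->.
  by rewrite (leq_trans _ h) ?orbT // -addnn leq_addr.
by case: (odd i); [exact: yn|exact: xn].
Qed.

(* The column (x, y), with the rows of x and y interleaved. *)
Definition vcat x y : Minf B := MkMinf (Minf_vcat_subproof x y).

Definition hcat x y : Minf B := star (vcat (star x) (star y)).

Lemma vcatE x y i j : vcat x y i j = (if odd i then y else x) i./2 j.
Proof. by []. Qed.

Lemma MinfS x i j : (star x) i j = star (x j i).
Proof. by []. Qed.

Lemma sum_double (F : nat -> B) n :
  \sum_(k < n.*2) F k = \sum_(k < n) (F k.*2 + F k.*2.+1).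
Proof.
elim: n => [|n ih]; first by rewrite !big_ord0.
by rewrite doubleS !big_ord_recr /= ih addrA.
Qed.

Lemma vcat_starM x y x' y' :
  star (vcat x y) ** vcat x' y' = star x ** x' + star y ** y'.
Proof.
have [n1 h1] := Minf_support (star (vcat x y)).
have [n2 h2] := Minf_support (star x); have [n3 h3] := Minf_support (star y).
set n := (n1 + n2 + n3)%N.
have l1 : (n1 <= n.*2)%N by rewrite /n; lia.
have l2 : (n2 <= n)%N by rewrite /n; lia.
have l3 : (n3 <= n)%N by rewrite /n; lia.
apply/MinfP => i j; rewrite MinfD (MinfME _ (h1 _ l1)) (MinfME _ (h2 _ l2)).
rewrite (MinfME _ (h3 _ l3)).
rewrite (sum_double (fun k => star (vcat x y) i k ** vcat x' y' k j)).
rewrite -big_split; apply: eq_bigr => k _ /=.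
by rewrite !odd_double /= !uphalf_double !doubleK.
Qed.

Lemma vcatM x y z : vcat x y ** z = vcat (x ** z) (y ** z).
Proof.
have [n1 h1] := Minf_support (vcat x y).
have [n2 h2] := Minf_support x; have [n3 h3] := Minf_support y.
set n := (n1 + n2 + n3)%N.
have l1 : (n1 <= n)%N by rewrite /n; lia.
have l2 : (n2 <= n)%N by rewrite /n; lia.
have l3 : (n3 <= n)%N by rewrite /n; lia.
apply/MinfP => i j; rewrite (MinfME _ (h1 _ l1)) vcatE.
by case: ifP => oi; rewrite ?(MinfME _ (h2 _ l2)) ?(MinfME _ (h3 _ l3));
  apply: eq_bigr => k _; rewrite vcatE oi.
Qed.

Lemma vcatD x y x' y' : vcat x y + vcat x' y' = vcat (x + x') (y + y').
Proof. by apply/MinfP => i j; rewrite MinfD !vcatE; case: odd. Qed.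

Lemma vcat_split x y : vcat x y + vcat x (- y) = vcat x 0 + vcat x 0.
Proof. by rewrite !vcatD subrr addr0. Qed.

Lemma Mhcat_vcat x y c d : hcat x y ** vcat c d = x ** c + y ** d.
Proof. by rewrite /hcat vcat_starM !starK. Qed.

Lemma Mhcat z x y : z ** hcat x y = hcat (z ** x) (z ** y).
Proof.
by rewrite /hcat -[z in LHS]starK -starM vcatM -!starM.
Qed.

Lemma hsumE x y : Minf_hsum x y = vcat (hcat x 0) (hcat 0 y).
Proof.
apply/MinfP => i j; rewrite vcatE /hcat /=.
by case oi: (odd i); case oj: (odd j); rewrite MinfS vcatE oj ?MinfS /= ?starK ?star0.
Qed.

Lemma hsum_vcat x y c d : Minf_hsum x y ** vcat c d = vcat (x ** c) (y ** d).
Proof. by rewrite hsumE vcatM !Mhcat_vcat !smul0r addr0 add0r. Qed.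

Lemma hsumM x y x' y' :
  Minf_hsum x y ** Minf_hsum x' y' = Minf_hsum (x ** x') (y ** y').
Proof. by rewrite [in X in _ ** X]hsumE hsum_vcat !Mhcat !smulr0 -hsumE. Qed.

Lemma star_hsum x y : star (Minf_hsum x y) = Minf_hsum (star x) (star y).
Proof.
apply/MinfP => i j /=; rewrite eq_sym; case: eqP => [->|_]; last exact: star0.
by case: odd.
Qed.

Lemma hsumZD (c : R[i]) x y x' y' :
  Minf_hsum (c *: x + x') (c *: y + y') = c *: Minf_hsum x y + Minf_hsum x' y'.
Proof.
apply/MinfP => i j; rewrite MinfD MinfZ /=; case: ifP => _.
  by case: odd.
by rewrite scaler0 addr0.
Qed.

Context {N : Minf B -> R}.
Hypothesis hN : cstar_norm N.

Lemma norm_vcat_neg x y : N (vcat x (- y)) = N (vcat x y).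
Proof.
apply/eqP; rewrite -(@eqrXn2 _ 2) ?cn_ge0 // -!(cnS hN) !vcat_starM.
by rewrite starN smulNl smulNr opprK.
Qed.

Lemma norm_vcatl0 x : N (vcat x 0) = N x.
Proof.
apply/eqP; rewrite -(@eqrXn2 _ 2) ?cn_ge0 // -!(cnS hN) vcat_starM.
by rewrite smulr0 addr0.
Qed.

Lemma norm_vcatr0 x : N (vcat 0 x) = N x.
Proof.
apply/eqP; rewrite -(@eqrXn2 _ 2) ?cn_ge0 // -!(cnS hN) vcat_starM.
by rewrite smulr0 add0r.
Qed.

(* (x, y) and (x, -y) have the same norm, and (x, 0) is their mean. *)
Lemma norm_vcat_l x y : N x <= N (vcat x y).
Proof.
have := cnD hN (vcat x y) (vcat x (- y)).
rewrite vcat_split norm_vcat_neg.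
have -> : vcat x 0 + vcat x 0 = (2 : R)%:C *: vcat x 0.
  by rewrite -(natr1 1) rmorphD scalerDl !scale1r.
by rewrite (cnZr hN) norm_vcatl0 ger0_norm //; lra.
Qed.

(** The right-hand element is the square of the column (x, y); this gives monotonicity of the norm
    on positive elements without an order. *)
Lemma norm_le_addpos x y : N (star x ** x) <= N (star x ** x + star y ** y).
Proof.
rewrite -vcat_starM !(cnS hN) ler_pXn2r ?nnegrE ?cn_ge0 //.
exact: norm_vcat_l.
Qed.

Lemma norm_hcat0 x : N (hcat x 0) = N x.
Proof. by rewrite /hcat (cn_star hN) star0 norm_vcatl0 (cn_star hN). Qed.

Lemma norm_hcat0r x : N (hcat 0 x) = N x.
Proof. by rewrite /hcat (cn_star hN) star0 norm_vcatr0 (cn_star hN). Qed.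

Lemma norm_hsuml x : N (Minf_hsum x 0) = N x.
Proof.
rewrite hsumE; have -> : hcat (0 : Minf B) 0 = 0.
  by apply: (cn_eq0 hN); rewrite norm_hcat0 (cn0 hN).
by rewrite norm_vcatl0 norm_hcat0.
Qed.

Lemma norm_hsumr x : N (Minf_hsum 0 x) = N x.
Proof.
rewrite hsumE; have -> : hcat (0 : Minf B) 0 = 0.
  by apply: (cn_eq0 hN); rewrite norm_hcat0 (cn0 hN).
by rewrite norm_vcatr0 norm_hcat0r.
Qed.

Lemma hsum_lr x y : Minf_hsum x y = Minf_hsum x 0 + Minf_hsum 0 y.
Proof. by rewrite -[Minf_hsum x 0]scale1r -hsumZD !scale1r addr0 add0r. Qed.

Lemma norm_hsum_add x y : N (Minf_hsum x y) <= N x + N y.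
Proof. by rewrite hsum_lr (le_trans (cnD hN _ _)) // norm_hsuml norm_hsumr. Qed.

Hypothesis hloc : local_cstar_norm N.

Lemma norm_hsum x y c : N x <= c -> N y <= c -> N (Minf_hsum x y) <= c.
Proof.
move=> hx hy; have [c0|c0] := leP c 0.
  have z x' : N x' <= c -> x' = 0.
    move=> h; apply: (cn_eq0 hN); apply/le_anti.
    by rewrite (le_trans h) // cn_ge0.
  have -> : x = 0 by apply: z.
  have -> : y = 0 by apply: z.
  by rewrite norm_hsuml -(z x hx).
rewrite -(@ler_pXn2r _ 2) ?nnegrE ?cn_ge0 ?(ltW c0) // -(cnS hN) star_hsum hsumM.
have hU := unorm_ucstar hN hloc.
(* The square of the direct sum is a sum of two orthogonal self-adjoint elements. [orth_sum_norm]
   bounds it by the larger norm rather than the sum, which keeps direct sums of contractive maps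
   contractive. *)
pose F (b : bool) := if b then uin (Minf_hsum (star x ** x) 0)
  else uin (Minf_hsum 0 (star y ** y)).
have Fs b : unitz_star (F b) = F b.
  case: b; rewrite unitz_star_uin star_hsum star0 starM starK //.
rewrite hsum_lr -(unorm_uin hN) uinD -[X in unorm N X]/(F true + F false).
rewrite -(big_bool _ F). apply: (orth_sum_norm hU (P := xpredT) (F := F)).
- by case; case=> // _ _ _; rewrite -uinM hsumM smul0r smulr0 hsumE;
    congr uin; apply: (cn_eq0 hN); rewrite -hsumE norm_hsuml (cn0 hN).
- by [].
- by case=> _; rewrite /F (unorm_uin hN) ?norm_hsuml ?norm_hsumr (cnS hN)
    ler_pXn2r ?nnegrE ?cn_ge0 ?(ltW c0).
- by rewrite exprn_gt0.
Qed.

(* With s^2 = 1 - x* x, the column (x a, s a) has the same norm as a. *)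
Lemma pos_contraction x : N x <= 1 -> unorm N (1 - uin (star x ** x)) <= 1.
Proof.
move=> x1; have hU := unorm_ucstar hN hloc.
have [||w [ww sw _ _ _]] := @usqrt R _ _ _ hU (uin (star x ** x)).
- by rewrite unitz_star_uin starM starK.
- by rewrite (unorm_uin hN) (cnS hN) expr_le1 ?cn_ge0.
apply: (unorm_le hN) => [|a]; first by rewrite /= oppr0 addr0 (cabs_real 1) normr1.
rewrite mul1r -ww uactM; set s := 1 - w.
have ss : unitz_star s = s by rewrite (ustB hU) (ust1 hU) sw.
have s1 b : N (uact s b) <= N b.
  rewrite (le_trans _ (_ : N (vcat (uact s b) (x ** b)) <= _)) ?norm_vcat_l //.
  rewrite -(@ler_pXn2r _ 2) ?nnegrE ?cn_ge0 // -!(cnS hN) vcat_starM.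
  rewrite (_ : _ + _ = star b ** b) //; apply: uin_inj.
  rewrite uinD !uinM -!unitz_star_uin !uin_uact !uinM !(ustM hU) ss.
  rewrite mulrA -[_ * s * s]mulrA ww mulrBr mulr1 mulrBl uinM -unitz_star_uin !mulrA.
  by rewrite subrK.
by rewrite (le_trans (s1 _)).
Qed.

End MinfColumns.

(** * Approximate units *)

Section ApproximateUnits.
Context {R : realType} {A : starAlgType R} {N : A -> R}.
Hypothesis hN : cstar_norm N.
Hypothesis hloc : local_cstar_norm N.
Implicit Types x y e : A.

Let hU := unorm_ucstar hN hloc.

Lemma uin_of (u : unitz A) : u.1 = 0 -> u = uin u.2.
Proof. by case: u => l a /= ->. Qed.

Lemma inv_bound_lt (e : R) : 0 < e -> exists2 m : nat, (0 < m)%N & 2 / m%:R <= e.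
Proof.
move=> e0; have h : 0 <= 2 / e by rewrite divr_ge0 ?ltW.
have [m hm] : exists m : nat, 2 / e < m%:R.
  by exists (Num.bound (2 / e)); exact: archi_boundP.
have m0 : 0 < m%:R :> R by apply: le_lt_trans hm.
exists m; first by rewrite ltr0n in m0.
by rewrite ler_pdivrMr // mulrC -ler_pdivrMr // ltW.
Qed.

(** 1 - e is a Cesaro mean G of powers of 1 - y^2, where y is [x ** star x] normalized. The square
    is taken because [ucomplement] yields the norm test only for squares of self-adjoint elements.
    The bound on G y^2 is then pulled back through two square roots, to G y and to G x, hence the
    fourth power in the choice of [m]. *)
Lemma approx_unit1 x (eps : R) : 0 < eps -> exists e,
  [/\ star e = e, N e <= 2, unorm N (1 - uin e) <= 1 & N (x - e ** x) <= eps].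
Proof.
move=> eps0; have [x0|x0] := eqVneq (N x) 0.
  exists 0; rewrite star0 (cn0 hN) uin0 subr0 (un1 hU) smul0r subr0 x0.
  by split=> //; exact: ltW.
have xp : 0 < N x by rewrite lt_neqAle eq_sym x0 cn_ge0.
pose c := (N x ^+ 2)^-1; have c0 : 0 < c by rewrite invr_gt0 exprn_gt0.
pose y := c%:C *: (x ** star x).
have sy : star y = y by rewrite starZ conj_real starM starK.
have y1 : N y <= 1.
  by rewrite (cnZr hN) (cn_sq hN) gtr0_norm // mulVf // gt_eqF // exprn_gt0.
have C1 : unorm N (1 - uin (y ** y)) <= 1.
  have suy : unitz_star (uin y) = uin y by rewrite unitz_star_uin sy.
  have [|s [ss _ s1 _ _]] := ucomplement hU suy; first by rewrite (unorm_uin hN).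
  by rewrite uinM -ss (unM_le1 hU).
have [m m0 hm] : exists2 m : nat, (0 < m)%N & 2 / m%:R <= (eps / N x) ^+ 4.
  by apply: inv_bound_lt; rewrite exprn_gt0 ?divr_gt0.
have [G [Q [[G1 TQ] TG NG NQ sG]]] := ucesaro hU C1 m0.
have [] := sG; first by rewrite unitz_star_uin starM sy.
move=> {}sG sQ.
pose e := (1 - G).2.
have eE : uin e = 1 - G by apply/esym/uin_of; rewrite G1 /= mul0r.
have Ge : 1 - uin e = G by rewrite eE subKr.
have Gx : uin (x - e ** x) = G * uin x by rewrite uinB uinM eE mulrBl mul1r subKr.
exists e; split.
- by apply: uin_inj; rewrite -unitz_star_uin eE (ustB hU) (ust1 hU) sG.
- rewrite -(unorm_uin hN) eE (le_trans (unB hU _ _)) // (un1 hU).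
  by rewrite -[leRHS]/(1 + 1) lerD2l.
- by rewrite Ge.
have GT : uin (y ** y) * G = G * uin (y ** y).
  rewrite -[G](subKr 1) G1 mulrBr mulrBl mulr1 mul1r.
  by rewrite -[in RHS]mulrA -TQ.
have Gy : unorm N (G * uin y) ^+ 2 <= (eps / N x) ^+ 4.
  rewrite -(un_sq hU) (ustM hU) sG unitz_star_uin sy mulrA.
  rewrite -[G * _ * _]mulrA -uinM -GT (le_trans _ hm) // (le_trans (unM hU _ _)) //.
  by rewrite (le_trans _ TG) // ler_piMr ?(un_ge0 hU).
have {}Gy : unorm N (G * uin y) <= (eps / N x) ^+ 2.
  rewrite -(@ler_pXn2r _ 2) ?nnegrE ?(un_ge0 hU) ?exprn_ge0 ?divr_ge0 ?(ltW eps0) ?(ltW xp) //.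
  by rewrite -exprM.
rewrite -(unorm_uin hN) Gx -(@ler_pXn2r _ 2) ?nnegrE ?(un_ge0 hU) ?(ltW eps0) //.
rewrite -(un_sq hU) (ustM hU) sG unitz_star_uin mulrA -[G * _ * _]mulrA -uinM.
have -> : x ** star x = (N x ^+ 2)%:C *: y.
  by rewrite scalerA -rmorphM /= divff ?scale1r // gt_eqF // exprn_gt0.
rewrite uinZ -scalerAr -scalerAl (unZr hU) ger0_norm ?exprn_ge0 ?(cn_ge0 hN) //.
rewrite -ler_pdivlMl ?exprn_gt0 // (le_trans (unM hU _ _)) //.
rewrite (@le_trans _ _ (unorm N (G * uin y))) // ?ler_piMr ?(un_ge0 hU) //.
by rewrite (le_trans Gy) // expr_div_n mulrC.
Qed.

(** Induction with 1 - e' = (1 - e2) (1 - e): [e2] repairs the remainder left by [e] on the new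
    element, and 1 - e2 is a contraction, so earlier estimates survive. *)
Lemma approx_unit (X : seq A) (eps : R) : 0 < eps -> exists e,
  [/\ N e <= 2, unorm N (1 - uin e) <= 1 &
    forall x, x \in X -> N (x - e ** x) <= eps].
Proof.
move=> eps0; elim: X => [|x X [e [_ e1 he]]].
  exists 0; rewrite (cn0 hN) uin0 subr0 (un1 hU); split=> //.
have [e2 [_ _ e21 he2]] := approx_unit1 (x - e ** x) eps0.
have key y : y - (e2 + e - e2 ** e) ** y = (y - e ** y) - e2 ** (y - e ** y).
  by rewrite smulBl smulDl smulBr smulA !opprD opprK !addrA; congr (_ + _); rewrite -!addrA; congr (_ + _); exact: addrC.
have E1 : 1 - uin (e2 + e - e2 ** e) = (1 - uin e2) * (1 - uin e).
  rewrite uinB uinD uinM mulrBl mul1r mulrBr mulr1 !opprD !opprK addrA.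
  rewrite -!addrA; congr (_ + _); rewrite addrCA; congr (_ + _).
have E2 : unorm N (1 - uin (e2 + e - e2 ** e)) <= 1 by rewrite E1 (unM_le1 hU).
exists (e2 + e - e2 ** e); split=> //.
  rewrite -(unorm_uin hN) -[uin _](subKr 1) (le_trans (unB hU _ _)) // (un1 hU).
  by rewrite -[leRHS]/(1 + 1) lerD2l.
move=> y; rewrite inE => /orP[/eqP ->|yX]; first by rewrite key.
rewrite key (le_trans _ (he y yX)) //.
have -> : y - e ** y - e2 ** (y - e ** y) = uact (1 - uin e2) (y - e ** y).
  by apply: uin_inj; rewrite uin_uact uinB uinM mulrBl mul1r.
by rewrite (le_trans (uact_unorm hN _ _)) // ler_piMl ?cn_ge0.
Qed.

(* The square root of 1 - x is a multiplier of A. *)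
Lemma compressed_pos x e : star x = x -> N x <= 1 ->
  exists g, e ** star e - e ** x ** star e = star g ** g.
Proof.
move=> sx x1; have [||w [ww sw _ _ _]] := @usqrt R _ _ _ hU (uin x).
- by rewrite unitz_star_uin sx.
- by rewrite (unorm_uin hN).
exists (star (ract e (1 - w))); rewrite starK; apply: uin_inj.
rewrite uinB !uinM -!unitz_star_uin uin_ract (ustM hU) (ustB hU) (ust1 hU) sw.
by rewrite mulrA -[_ * (1 - w) * (1 - w)]mulrA ww mulrBr mulr1 mulrBl.
Qed.

End ApproximateUnits.

(** * Order zero maps *)

Section OrderZeroMaps.
Context {R : realType} {A B : normedStarAlgType R}.
Hypothesis hA : local_cstar_norm (@cnorm R A).
Hypothesis hM : local_cstar_norm (@cnorm R (Minf B)).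
Implicit Types (a b c e f x y z : A) (u v w : Minf B).

Let nA := proj1 hA.
Let nM := proj1 hM.
Let UA := unorm_ucstar nA hA.

#[local] Instance nc_opsA : @Ncring.Ring_ops (unitz A)
  0 1 +%R *%R (fun x y : unitz _ => x - y) -%R eq := nc_ops (unitz A).
#[local] Instance nc_ringA : @Ncring.Ring (unitz A)
  0 1 +%R *%R (fun x y : unitz _ => x - y) -%R eq nc_opsA := nc_ring (unitz A).
#[local] Instance nc_opsM : @Ncring.Ring_ops (unitz (Minf B))
  0 1 +%R *%R (fun x y : unitz _ => x - y) -%R eq := nc_ops (unitz (Minf B)).
#[local] Instance nc_ringM : @Ncring.Ring (unitz (Minf B))
  0 1 +%R *%R (fun x y : unitz _ => x - y) -%R eq nc_opsM := nc_ring (unitz (Minf B)).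

Local Notation NA := (@cnorm R A).
Local Notation NM := (@cnorm R (Minf B)).

Section OneMap.
Variable phi : A -> Minf B.
Hypothesis hphi : cpc_order_zero phi.

Lemma oz_lin t x y : phi (t *: x + y) = t *: phi x + phi y.
Proof. by case: hphi => h *; apply: h. Qed.

Lemma ozD x y : phi (x + y) = phi x + phi y.
Proof. by rewrite -{1}[x]scale1r oz_lin scale1r. Qed.

Lemma oz0 : phi 0 = 0.
Proof. by apply: (addIr (phi 0)); rewrite -ozD !add0r. Qed.

Lemma ozZ t x : phi (t *: x) = t *: phi x.
Proof. by rewrite -[t *: x]addr0 oz_lin oz0 addr0. Qed.

Lemma ozN x : phi (- x) = - phi x.
Proof. by rewrite -scaleN1r ozZ scaleN1r. Qed.

Lemma ozB x y : phi (x - y) = phi x - phi y.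
Proof. by rewrite ozD ozN. Qed.

Lemma oz_norm x : NM (phi x) <= NA x.
Proof. by case: hphi => _ _ h _; apply: h. Qed.

(* 2-positivity on the pair (x, e). *)
Lemma oz_gram x e : exists u v,
  [/\ phi (star x ** x) = star u ** u, phi (star x ** e) = star u ** v,
      phi (star e ** x) = star v ** u & phi (star e ** e) = star v ** v].
Proof.
case: hphi => _ cp _ _.
pose g (i : 'I_2) := if i == 0 then x else e.
have [|Y hY] := cp 2%N (\matrix_(i, j) (star (g i) ** g j)).
  exists (\matrix_(k, i) (if k == 0 then g i else 0)).
  apply/matrixP => i j; rewrite !mxE !big_ord_recl big_ord0 !mxE /=.
  by rewrite star0 smul0r !addr0.
(* Each column of [Y] has two entries in M_oo(B); [vcat] stacks them into a single element. *)
have key i j : phi (star (g i) ** g j) =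
    star (vcat (Y 0 i) (Y 1 i)) ** vcat (Y 0 j) (Y 1 j).
  have := congr1 (fun X : 'M[Minf B]_2 => X i j) hY; rewrite !mxE => ->.
  have l1 : lift ord0 ord0 = 1 :> 'I_2 by apply/val_inj.
  by rewrite !big_ord_recl big_ord0 addr0 l1 vcat_starM.
exists (vcat (Y 0 0) (Y 1 0)), (vcat (Y 0 1) (Y 1 1)).
by have := (key 0 0, key 0 1, key 1 0, key 1 1); rewrite /g /= => -[[[-> ->] ->] ->].
Qed.

(** Complete positivity speaks only of squares. By [oz_gram], phi (x* e) is the adjoint of phi (e
    x), and [e] runs through an approximate unit. *)
Lemma oz_star x : phi (star x) = star (phi x).
Proof.
apply/eqP; rewrite -subr_eq0; apply/eqP/(cn_small0 nM) => eps eps0.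
have [|e [se _ _ he]] := @approx_unit1 _ _ _ nA hA x (eps / 2); first by rewrite divr_gt0.
have [u [v [_ h1 h2 _]]] := oz_gram x e.
have h : phi (star x ** e) = star (phi (e ** x)).
  by rewrite -{2}se h2 starM starK h1.
rewrite (le_trans (cn_split nM (phi (star x ** e)) _ _)) // [leRHS]splitr lerD //.
  rewrite -ozB (le_trans (oz_norm _)) //.
  by rewrite -(cn_star nA) starB starM starK se.
rewrite h -starB (cn_star nM) -ozB (le_trans (oz_norm _)) //.
by rewrite (cn_distC nA).
Qed.

(** A Cauchy-Schwarz argument: if phi (x* x) = u* u, then [u ** v = 0], and phi (e x) has [u] as
    right factor. *)
Lemma oz_kill x v : phi (star x ** x) ** v = 0 -> phi x ** v = 0.
Proof.
move=> h; apply: (cn_small0 nM) => eps eps0.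
have d0 : 0 < NM v + 1 by rewrite ltr_wpDl ?(cn_ge0 nM).
have [|e [se _ _ he]] := @approx_unit1 _ _ _ nA hA x (eps / (NM v + 1)).
  by rewrite divr_gt0.
have [u [w [h1 _ h3 _]]] := oz_gram x e.
have uv : u ** v = 0.
  apply: (cn_eq0 nM); apply/eqP; rewrite -sqrf_eq0 -(cnS nM) starM.
  by rewrite -smulA [star u ** _]smulA -h1 h smulr0 (cn0 nM).
have -> : phi x ** v = phi (x - e ** x) ** v.
  by rewrite ozB smulBl -se h3 -smulA uv smulr0 subr0.
rewrite (le_trans (cnM nM _ _)) //.
rewrite (@le_trans _ _ (eps / (NM v + 1) * (NM v + 1))) //; last first.
  by rewrite divfK // gt_eqF.
by rewrite ler_pM ?(cn_ge0 nM) ?lerDl // (le_trans (oz_norm _)).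
Qed.

(** The positive elements x* x and y y* are orthogonal; [oz_kill] then removes the extra factor on
    each side in turn. *)
Lemma oz_orth x y : x ** y = 0 -> phi x ** phi y = 0.
Proof.
move=> xy; have h : phi (star x ** x) ** phi (y ** star y) = 0.
  case: hphi => _ _ _; apply; [by exists x|by exists (star y); rewrite starK|].
  by rewrite -smulA [x ** _]smulA xy smul0r smulr0.
have /(congr1 star) := oz_kill h.
rewrite starM star0 -!oz_star starM starK => h2.
have {}h2 : phi (star y) ** phi (star x) = 0 by apply: oz_kill; rewrite starK.
by move/(congr1 star): h2; rewrite starM star0 -!oz_star !starK.
Qed.

(** * Spectral slices and the swap identity *)

Section Slices.
Variables a c : A.
Local Notation UU := (unitz A).

(** A bounded bilinear form that vanishes when [p * q = 0]. It lives on the unitization because the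
    slices involve 1, and the aim is to show that (k, 1) and (1, k) have the same value. *)
Definition ozform (p q : UU) : Minf B := phi (ract a p) ** phi (uact q c).

Lemma ractD p q : ract a (p + q) = ract a p + ract a q.
Proof. by apply: uin_inj; rewrite uinD !uin_ract mulrDr. Qed.

Lemma ozformDl p p' q : ozform (p + p') q = ozform p q + ozform p' q.
Proof. by rewrite /ozform ractD ozD smulDl. Qed.

Lemma ozformDr p q q' : ozform p (q + q') = ozform p q + ozform p q'.
Proof. by rewrite /ozform uactD (ozD (uact q c)) smulDr. Qed.

Lemma ozform0l q : ozform 0 q = 0.
Proof. by apply: (addIr (ozform 0 q)); rewrite -ozformDl !add0r. Qed.

Lemma ozform0r p : ozform p 0 = 0.
Proof. by apply: (addIr (ozform p 0)); rewrite -ozformDr !add0r. Qed.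

Lemma ozform_suml (I : Type) (r : seq I) (P : pred I) (F : I -> UU) q :
  ozform (\sum_(i <- r | P i) F i) q = \sum_(i <- r | P i) ozform (F i) q.
Proof. by elim/big_rec2: _ => [|i y z _ <-]; rewrite ?ozform0l // ozformDl. Qed.

Lemma ozform_sumr (I : Type) (r : seq I) (P : pred I) (F : I -> UU) p :
  ozform p (\sum_(i <- r | P i) F i) = \sum_(i <- r | P i) ozform p (F i).
Proof. by elim/big_rec2: _ => [|i y z _ <-]; rewrite ?ozform0r // ozformDr. Qed.

Lemma ozform_orth p q : p * q = 0 -> ozform p q = 0.
Proof.
move=> pq; apply: oz_orth; apply: uin_inj.
by rewrite uinM uin_ract uin_uact mulrA -[_ * p * q]mulrA pq mulr0 mul0r.
Qed.

Lemma ozform_norm p q :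
  NM (ozform p q) <= NA a * unorm NA p * (unorm NA q * NA c).
Proof.
rewrite (le_trans (cnM nM _ _)) // ler_pM ?(cn_ge0 nM) //.
  rewrite (le_trans (oz_norm _)) // -(unorm_uin nA) uin_ract.
  by rewrite (le_trans (unM UA _ _)) // (unorm_uin nA).
by rewrite (le_trans (oz_norm _)) // (uact_unorm nA).
Qed.

Variables (n : nat) (r : nat -> UU).
Hypotheses (r0 : r 0%N = 1)
  (rn : forall i, unorm NA (r i) <= 1 /\ unitz_star (r i) = r i)
  (rr : forall i j, (i < j)%N -> r i * r j = r j /\ r j * r i = r j).

Definition slice i := r i - r i.+1.

Lemma slice_orth i j : (i.+1 < j)%N || (j.+1 < i)%N -> slice i * slice j = 0.
Proof.
have h k l : (k.+1 < l)%N -> slice k * slice l = 0 /\ slice l * slice k = 0.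
  move=> kl; have kl' := ltnW kl; rewrite /slice !mulrBl !mulrBr.
  have [-> ->] := rr kl; have [-> ->] := rr kl'.
  have [-> ->] := rr (ltn_trans kl' (ltnSn _)).
  have [-> ->] := rr (ltn_trans kl (ltnSn _)).
  by rewrite !subrr.
by case/orP => /h[].
Qed.

(** With r the cut [r l.+1], the common term (r, r) cancels and leaves the pairs (r, 1 - r) and (1 -
    r, r). By orthogonality only the two slices adjacent to the cut contribute to these. *)
Lemma ozform_commutator l :
  ozform (r l.+1) 1 - ozform 1 (r l.+1) =
  ozform (slice l.+1) (slice l) - ozform (slice l) (slice l.+1).
Proof.
have O p q p' : p' * q = 0 -> ozform (p + p') q = ozform p q.
  by move=> h; rewrite ozformDl (ozform_orth h) addr0.
have O' p q q' : p * q' = 0 -> ozform p (q + q') = ozform p q.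
  by move=> h; rewrite ozformDr (ozform_orth h) addr0.
have r12 := rr (ltnSn l.+1); have r01 := rr (ltnSn l).
have r02 := rr (ltn_trans (ltnSn l) (ltnSn l.+1)).
transitivity (ozform (r l.+1) (1 - r l.+1) - ozform (1 - r l.+1) (r l.+1)).
  have e1 : ozform (r l.+1) 1 = ozform (r l.+1) (1 - r l.+1) + ozform (r l.+1) (r l.+1).
    by rewrite -ozformDr subrK.
  have e2 : ozform 1 (r l.+1) = ozform (1 - r l.+1) (r l.+1) + ozform (r l.+1) (r l.+1).
    by rewrite -ozformDl subrK.
  by rewrite e1 e2 opprD addrACA subrr addr0.
congr (_ - _).
  rewrite -{1}[r l.+1](subrK (r l.+2)) O; last first.
    by rewrite mulrBr mulr1 r12.2 subrr.
  have -> : 1 - r l.+1 = slice l + (1 - r l).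
    by rewrite /slice; Ncring_tac.non_commutative_ring.
  rewrite O' // /slice mulrBr mulr1 mulrBl r01.2 r02.2 subrr //.
have -> : 1 - r l.+1 = slice l + (1 - r l).
  by rewrite /slice; Ncring_tac.non_commutative_ring.
rewrite O; last by rewrite mulrBl mul1r r01.1 subrr.
rewrite -{1}[r l.+1](subrK (r l.+2)) O' //.
by rewrite /slice mulrBl r02.1 r12.1 subrr.
Qed.

Lemma slice_norm l : unorm NA (slice l) <= 2.
Proof.
have [h1 _] := rn l; have [h2 _] := rn l.+1.
by rewrite (le_trans (unB UA _ _)) // -[leRHS]/(1 + 1) lerD.
Qed.

Lemma slice_sa l : unitz_star (slice l) = slice l.
Proof.
have [_ h1] := rn l; have [_ h2] := rn l.+1.
by rewrite (ustB UA) h1 h2.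
Qed.

(** The bound must not depend on [n]. Within one residue class of [l] modulo 3 all cross terms
    vanish, so the sum is one value of the form at two orthogonal sums of norm at most 2: the
    constant is 3 * 2 * 2. *)
Lemma ozform_slices (s s' : nat) : (s + s' = 1)%N ->
  NM (\sum_(l < n) ozform (slice (l + s)) (slice (l + s')))
    <= 12 * (NA a * NA c).
Proof.
move=> ss; pose p (l : 'I_n) : 'I_3 := inord (l %% 3).
have pE (i j : 'I_n) k : p i == k -> p j == k -> i != j ->
    (i.+2 < j)%N \/ (j.+2 < i)%N.
  move=> /eqP <- /eqP /(congr1 val) /=; rewrite !inordK ?ltn_pmod //.
  move=> h /eqP ij; have {}ij : (i : nat) <> j by move/val_inj.
  lia.
rewrite (partition_big p xpredT) //= (le_trans (cn_sum nM _ _ _)) //.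
have -> : 12 * (NA a * NA c) = \sum_(k < 3) (4 * (NA a * NA c)).
  by rewrite sumr_const card_ord -mulr_natl; ring.
apply: ler_sum => k _.
have -> : \sum_(l < n | p l == k) ozform (slice (l + s)) (slice (l + s')) =
    ozform (\sum_(l < n | p l == k) slice (l + s))
      (\sum_(l < n | p l == k) slice (l + s')).
  rewrite ozform_suml; apply: eq_bigr => i pi.
  rewrite ozform_sumr (bigD1 i) //= big1 ?addr0 // => j /andP[pj ij].
  apply: ozform_orth; apply: slice_orth.
  have [] := pE _ _ _ pi pj (_ : i != j); first by rewrite eq_sym.
    by move=> h; apply/orP; left; lia.
  by move=> h; apply/orP; right; lia.
have Ns t : unorm NA (\sum_(l < n | p l == k) slice (l + t)) <= 2.
  apply: (orth_sum_norm UA) => // [i j pi pj ij|i _|i _].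
  - by apply: slice_orth; have [] := pE _ _ _ pi pj ij => h; apply/orP; lia.
  - exact: slice_sa.
  - exact: slice_norm.
rewrite (le_trans (ozform_norm _ _)) //.
have -> : 4 * (NA a * NA c) = NA a * 2 * (2 * NA c) by ring.
by rewrite ler_pM ?mulr_ge0 ?(un_ge0 UA) ?(cn_ge0 nA) // ?ler_wpM2l ?ler_wpM2r ?(cn_ge0 nA).
Qed.

End Slices.

(** The cuts add up to 2^n k, so 2^n times the defect is a sum of commutators of cuts, bounded
    independently of n by 12 + 12 times the norms of [a] and [c]. Hence the defect is 0. *)
Lemma oz_swap_interval a c k : star k = k ->
  unorm NA (1 - (uin k + uin k)) <= 1 -> phi (a ** k) ** phi c = phi a ** phi (k ** c).
Proof.
move=> sk k1; apply/eqP; rewrite -subr_eq0; apply/eqP.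
have form1 : phi (a ** k) ** phi c - phi a ** phi (k ** c) =
    ozform a c (uin k) 1 - ozform a c 1 (uin k).
  by congr (phi _ ** phi _ - phi _ ** phi _); apply: uin_inj;
    rewrite ?uin_ract ?uin_uact ?mulr1 ?mul1r ?uinM.
rewrite form1; set D := _ - _.
have sk' : unitz_star (uin k) = uin k by rewrite unitz_star_uin sk.
have bound n : NM D * 2 ^+ n <= 24 * (NA a * NA c).
  have [r [r0 rn rr _ rs]] := upartition UA n sk' k1.
  have DE : D *+ (2 ^ n) = \sum_(l < 2 ^ n) (ozform a c (slice r l.+1) (slice r l)
      - ozform a c (slice r l) (slice r l.+1)).
    under eq_bigr do rewrite -ozform_commutator //.
    rewrite sumrB -ozform_suml -ozform_sumr -!(big_mkord xpredT (fun l => r l.+1)) rs.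
    have mulr_nl m : ozform a c (uin k *+ m) 1 = ozform a c (uin k) 1 *+ m.
      by elim: m => [|m ih]; rewrite ?ozform0l // !mulrS ozformDl ih.
    have mulr_nr m : ozform a c 1 (uin k *+ m) = ozform a c 1 (uin k) *+ m.
      by elim: m => [|m ih]; rewrite ?ozform0r // !mulrS ozformDr ih.
    by rewrite mulr_nl mulr_nr -mulrnBl.
  have -> : NM D * 2 ^+ n = NM (D *+ (2 ^ n)).
    by rewrite (cnMn nM) natrX mulrC.
  rewrite DE sumrB (le_trans (cnB nM _ _)) //.
  have -> : 24 * (NA a * NA c) = 12 * (NA a * NA c) + 12 * (NA a * NA c) by ring.
  rewrite lerD //.
    have := @ozform_slices a c (2 ^ n)%N r rn rr 1 0 erefl.
    by under eq_bigr do rewrite addn1 addn0.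
  have := @ozform_slices a c (2 ^ n)%N r rn rr 0 1 erefl.
  by under eq_bigr do rewrite addn1 addn0.
apply: (cn_small0 nM) => eps eps0.
set K := 24 * (NA a * NA c) in bound.
have K0 : 0 <= K by rewrite !mulr_ge0 ?(cn_ge0 nA).
have [n hn] : exists n : nat, K / eps < n%:R.
  by exists (Num.bound (K / eps)); apply: archi_boundP; rewrite divr_ge0 // ltW.
have n2 : n%:R <= 2 ^+ n :> R by rewrite -natrX ler_nat ltnW // ltn_expl.
have p2 : 0 < 2 ^+ n :> R by rewrite exprn_gt0.
rewrite -(ler_pM2r p2) (le_trans (bound n)) // mulrC -ler_pdivrMr //.
by rewrite (le_trans (ltW hn)).
Qed.

Definition swappable k :=
  forall a c, phi (a ** k) ** phi c = phi a ** phi (k ** c).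

Lemma swappableD k l : swappable k -> swappable l -> swappable (k + l).
Proof.
by move=> hk hl a c; rewrite smulDr smulDl !ozD smulDl smulDr hk hl.
Qed.

Lemma swappableZ t k : swappable k -> swappable (t *: k).
Proof.
by move=> hk a c; rewrite smulZr smulZl !ozZ smulZl smulZr hk.
Qed.

Lemma swappableN k : swappable k -> swappable (- k).
Proof. by rewrite -scaleN1r; apply: swappableZ. Qed.

Lemma swappable_closed k :
  (forall eps, 0 < eps -> exists2 l, swappable l & NA (k - l) <= eps) -> swappable k.
Proof.
move=> h a c; apply/eqP; rewrite -subr_eq0; apply/eqP/(cn_small0 nM) => eps eps0.
have d0 : 0 < 2 * (NA a * NA c) + 1 by rewrite ltr_wpDl // !mulr_ge0 ?(cn_ge0 nA).
have [l hl kl] := h _ (divr_gt0 eps0 d0).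
have -> : phi (a ** k) ** phi c - phi a ** phi (k ** c) =
    phi (a ** (k - l)) ** phi c - phi a ** phi ((k - l) ** c).
  rewrite smulBr smulBl !ozB smulBl smulBr hl; apply: uin_inj.
  by rewrite !(uinB, uinM); Ncring_tac.non_commutative_ring.
have h1 : NM (phi (a ** (k - l)) ** phi c) <= NA a * NA (k - l) * NA c.
  rewrite (le_trans (cnM nM _ _)) // ler_pM ?(cn_ge0 nM) ?oz_norm //.
  by rewrite (le_trans (oz_norm _)) // (cnM nA).
have h2 : NM (phi a ** phi ((k - l) ** c)) <= NA a * (NA (k - l) * NA c).
  rewrite (le_trans (cnM nM _ _)) // ler_pM ?(cn_ge0 nM) ?oz_norm //.
  by rewrite (le_trans (oz_norm _)) // (cnM nA).
rewrite (le_trans (cnB nM _ _)) //.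
rewrite (@le_trans _ _ (NA (k - l) * (2 * (NA a * NA c) + 1))) //; last first.
  by rewrite -ler_pdivlMr.
by have := cn_ge0 nA (k - l); lra.
Qed.

Lemma swappable_sq y : star y = y -> swappable (y ** y).
Proof.
move=> sy; have [y0|y0] := eqVneq (NA y) 0.
  by rewrite (cn_eq0 nA y0) smul0r => a c; rewrite smulr0 smul0r oz0 smul0r smulr0.
have yp : 0 < NA y by rewrite lt_neqAle eq_sym y0 (cn_ge0 nA).
pose t := ((NA y)^-1)%:C : R[i].
have -> : y ** y = ((NA y ^+ 2)%:C) *: ((t *: y) ** (t *: y)).
  rewrite smulZl smulZr !scalerA -!rmorphM /=.
  have -> : NA y ^+ 2 * ((NA y)^-1 * (NA y)^-1) = 1 by field.
  by rewrite scale1r.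
apply: swappableZ; set y' := t *: y.
have sy' : star y' = y' by rewrite starZ conj_real sy.
have y1 : NA y' <= 1 by rewrite (cnZr nA) gtr0_norm ?invr_gt0 // mulVf.
have su : unitz_star (uin y') = uin y' by rewrite unitz_star_uin sy'.
have [|s [ss _ _ _ h]] := ucomplement UA su; first by rewrite (unorm_uin nA).
move=> a c; apply: oz_swap_interval; first by rewrite starM sy'.
by rewrite opprD addrA uinM -ss.
Qed.

(** Squares are covered by [swappable_sq]. With [e] near a unit, [y] is close to (y e + e y) / 2, a
    combination of squares of self-adjoint elements. *)
Lemma swappable_sa y : star y = y -> swappable y.
Proof.
move=> sy; apply: swappable_closed => eps eps0.
have [e [se _ _ he]] := @approx_unit1 _ _ _ nA hA y _ eps0.
exists (((2^-1 : R)%:C) *: (y ** e + e ** y)).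
  apply: swappableZ.
  have -> : y ** e + e ** y = (y + e) ** (y + e) - y ** y - e ** e.
    apply: uin_inj; rewrite !(uinD, uinN, uinM).
    by Ncring_tac.non_commutative_ring.
  apply: swappableD; last by apply/swappableN/swappable_sq.
  apply: swappableD; last by apply/swappableN/swappable_sq.
  by apply: swappable_sq; rewrite starD sy se.
have -> : y - (2^-1)%:C *: (y ** e + e ** y)
    = (2^-1 : R)%:C *: ((y - y ** e) + (y - e ** y)).
  rewrite addrACA -opprD scalerBr; congr (_ - _).
  by rewrite scale_half2.
rewrite (cnZr nA) gtr0_norm ?invr_gt0 // mulrC ler_pdivrMr //.
rewrite (le_trans (cnD nA _ _)) // mulr_natr mulr2n lerD //.
by rewrite -(cn_star nA) starB starM sy se.
Qed.

(* Thus a product of n values of phi only depends on the product of the n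
   arguments. *)
Lemma oz_swap a k c : phi (a ** k) ** phi c = phi a ** phi (k ** c).
Proof.
have sw1 := @swappable_sa (k + star k).
have sw2 := @swappable_sa ('i *: (k - star k)).
suff : swappable k by apply.
rewrite (sa_decomp k).
apply: swappableZ; apply: swappableD; first by apply: sw1; rewrite starD starK addrC.
apply: swappableZ; apply: sw2; rewrite starZ starB starK.
by rewrite conj_i scaleNr -scalerN opprB.
Qed.

End OneMap.

End OrderZeroMaps.

(** * Bounds on compressions and cut-off elements *)

Section CutOff.
Context {R : realType} {A B : normedStarAlgType R}.
Hypothesis hA : local_cstar_norm (@cnorm R A).
Hypothesis hM : local_cstar_norm (@cnorm R (Minf B)).
Implicit Types (a b e f x y z : A) (c u v w : Minf B).

Let nA := proj1 hA.
Let nM := proj1 hM.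
Let UM := unorm_ucstar nM hM.

#[local] Instance nc_opsM' : @Ncring.Ring_ops (unitz (Minf B))
  0 1 +%R *%R (fun x y : unitz _ => x - y) -%R eq := nc_ops (unitz (Minf B)).
#[local] Instance nc_ringM' : @Ncring.Ring (unitz (Minf B))
  0 1 +%R *%R (fun x y : unitz _ => x - y) -%R eq nc_opsM' := nc_ring (unitz (Minf B)).

Local Notation NA := (@cnorm R A).
Local Notation NM := (@cnorm R (Minf B)).

Variable phi : A -> Minf B.
Hypothesis hphi : cpc_order_zero phi.

(** Both [p - q] and [p + q] are squares with sum 2 p, so each has norm at most twice that of p;
    their difference is 2 q. *)
Lemma compress_bound_contr e c x : star x = x -> NA x <= 1 ->
  NM (star c ** phi (e ** x ** star e) ** c)
    <= 2 * NM (star c ** phi (e ** star e) ** c).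
Proof.
move=> sx x1; set q := star c ** phi _ ** c; set p := star c ** phi _ ** c.
have [g hg] := compressed_pos nA hA e sx x1.
have [||g' hg'] := @compressed_pos _ _ _ nA hA (- x) e.
- by rewrite starN sx.
- by rewrite (cnN nA).
have [u [_ [hu _ _ _]]] := oz_gram hphi g g.
have [u' [_ [hu' _ _ _]]] := oz_gram hphi g' g'.
have pq : p - q = star (u ** c) ** (u ** c).
  rewrite /p /q -smulBl -smulBr -(ozB hphi) hg hu starM !smulA //.
have pq' : p + q = star (u' ** c) ** (u' ** c).
  rewrite /p /q -smulDl -smulDr -(ozD hphi).
  have -> : e ** star e + e ** x ** star e = e ** star e - e ** (- x) ** star e.
    by rewrite smulNr smulNl opprK.
  by rewrite hg' hu' starM !smulA.
have pp : NM (p + p) = 2 * NM p by rewrite -mulr2n (cnMn nM).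
have e1 : (p - q) + (p + q) = p + p by rewrite addrACA addNr addr0.
have h1 : NM (p - q) <= 2 * NM p by rewrite -pp -e1 pq pq' (norm_le_addpos nM).
have h2 : NM (p + q) <= 2 * NM p.
  by rewrite -pp -e1 [X in _ <= NM X]addrC pq pq' (norm_le_addpos nM).
have : NM (q + q) <= NM (p + q) + NM (p - q).
  have -> : q + q = (p + q) - (p - q) by rewrite opprB [RHS]addrC addrA subrK.
  exact: cnB.
have -> : NM (q + q) = 2 * NM q by rewrite -mulr2n (cnMn nM).
lra.
Qed.

(** A positive map is bounded by its value at the unit, whose role [e ** star e] plays here. One
    factor 2 comes from [compress_bound_contr], the other from the real and imaginary parts of
    [x]. *)
Lemma compress_bound e c x :
  NM (star c ** phi (e ** x ** star e) ** c)
    <= 4 * NA x * NM (star c ** phi (e ** star e) ** c).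
Proof.
set p := NM (star c ** phi (e ** star e) ** c).
pose q x := star c ** phi (e ** x ** star e) ** c.
have qD y z : q (y + z) = q y + q z.
  by rewrite /q smulDr smulDl (ozD hphi) smulDr smulDl.
have qZ t y : q (t *: y) = t *: q y.
  by rewrite /q smulZr smulZl (ozZ hphi) smulZr smulZl.
have p0 : 0 <= p by exact: cn_ge0.
have qsa y : star y = y -> NM (q y) <= 2 * NA y * p.
  move=> sy; have [y0|y0] := eqVneq (NA y) 0.
    rewrite (cn_eq0 nA y0) -[X in q X](scale0r (0 : A)) qZ scale0r (cn0 nM).
    by rewrite !mulr_ge0 ?(cn_ge0 nA).
  have yp : 0 < NA y by rewrite lt_neqAle eq_sym y0 (cn_ge0 nA).
  have := @compress_bound_contr e c (((NA y)^-1)%:C *: y).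
  rewrite starZ conj_real sy (cnZr nA) gtr0_norm ?invr_gt0 // mulVf //.
  move=> /(_ erefl (lexx _)); rewrite -/(q _) qZ (cnZr nM) gtr0_norm ?invr_gt0 //.
  by rewrite ler_pdivrMl // -/p; lra.
have Ns y : NA (star y) = NA y by exact: cn_star.
have h1 : NM (q (x + star x)) <= 4 * NA x * p.
  rewrite (le_trans (qsa _ _)) ?starD ?starK 1?addrC // ler_wpM2r //.
  by have := cnD nA (star x) x; rewrite Ns; lra.
have h2 : NM (q ('i *: (x - star x))) <= 4 * NA x * p.
  rewrite (le_trans (qsa _ _)) //.
    by rewrite starZ starB starK conj_i scaleNr -scalerN opprB.
  rewrite ler_wpM2r // (cnZ nA) cabs_i mul1r.
  by have := cnB nA x (star x); rewrite Ns; lra.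
rewrite -/(q x) {1}(sa_decomp x) qZ (cnZr nM) gtr0_norm ?invr_gt0 // ler_pdivrMl //.
rewrite qD qZ (le_trans (cnD nM _ _)) // (cnZ nM) cabsN cabs_i mul1r; lra.
Qed.

(* Formally phi = h pi for a *-homomorphism pi and a central h >= 0, and w is
   g(h) pi(e) with g(h) close to 1 and g(0) = 0; here h is replaced by phi f for a
   local unit f of e, and 1 - g is a Cesaro mean. The estimate is uniform in x. *)
Lemma oz_cutoff e (delta : R) : NA e <= 2 -> 0 < delta -> exists w,
  (forall x, NM (w ** phi x ** star w - phi (e ** x ** star e)) <= delta * NA x) /\
  (forall v, (forall a, phi a ** v = 0) -> w ** v = 0).
Proof.
(* Three errors of size rho use half of [delta]; the other half pays for [P - P0] below. *)
move=> e2 d0; have [rho rhoE] : exists rho, rho = delta / 6 by exists (delta / 6).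
have rho0 : 0 < rho by rewrite rhoE divr_gt0.
have [m m0 hm] : exists2 m : nat, (0 < m)%N & 2 / m%:R <= rho ^+ 2 / 128.
  by apply: inv_bound_lt; rewrite divr_gt0 // exprn_gt0.
have mR : 0 < m%:R :> R by rewrite ltr0n.
(* The bound 1 keeps [f ** e] of norm at most 3, the second serves the error of [f] in [Gz], and the
   third absorbs the factor [m%:R ^+ 2] from the two copies of [Q']; so [m] is fixed before
   [eta]. *)
pose eta := Num.min 1 (Num.min (rho ^+ 2 / 16) (delta / (10 * m%:R ^+ 2))).
have eta0 : 0 < eta.
  by rewrite !lt_min ltr01 !divr_gt0 ?mulr_gt0 ?exprn_gt0.
have eta1 : eta <= 1 by rewrite ge_min lexx.
have eta2 : 16 * eta <= rho ^+ 2.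
  by rewrite mulrC -ler_pdivlMr // !ge_min lexx !orbT.
have eta3 : 10 * m%:R ^+ 2 * eta <= delta.
  by rewrite mulrC -ler_pdivlMr ?mulr_gt0 ?exprn_gt0 // !ge_min lexx !orbT.
clearbody eta.
have [f0 [sf0 Nf0 _ hf0]] := @approx_unit1 _ _ _ nA hA e (eta / 3) (ltac:(by rewrite divr_gt0)).
pose f := f0 ** f0; have sf : star f = f by rewrite starM sf0.
have Nf : NA f <= 4.
  rewrite (le_trans (cnM nA _ _)) //.
  have -> : 4 = 2 * 2 :> R by ring.
  by rewrite ler_pM ?(cn_ge0 nA).
have fe : NA (e - f ** e) <= eta.
  have -> : e - f ** e = (e - f0 ** e) + f0 ** (e - f0 ** e).
    by rewrite smulBr addrA subrK smulA.
  rewrite (le_trans (cnD nA _ _)) //.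
  have : NA (f0 ** (e - f0 ** e)) <= 2 * (eta / 3).
    by rewrite (le_trans (cnM nA _ _)) // ler_pM ?(cn_ge0 nA).
  lra.
have [u0 [_ [hu0 _ _ _]]] := oz_gram hphi f0 f0.
(* [phi f] has norm at most 4, so halving makes [u] a contraction and [pos_contraction] applies to
   its square. *)
pose h : R[i] := (2^-1 : R)%:C; pose u := h *: u0.
pose T := uin (phi f); pose T' := uin (star u ** u).
have TT' : T = (4 : R)%:C *: T'.
  rewrite /T /T' /f -{1}sf0 hu0 -uinZ /u starZ conj_real smulZl smulZr !scalerA.
  rewrite -!rmorphM /=; have -> : 4 * (2^-1 * 2^-1) = 1 :> R by field.
  by rewrite scale1r.
have Nu : NM u <= 1.
  rewrite -(@ler_pXn2r _ 2) ?nnegrE ?(cn_ge0 nM) // expr1n -(cnS nM).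
  rewrite -(unorm_uin nM) -/T'.
  have : unorm NM T <= 4 by rewrite (unorm_uin nM) (le_trans (oz_norm hphi _)).
  by rewrite TT' (unZr UM) ger0_norm //; lra.
have C1 : unorm NM (1 - T') <= 1 by exact: pos_contraction.
have [G [Q [[G1 TQ] TG NG NQ sG]]] := ucesaro UM C1 m0.
have [] := sG; first by rewrite unitz_star_uin starM starK.
move=> {}sG sQ.
pose Q' := (4^-1 : R)%:C *: Q.
have sQ' : unitz_star Q' = Q' by rewrite (ustZr UM) sQ.
have NQ' : unorm NM Q' <= m%:R.
  rewrite (unZr UM) gtr0_norm ?invr_gt0 // ler_pdivrMl //.
  by rewrite (le_trans NQ) // ler_peMl ?ler0n // ler1n.
have sc : (4 : R)%:C * (4^-1 : R)%:C = 1 :> R[i].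
  by rewrite -rmorphM /= divff.
have TQ' : T * Q' = 1 - G by rewrite TT' -scalerAl -scalerAr scalerA sc scale1r G1.
have QT' : Q' * T = 1 - G.
  by rewrite TT' -scalerAl -scalerAr scalerA mulrC sc scale1r -TQ G1.
have NGT : unorm NM (G * T) <= rho ^+ 2 / 32.
  rewrite -(un_star UM) (ustM UM) sG unitz_star_uin -(oz_star hA hM hphi) sf -/T.
  rewrite TT' -scalerAl (unZr UM) ger0_norm //.
  by move: TG hm; set X := unorm NM _; lra.
(* [T * Q' = 1 - G] makes [Q'] a regularized inverse of [phi f]. The second clause holds because
   [phi e] is the right factor of the witness. *)
exists (uact Q' (phi e)); split; last first.
  move=> v hv; apply: uin_inj.
  by rewrite uinM uin_uact -mulrA -uinM hv uin0 mulr0.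
move=> x; pose z := e ** x ** star e.
have star_oz y : unitz_star (uin (phi y)) = uin (phi (star y)).
  by rewrite unitz_star_uin -(oz_star hA hM hphi).
have swap := oz_swap hA hM hphi.
have Ne : NA (star e) <= 2 by rewrite (cn_star nA).
have x0 := cn_ge0 nA x.
have small y : NA (e ** y ** star e - f ** (e ** y ** star e)) <= 2 * eta * NA y.
  have -> : e ** y ** star e - f ** (e ** y ** star e) = (e - f ** e) ** y ** star e.
    by rewrite !smulBl !smulA.
  rewrite (le_trans (cnM3 nA _ _ _)) //.
  have : NA (e - f ** e) * NA y * NA (star e) <= eta * NA y * 2.
    by rewrite ler_pM ?mulr_ge0 ?(cn_ge0 nA) // ler_wpM2r ?(cn_ge0 nA).
  lra.
have Gz y : unorm NM (G * uin (phi (e ** y ** star e))) <= rho * NA y.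
  set z' := e ** y ** star e.
  have y0 := cn_ge0 nA y.
  have Nz' : NA z' <= 4 * NA y.
    rewrite (le_trans (cnM3 nA _ _ _)) //.
    have : NA e * NA y * NA (star e) <= 2 * NA y * 2.
      by rewrite ler_pM ?mulr_ge0 ?(cn_ge0 nA) // ler_wpM2r.
    lra.
  rewrite -(@ler_pXn2r _ 2) ?nnegrE ?(un_ge0 UM) ?mulr_ge0 ?(ltW rho0) //.
  rewrite -(un_sq UM) (ustM UM) sG star_oz mulrA -[G * _ * _]mulrA -uinM.
  have -> : phi z' ** phi (star z') =
      phi f ** phi (z' ** star z') + phi (z' - f ** z') ** phi (star z').
    by rewrite (ozB hphi) smulBl -swap addrC subrK.
  rewrite uinD mulrDr mulrDl (le_trans (unD UM _ _)) //.
  have b1 : unorm NM (G * uin (phi f ** phi (z' ** star z')) * G)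
      <= rho ^+ 2 / 32 * (16 * NA y ^+ 2).
    rewrite uinM [G * (_ * _)]mulrA (le_trans (unM UM _ _)) //.
    rewrite (@le_trans _ _ (unorm NM (G * uin (phi f) * uin (phi (z' ** star z'))))) //.
      by rewrite ler_piMr ?(un_ge0 UM).
    rewrite (le_trans (unM UM _ _)) // ler_pM ?(un_ge0 UM) //.
    rewrite (unorm_uin nM) (le_trans (oz_norm hphi _)) // (cn_sq nA).
    have -> : 16 * NA y ^+ 2 = (4 * NA y) ^+ 2 by ring.
    by rewrite ler_pXn2r ?nnegrE ?mulr_ge0 ?(cn_ge0 nA).
  have b2 : unorm NM (G * uin (phi (z' - f ** z') ** phi (star z')) * G)
      <= 2 * eta * NA y * (4 * NA y).
    rewrite (le_trans (unM UM _ _)) //.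
    rewrite (@le_trans _ _ (unorm NM (uin (phi (z' - f ** z') ** phi (star z'))))) //.
      rewrite (@le_trans _ _ (unorm NM (G * uin (phi (z' - f ** z') ** phi (star z'))))) //.
        by rewrite ler_piMr ?(un_ge0 UM).
      by rewrite (le_trans (unM UM _ _)) // ler_piMl ?(un_ge0 UM).
    rewrite (unorm_uin nM) (le_trans (cnM nM _ _)) // ler_pM ?(cn_ge0 nM) //.
      by rewrite (le_trans (oz_norm hphi _)) // small.
    by rewrite (le_trans (oz_norm hphi _)) // (cn_star nA).
  have : eta * NA y ^+ 2 * 16 <= rho ^+ 2 * NA y ^+ 2.
    by rewrite mulrAC ler_wpM2r ?exprn_ge0 // mulrC.
  by move: b1 b2; rewrite exprMn; lra.
have zG : unorm NM (uin (phi z) * G) <= rho * NA x.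
  rewrite -(un_star UM) (ustM UM) sG star_oz.
  have -> : star z = e ** star x ** star e by rewrite !starM starK smulA.
  by rewrite (le_trans (Gz _)) // (cn_star nA).
(* Between two factors [Q'], [P] gives the compression by the witness and [P0] gives (1 - G) phi(z)
   (1 - G). The swap identity makes [P] and [P0] close. *)
pose P := phi e ** phi x ** phi (star e).
pose P0 := phi f ** phi z ** phi f.
have PP0 : NM (P - P0) <= 5 * eta * NA x.
  have P0E : P0 = phi (f ** e) ** phi x ** phi (star e ** f).
    by rewrite (swap f e x) -[RHS]smulA -(swap (e ** x) (star e) f) [RHS]smulA.
  have -> : P - P0 = phi (e - f ** e) ** phi x ** phi (star e)
      + phi (f ** e) ** phi x ** phi (star e - star e ** f).
    by rewrite P0E !(ozB hphi) !smulBl !smulBr addrA subrK.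
  rewrite (le_trans (cnD nM _ _)) //.
  have b1 : NM (phi (e - f ** e) ** phi x ** phi (star e)) <= eta * NA x * 2.
    rewrite (le_trans (cnM3 nM _ _ _)) // !ler_pM ?mulr_ge0 ?(cn_ge0 nM) ?(oz_norm hphi) //;
    by rewrite (le_trans (oz_norm hphi _)).
  have b2 : NM (phi (f ** e) ** phi x ** phi (star e - star e ** f)) <= 3 * NA x * eta.
    rewrite (le_trans (cnM3 nM _ _ _)) // !ler_pM ?mulr_ge0 ?(cn_ge0 nM) ?(oz_norm hphi) //;
    rewrite (le_trans (oz_norm hphi _)) //.
      have := cn_le_dist nA (f ** e) e; rewrite (cn_distC nA); lra.
    by rewrite -(cn_star nA) starB starM starK sf.
  lra.
have uW : unitz_star (uin (uact Q' (phi e))) = uin (phi (star e)) * Q'.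
  by rewrite uin_uact (ustM UM) star_oz sQ'.
rewrite -(unorm_uin nM) uinB !uinM -unitz_star_uin uW uin_uact.
have -> : Q' * uin (phi e) * uin (phi x) * (uin (phi (star e)) * Q') - uin (phi z) =
    Q' * uin (P - P0) * Q' - G * uin (phi z) - (1 - G) * (uin (phi z) * G).
  transitivity (Q' * uin (P - P0) * Q' + ((Q' * T) * uin (phi z) * (T * Q') - uin (phi z))).
    by rewrite /P /P0 /T uinB !uinM; Ncring_tac.non_commutative_ring.
  by rewrite QT' TQ'; Ncring_tac.non_commutative_ring.
rewrite (le_trans (unB UM _ _)) //.
have b1 : unorm NM (Q' * uin (P - P0) * Q') <= m%:R * (5 * eta * NA x) * m%:R.
  rewrite (le_trans (unM UM _ _)) // ler_pM ?(un_ge0 UM) //.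
  rewrite (le_trans (unM UM _ _)) // ler_pM ?(un_ge0 UM) //.
  by rewrite (unorm_uin nM).
have b2 : unorm NM ((1 - G) * (uin (phi z) * G)) <= 2 * (rho * NA x).
  rewrite (le_trans (unM UM _ _)) // ler_pM ?(un_ge0 UM) //.
  by rewrite (le_trans (unB UM _ _)) // (un1 UM); lra.
have b3 := unB UM (Q' * uin (P - P0) * Q') (G * uin (phi z)).
have b4 := Gz x.
have b5 : 10 * m%:R ^+ 2 * eta * NA x <= delta * NA x by rewrite ler_wpM2r.
have b6 : rho * NA x = delta * NA x / 6 by rewrite rhoE; ring.
move: b1 b2 b3 b4 b5 b6; rewrite -/z.
have -> : m%:R * (5 * eta * NA x) * m%:R = 10 * m%:R ^+ 2 * eta * NA x / 2 by field.
lra.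
Qed.

End CutOff.

(** * Cuntz comparison *)

Section FiniteSubequivalence.
Context {R : realType} {A B : normedStarAlgType R}.

(* Equivalent to [csubequiv] for order zero maps ([fin_csubequiv]), and transitive
   without any bound on the implementing elements. *)
Definition fin_subequiv (phi psi : A -> Minf B) : Prop :=
  forall (X : seq A) (eps : R), 0 < eps ->
    exists c, forall x, x \in X ->
      cnorm (star c ** psi x ** c - phi x) <= eps.

Lemma csubequiv_fin phi psi : csubequiv phi psi -> fin_subequiv phi psi.
Proof.
move=> [b hb] X eps eps0.
suff [n hn] : exists n, forall m, (n <= m)%N -> forall x, x \in X ->
    cnorm (star (b m) ** psi x ** b m - phi x) <= eps.
  by exists (b n) => x; apply: hn.
elim: X => [|x X [n hn]]; first by exists 0%N.
have /cvgr0Pnorm_lt/(_ _ eps0)[n' _ hn'] := hb x.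
exists (maxn n n') => m; rewrite geq_max => /andP[m1 m2] y.
rewrite inE => /orP[/eqP ->|]; last exact: hn.
by rewrite (le_trans (ler_norm _)) // ltW // hn'.
Qed.

Hypothesis hA : local_cstar_norm (@cnorm R A).
Hypothesis hM : local_cstar_norm (@cnorm R (Minf B)).
Hypothesis sA : cnorm_separable (@cnorm R A).
Implicit Types (phi psi chi : A -> Minf B).

Let nA := proj1 hA.
Let nM := proj1 hM.

Local Notation NA := (@cnorm R A).
Local Notation NM := (@cnorm R (Minf B)).

Lemma cn_compress (c u v : Minf B) :
  NM (star c ** u ** c - star c ** v ** c) <= NM c ^+ 2 * NM (u - v).
Proof.
rewrite -smulBl -smulBr (le_trans (cnM3 nM _ _ _)) // (cn_star nM).
by rewrite mulrAC expr2.
Qed.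

Lemma compress_approx_unit (X : seq A) (eps : R) : 0 < eps ->
  exists2 e, NA e <= 2 & forall x, x \in X -> NA (x - e ** x ** star e) <= eps.
Proof.
move=> eps0; have e3 : 0 < eps / 3 by rewrite divr_gt0.
have [e [e2 _ he]] := approx_unit nA hA (X ++ map star X) e3.
exists e => // x xX.
have -> : x - e ** x ** star e = (x - e ** x) + e ** (x - x ** star e).
  by rewrite smulBr addrA subrK smulA.
have h1 : NA (x - e ** x) <= eps / 3 by apply: he; rewrite mem_cat xX.
have h2 : NA (x - x ** star e) <= eps / 3.
  rewrite -(cn_star nA) starB starM starK; apply: he.
  by rewrite mem_cat map_f ?orbT.
rewrite (le_trans (cnD nA _ _)) //.
have : NA (e ** (x - x ** star e)) <= 2 * (eps / 3).
  by rewrite (le_trans (cnM nA _ _)) // ler_pM ?(cn_ge0 nA).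
lra.
Qed.

Lemma finite_bound (X : seq A) : exists2 K : R, 0 < K & forall x, x \in X -> NA x <= K.
Proof.
elim: X => [|x X [K K0 hK]]; first by exists 1.
have x0 := cn_ge0 nA x.
exists (K + NA x); first by rewrite ltr_wpDr.
move=> y; rewrite inE => /orP[/eqP ->|/hK h]; first by rewrite lerDr ltW.
by rewrite (le_trans h) // lerDl.
Qed.

(** Not immediate, since M_oo(B) has no unit to serve as [c]: the adjoint of a cut-off element takes
    its place. *)
Lemma fin_subequiv_refl phi : cpc_order_zero phi -> fin_subequiv phi phi.
Proof.
move=> hphi X eps eps0; have e2 : 0 < eps / 2 by rewrite divr_gt0.
have [e Ne he] := compress_approx_unit X e2.
have [K K0 hK] := finite_bound X.
have [w [hw _]] := oz_cutoff hA hM hphi Ne (divr_gt0 e2 K0).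
exists (star w) => x xX; rewrite starK.
rewrite (le_trans (cn_split nM (phi (e ** x ** star e)) _ _)) // [leRHS]splitr.
rewrite lerD //.
  by rewrite (le_trans (hw x)) // mulrAC ler_pdivrMr // ler_wpM2l ?hK // ltW.
by rewrite -(ozB hphi) (le_trans (oz_norm hphi _)) // (cn_distC nA) he.
Qed.

Lemma fin_subequiv_trans phi psi chi :
  fin_subequiv phi psi -> fin_subequiv psi chi -> fin_subequiv phi chi.
Proof.
move=> h1 h2 X eps eps0; have e2 : 0 < eps / 2 by rewrite divr_gt0.
have [b hb] := h1 X _ e2.
have b1 : 0 < NM b ^+ 2 + 1 by rewrite ltr_wpDl // exprn_ge0 ?(cn_ge0 nM).
have [c hc] := h2 X _ (divr_gt0 e2 b1).
exists (c ** b) => x xX.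
have -> : star (c ** b) ** chi x ** (c ** b) = star b ** (star c ** chi x ** c) ** b.
  by rewrite starM !smulA.
rewrite (le_trans (cn_split nM (star b ** psi x ** b) _ _)) // [leRHS]splitr.
apply: lerD; last exact: hb.
rewrite (le_trans (cn_compress _ _ _)) //.
rewrite (@le_trans _ _ ((NM b ^+ 2 + 1) * (eps / 2 / (NM b ^+ 2 + 1)))) //.
  by rewrite ler_pM ?(cn_ge0 nM) ?exprn_ge0 ?(cn_ge0 nM) ?lerDl ?hc.
by rewrite mulrC divfK // gt_eqF.
Qed.

(* The bound on x |-> c* psi(x) c depends neither on X nor on t; it replaces the
   uniform boundedness principle, which is not available on the incomplete A. *)
Lemma fin_subequiv_localize phi psi (X : seq A) (t : R) :
  cpc_order_zero phi -> cpc_order_zero psi -> fin_subequiv phi psi -> 0 < t ->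
  exists c, [/\ forall x, NM (star c ** psi x ** c) <= 21 * NA x,
    forall x, x \in X -> NM (star c ** psi x ** c - phi x) <= t * (NA x + 2) &
    forall v, (forall a, psi a ** v = 0) -> star c ** v = 0].
Proof.
move=> hphi hpsi sub t0.
have [e Ne he] := compress_approx_unit X t0.
have [t' [t'0 t'1 t't]] : exists t' : R, [/\ 0 < t', t' <= 1 & t' <= t].
  by exists (Num.min 1 t); rewrite lt_min ltr01 t0 !ge_min !lexx orbT.
(* Testing at [e ** star e] bounds the compressed value there by 4 + 1. Then [compress_bound] gives
   4 * 5, and the cut-off error adds 1, for a total of 21. *)
have [c0 hc0] := sub ((e ** star e) :: [seq e ** x ** star e | x <- X]) _ t'0.
have n1 : 0 < NM c0 ^+ 2 + 1 by rewrite ltr_wpDl // exprn_ge0 ?(cn_ge0 nM).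
have [w [hw kw]] := oz_cutoff hA hM hpsi Ne (divr_gt0 t'0 n1).
have cE x : star (star w ** c0) ** psi x ** (star w ** c0) =
    star c0 ** (w ** psi x ** star w) ** c0.
  by rewrite starM starK !smulA.
have key x : NM (star (star w ** c0) ** psi x ** (star w ** c0) -
    star c0 ** psi (e ** x ** star e) ** c0) <= t' * NA x.
  rewrite cE (le_trans (cn_compress _ _ _)) //.
  rewrite (@le_trans _ _ ((NM c0 ^+ 2 + 1) * (t' / (NM c0 ^+ 2 + 1) * NA x))) //.
    by rewrite ler_pM ?(cn_ge0 nM) ?exprn_ge0 ?(cn_ge0 nM) ?lerDl ?hw.
  by rewrite mulrA [_ * (t' / _)]mulrC divfK // gt_eqF.
exists (star w ** c0); split.
- move=> x; have := cn_le_dist nM (star (star w ** c0) ** psi x ** (star w ** c0))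
    (star c0 ** psi (e ** x ** star e) ** c0).
  have := key x; have := compress_bound hA hM hpsi e c0 x.
  have h5 : NM (star c0 ** psi (e ** star e) ** c0) <= 5.
    have := hc0 (e ** star e); rewrite mem_head => /(_ isT).
    have := cn_le_dist nM (star c0 ** psi (e ** star e) ** c0) (phi (e ** star e)).
    have : NM (phi (e ** star e)) <= 4.
      rewrite (le_trans (oz_norm hphi _)) // (cn_sq nA).
      have -> : 4 = 2 ^+ 2 :> R by ring.
      by rewrite ler_pXn2r ?nnegrE ?(cn_ge0 nA).
    lra.
  have : 4 * NA x * NM (star c0 ** psi (e ** star e) ** c0) <= 4 * NA x * 5.
    by rewrite ler_wpM2l // mulr_ge0 ?(cn_ge0 nA).
  have : t' * NA x <= NA x by rewrite ler_piMl ?(cn_ge0 nA).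
  lra.
- move=> x xX; set z := e ** x ** star e.
  rewrite (le_trans (cn_split nM (star c0 ** psi z ** c0) _ _)) //.
  have h1 := key x; have h2 := cn_split nM (phi z) (star c0 ** psi z ** c0) (phi x).
  have h3 : NM (star c0 ** psi z ** c0 - phi z) <= t'.
    by apply: hc0; rewrite inE; apply/orP; right; apply/mapP; exists x.
  have h4 : NM (phi z - phi x) <= t.
    by rewrite -(ozB hphi) (le_trans (oz_norm hphi _)) // (cn_distC nA) he.
  have h5 : t' * NA x <= t * NA x by rewrite ler_wpM2r ?(cn_ge0 nA).
  rewrite -/z in h1; clearbody z; move: h1 h2 h3 h4 h5 t't; clear; lra.
by move=> v hv; rewrite starM starK -smulA kw ?smulr0.
Qed.

(** The n-th element handles the first n points of a dense sequence up to a multiple of 1 / (n + 1).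
    Density reaches the other points because the bound 21 is the same for all n. *)
Lemma fin_csubequiv phi psi : cpc_order_zero phi -> cpc_order_zero psi ->
  fin_subequiv phi psi -> csubequiv phi psi.
Proof.
move=> hphi hpsi sub; have [D /countable_injP[g gi] hD] := sA.
pose d i := xget 0 [set x | D x /\ g x = i].
have dE x : D x -> d (g x) = x.
  move=> Dx; have [|Dd gd] := @xgetPex _ (0 : A) [set y | D y /\ g y = g x].
    by exists x.
  by apply: gi => //; apply/mem_set.
have step n := fin_subequiv_localize [seq d i | i <- iota 0 n] hphi hpsi sub
  (ltac:(by rewrite invr_gt0 ltr0n) : 0 < (n.+1%:R : R)^-1).
have [b hb] := choice step.
exists b => a; apply/cvgr0Pnorm_le => eps eps0.
(* The errors from psi (a - x), from [x] and from phi (a - x) are at most 21, 1 and 1 times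
   [eps / 46], together [eps / 2]. *)
have e30 : 0 < eps / 46 by rewrite divr_gt0.
have [x Dx ax] := hD a _ e30.
have K0 : 0 <= NA x + 2 by rewrite addr_ge0 ?(cn_ge0 nA).
have [m hm] : exists m : nat, (NA x + 2) / (eps / 46) < m%:R.
  exists (Num.bound ((NA x + 2) / (eps / 46))).
  by apply: archi_boundP; rewrite divr_ge0 // ltW.
exists (maxn m (g x).+1) => // n /=; rewrite geq_max => /andP[mn gn].
have [h1 h2 _] := hb n.
rewrite ger0_norm ?(cn_ge0 nM) //.
have hx : NM (star (b n) ** psi x ** b n - phi x) <= eps / 46.
  have xX : x \in [seq d i | i <- iota 0 n].
    by apply/mapP; exists (g x); rewrite ?mem_iota // dE.
  rewrite (le_trans (h2 x xX)) // mulrC ler_pdivrMr ?ltr0n //.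
  rewrite mulrC -ler_pdivrMr // (le_trans (ltW hm)) // ler_nat.
  exact: leqW.
have -> : star (b n) ** psi a ** b n - phi a = star (b n) ** psi (a - x) ** b n
    + (star (b n) ** psi x ** b n - phi x) - phi (a - x).
  rewrite (ozB hpsi) (ozB hphi) smulBr smulBl subrKA opprB.
  by rewrite subrKA.
rewrite (le_trans (cnB nM _ _)) //.
have := cnD nM (star (b n) ** psi (a - x) ** b n) (star (b n) ** psi x ** b n - phi x).
have := h1 (a - x); have := oz_norm hphi (a - x); have := ltW ax.
move: hx; lra.
Qed.

End FiniteSubequivalence.

(** * Precomposition and direct sums of order zero maps *)

Section Precomposition.
Context {R : realType} {A' A B : normedStarAlgType R}.

Lemma cpc_order_zero_comp (phi : A -> Minf B) (T : A' -> A) :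
  linear T -> (forall x y, T (x ** y) = T x ** T y) ->
  (forall x, T (star x) = star (T x)) -> (forall x, cnorm (T x) <= cnorm x) ->
  cpc_order_zero phi -> cpc_order_zero (phi \o T).
Proof.
move=> Tl TM TS TN [lin cp cn oz].
have TD x y : T (x + y) = T x + T y by have := Tl 1 x y; rewrite !scale1r.
have T0 : T 0 = 0 by apply: (addIr (T 0)); rewrite -TD !add0r.
have Tp x : cpositive x -> cpositive (T x).
  by move=> [y ->]; exists (T y); rewrite TM TS.
split.
- by move=> c x y /=; rewrite Tl lin.
- move=> n X [Y ->]; rewrite map_mx_comp; apply: cp.
  exists (map_mx T Y); apply/matrixP => i j; rewrite !mxE.
  rewrite (big_morph T TD T0); apply: eq_bigr => k _.
  by rewrite !mxE TM TS.
- by move=> a /=; rewrite (le_trans (cn _)).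
by move=> a b pa pb ab /=; apply: oz; rewrite -?TM ?ab ?T0 //; apply: Tp.
Qed.

End Precomposition.

Lemma zero_oz (R : realType) (A B : normedStarAlgType R) :
  (forall a : A, cnorm (0 : Minf B) <= cnorm a) ->
  cpc_order_zero (fun _ : A => 0 : Minf B).
Proof.
move=> h; split=> //.
- by move=> c x y; rewrite scaler0 addr0.
- move=> n X _; exists 0; apply/matrixP => i j; rewrite !mxE big1 // => k _.
  by rewrite !mxE smulr0.
by move=> a b _ _ _; rewrite smulr0.
Qed.

Section HatSum.
Context {R : realType} {A B : normedStarAlgType R}.
Hypothesis hA : local_cstar_norm (@cnorm R A).
Hypothesis hM : local_cstar_norm (@cnorm R (Minf B)).

Let nA := proj1 hA.
Let nM := proj1 hM.

Implicit Types (phi psi : A -> Minf B).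

Definition map_hsum phi psi (a : A) : Minf B := Minf_hsum (phi a) (psi a).

Lemma hsum00 : Minf_hsum (0 : Minf B) 0 = 0.
Proof. by apply/MinfP => i j /=; case: ifP => //; case: odd. Qed.

Lemma hcat00 : hcat (0 : Minf B) 0 = 0.
Proof. by apply: (cn_eq0 nM); rewrite (norm_hcat0 nM) (cn0 nM). Qed.

Lemma hsumD (x y x' y' : Minf B) :
  Minf_hsum (x + x') (y + y') = Minf_hsum x y + Minf_hsum x' y'.
Proof. by rewrite -{1}[x]scale1r -{1}[y]scale1r hsumZD scale1r. Qed.

Lemma hsumB (x y x' y' : Minf B) :
  Minf_hsum (x - x') (y - y') = Minf_hsum x y - Minf_hsum x' y'.
Proof.
rewrite hsumD; congr (_ + _); apply/eqP; rewrite -addr_eq0 -hsumD !addNr.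
by rewrite hsum00.
Qed.

Lemma map_hsum_oz phi psi : cpc_order_zero phi -> cpc_order_zero psi ->
  cpc_order_zero (map_hsum phi psi).
Proof.
move=> [l1 c1 n1 o1] [l2 c2 n2 o2]; split.
- by move=> c x y; rewrite /map_hsum l1 l2 hsumZD.
- move=> n X pX; have [Y hY] := c1 n X pX; have [Z hZ] := c2 n X pX.
  exists (\matrix_(i, j) Minf_hsum (Y i j) (Z i j)); apply/matrixP => i j.
  have /(congr1 (fun V : 'M[Minf B]_n => V i j)) := hY.
  have /(congr1 (fun V : 'M[Minf B]_n => V i j)) := hZ.
  rewrite !mxE /map_hsum => -> ->.
  elim/big_rec3: _ => [|k y1 y2 y3 _ <-]; first exact: hsum00.
  by rewrite !mxE star_hsum hsumM hsumD.
- by move=> a; apply: (norm_hsum nM hM).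
by move=> a b pa pb ab; rewrite /map_hsum hsumM o1 ?o2 ?hsum00.
Qed.

Lemma map_hsum_sub phi psi phi' psi' : fin_subequiv phi phi' ->
  fin_subequiv psi psi' -> fin_subequiv (map_hsum phi psi) (map_hsum phi' psi').
Proof.
move=> h1 h2 X eps eps0; have e2 : 0 < eps / 2 by rewrite divr_gt0.
have [b hb] := h1 X _ e2; have [c hc] := h2 X _ e2.
exists (Minf_hsum b c) => x xX.
rewrite star_hsum !hsumM -hsumB (le_trans (norm_hsum_add nM _ _)) //.
by rewrite [leRHS]splitr; apply: lerD; [exact: hb|exact: hc].
Qed.

(** The isometry onto the first summand would need a unit; the row (c, 0) and the column (c, 0)
    replace it, with [c] from the reflexivity of <~ for [phi]. *)
Lemma hsuml_sub phi : cpc_order_zero phi ->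
  fin_subequiv (map_hsum phi (fun=> 0)) phi /\ fin_subequiv phi (map_hsum phi (fun=> 0)).
Proof.
move=> hphi; have rf := fin_subequiv_refl hA hM hphi.
split=> X eps /(rf X)[c hc].
  exists (hcat c 0) => x xX; rewrite /map_hsum.
  have -> : star (hcat c 0) ** phi x ** hcat c 0 =
      Minf_hsum (star c ** phi x ** c) 0.
    by rewrite {1}/hcat starK star0 !vcatM !smul0r hsumE hcat00 Mhcat smulr0.
  by rewrite -hsumB subrr (norm_hsuml nM) hc.
exists (vcat c 0) => x xX; rewrite /map_hsum -smulA hsum_vcat smulr0 vcat_starM.
by rewrite smulr0 addr0 smulA hc.
Qed.

Lemma hsumr_sub phi : cpc_order_zero phi ->
  fin_subequiv (map_hsum (fun=> 0) phi) phi /\ fin_subequiv phi (map_hsum (fun=> 0) phi).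
Proof.
move=> hphi; have rf := fin_subequiv_refl hA hM hphi.
split=> X eps /(rf X)[c hc].
  exists (hcat 0 c) => x xX; rewrite /map_hsum.
  have -> : star (hcat 0 c) ** phi x ** hcat 0 c =
      Minf_hsum 0 (star c ** phi x ** c).
    by rewrite {1}/hcat starK star0 !vcatM !smul0r hsumE hcat00 Mhcat smulr0.
  by rewrite -hsumB subrr (norm_hsumr nM) hc.
exists (vcat 0 c) => x xX; rewrite /map_hsum -smulA hsum_vcat smulr0 vcat_starM.
by rewrite smulr0 add0r smulA hc.
Qed.

End HatSum.

(** * Direct sums of two algebras *)

Section ProductAlgebra.
Context {R : realType} {A1 A2 : normedStarAlgType R}.
Hypotheses (h1 : local_cstar_norm (@cnorm R A1))
  (h2 : local_cstar_norm (@cnorm R A2)).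

Let n1 := proj1 h1.
Let n2 := proj1 h2.

Lemma pair_cnormE (x : A1 * A2) : cnorm x = Num.max (cnorm x.1) (cnorm x.2).
Proof. by []. Qed.

Lemma pair_cstar_norm : cstar_norm (@cnorm R (A1 * A2)%type).
Proof.
split.
- move=> x; rewrite pair_cnormE; split; first by rewrite le_max (cn_ge0 n1).
  move=> x0; have /andP[a b] : (cnorm x.1 <= 0) && (cnorm x.2 <= 0).
    by rewrite -ge_max x0.
  case: x a b {x0} => x1 x2 /= a b; congr pair.
    by apply: (cn_eq0 n1); apply/le_anti; rewrite a (cn_ge0 n1).
  by apply: (cn_eq0 n2); apply/le_anti; rewrite b (cn_ge0 n2).
- move=> x y; rewrite !pair_cnormE ge_max; apply/andP; split.
    by rewrite (le_trans (cnD n1 _ _)) // lerD // le_max lexx.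
  by rewrite (le_trans (cnD n2 _ _)) // lerD // le_max lexx orbT.
- move=> c x; rewrite !pair_cnormE /= (cnZ n1) (cnZ n2) maxr_pMr //.
  exact: cabs_ge0.
- move=> x y; rewrite !pair_cnormE ge_max; apply/andP; split.
    rewrite (le_trans (cnM n1 _ _)) // ler_pM ?(cn_ge0 n1) // le_max lexx //.
  by rewrite (le_trans (cnM n2 _ _)) // ler_pM ?(cn_ge0 n2) // le_max lexx orbT.
move=> x; rewrite !pair_cnormE /= (cnS n1) (cnS n2).
have a := cn_ge0 n1 x.1; have b := cn_ge0 n2 x.2.
have [ab|ba] := leP (cnorm x.1) (cnorm x.2).
  by rewrite max_r // ler_pXn2r.
by rewrite max_l // ler_pXn2r // ltW.
Qed.

Lemma pair_local_cstar_norm : local_cstar_norm (@cnorm R (A1 * A2)%type).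
Proof.
split; first exact: pair_cstar_norm.
have [_ [I1 [F1 [s1 d1 c1]]]] := h1; have [_ [I2 [F2 [s2 d2 c2]]]] := h2.
exists (I1 * I2)%type, (fun i => [set x : A1 * A2 | F1 i.1 x.1 /\ F2 i.2 x.2]); split.
- move=> [i1 i2] /=.
  have [z1 l1 m1 t1 k1] := s1 i1; have [z2 l2 m2 t2 k2] := s2 i2; split.
  + by split.
  + by move=> c x y [x1 x2] [y1 y2]; split; [apply: l1|apply: l2].
  + by move=> x y [x1 x2] [y1 y2]; split; [apply: m1|apply: m2].
  + by move=> x [x1 x2]; split; [apply: t1|apply: t2].
  move=> u Su cu.
  have [|e e0|a1 Fa1 ca1] := k1 (fun n => (u n).1).
  + by move=> n; case: (Su n).
  + have [n0 hn0] := cu e e0; exists n0 => m n hm hn.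
    by rewrite (le_lt_trans _ (hn0 m n hm hn)) // pair_cnormE le_max lexx.
  have [|e e0|a2 Fa2 ca2] := k2 (fun n => (u n).2).
  + by move=> n; case: (Su n).
  + have [n0 hn0] := cu e e0; exists n0 => m n hm hn.
    by rewrite (le_lt_trans _ (hn0 m n hm hn)) // pair_cnormE le_max lexx orbT.
  exists (a1, a2) => //; apply/cvgr0Pnorm_lt => e e0.
  have /cvgr0Pnorm_lt/(_ _ e0)[m1' _ hm1] := ca1.
  have /cvgr0Pnorm_lt/(_ _ e0)[m2' _ hm2] := ca2.
  exists (maxn m1' m2') => // n /=; rewrite geq_max => /andP[l1' l2'].
  have a := hm1 n l1'; have b := hm2 n l2'.
  rewrite ger0_norm ?(cn_ge0 pair_cstar_norm) // pair_cnormE gt_max.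
  by rewrite (le_lt_trans (ler_norm _) a) (le_lt_trans (ler_norm _) b).
- move=> [i1 i2] [j1 j2]; have [k1 [a1 b1]] := d1 i1 j1.
  have [k2 [a2 b2]] := d2 i2 j2; exists (k1, k2); split=> x /= [x1 x2].
    by split; [apply: a1|apply: a2].
  by split; [apply: b1|apply: b2].
apply/seteqP; split=> // x _.
have [i1 _ x1] : (\bigcup_i F1 i) x.1 by rewrite c1.
have [i2 _ x2] : (\bigcup_i F2 i) x.2 by rewrite c2.
by exists (i1, i2).
Qed.

Lemma pair_separable : cnorm_separable (@cnorm R A1) ->
  cnorm_separable (@cnorm R A2) -> cnorm_separable (@cnorm R (A1 * A2)%type).
Proof.
move=> [D1 cD1 hD1] [D2 cD2 hD2]; exists (D1 `*` D2).
  exact: countableX.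
move=> x e e0; have [a1 Da1 xa1] := hD1 x.1 e e0.
have [a2 Da2 xa2] := hD2 x.2 e e0.
by exists (a1, a2) => //; rewrite pair_cnormE gt_max xa1 xa2.
Qed.

Definition inj1 (a : A1) : A1 * A2 := (a, 0).
Definition inj2 (a : A2) : A1 * A2 := (0, a).

Context {B : normedStarAlgType R}.
Hypothesis hM : local_cstar_norm (@cnorm R (Minf B)).
Hypotheses (s1 : cnorm_separable (@cnorm R A1)) (s2 : cnorm_separable (@cnorm R A2)).

Let nM := proj1 hM.

Lemma inj1_oz (phi : A1 * A2 -> Minf B) : cpc_order_zero phi -> cpc_order_zero (phi \o inj1).
Proof.
apply: cpc_order_zero_comp => [c x y|x y|x|x].
- by congr pair; rewrite /= scaler0 addr0.
- by congr pair; rewrite /= smulr0.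
- by congr pair; rewrite /= star0.
by rewrite pair_cnormE /= (cn0 n2) max_l // (cn_ge0 n1).
Qed.

Lemma inj2_oz (phi : A1 * A2 -> Minf B) : cpc_order_zero phi -> cpc_order_zero (phi \o inj2).
Proof.
apply: cpc_order_zero_comp => [c x y|x y|x|x].
- by congr pair; rewrite /= scaler0 addr0.
- by congr pair; rewrite /= smulr0.
- by congr pair; rewrite /= star0.
by rewrite pair_cnormE /= (cn0 n1) max_r // (cn_ge0 n2).
Qed.

Lemma fst_oz (phi : A1 -> Minf B) : cpc_order_zero phi ->
  cpc_order_zero (fun x : A1 * A2 => phi x.1).
Proof.
apply: (@cpc_order_zero_comp _ _ _ _ phi fst) => // x.
by rewrite pair_cnormE le_max lexx.
Qed.

Lemma snd_oz (phi : A2 -> Minf B) : cpc_order_zero phi ->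
  cpc_order_zero (fun x : A1 * A2 => phi x.2).
Proof.
apply: (@cpc_order_zero_comp _ _ _ _ phi snd) => // x.
by rewrite pair_cnormE le_max lexx orbT.
Qed.

Lemma pair_fin_subequiv (phi psi : A1 * A2 -> Minf B) :
  cpc_order_zero phi -> cpc_order_zero psi ->
  fin_subequiv (phi \o inj1) (psi \o inj1) ->
  fin_subequiv (phi \o inj2) (psi \o inj2) -> fin_subequiv phi psi.
Proof.
move=> hphi hpsi sub1 sub2 X eps eps0.
have hA := pair_local_cstar_norm.
have [phi1 psi1] := (inj1_oz hphi, inj1_oz hpsi).
have [phi2 psi2] := (inj2_oz hphi, inj2_oz hpsi).
have [K K0 hK] := finite_bound hA X.
(* [fin_subequiv_localize] has error t (N x + 2), so t = eps / (2 (K + 2)) leaves at most [eps / 2]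
   for each coordinate. *)
have K2 : 0 < 2 * (K + 2) by rewrite mulr_gt0 ?addr_gt0.
have t0 := divr_gt0 eps0 K2.
have [c1 [_ ap1 k1]] := fin_subequiv_localize h1 hM (map fst X) phi1 psi1 sub1 t0.
have [c2 [_ ap2 k2]] := fin_subequiv_localize h2 hM (map snd X) phi2 psi2 sub2 t0.
have orth a b : psi (inj1 a) ** psi (inj2 b) = 0.
  by apply: (oz_orth hA hM hpsi); congr pair; rewrite /= ?smulr0 ?smul0r.
have orth' a b : psi (inj2 b) ** psi (inj1 a) = 0.
  by apply: (oz_orth hA hM hpsi); congr pair; rewrite /= ?smulr0 ?smul0r.
(* [psi (inj2 b)] is annihilated by the range of [psi \o inj1], hence by [star c1]; this and its
   three variants remove all cross terms. *)
have z1 b : star c1 ** psi (inj2 b) = 0 by apply: k1 => a; apply: orth.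
have z2 a : star c2 ** psi (inj1 a) = 0 by apply: k2 => b; apply: orth'.
have z1' b : psi (inj2 b) ** c1 = 0.
  have := congr1 star (z1 (star b)); rewrite starM starK star0.
  rewrite -(oz_star hA hM hpsi); congr (psi _ ** _ = _).
  by congr pair; rewrite /= ?star0 ?starK.
have z2' a : psi (inj1 a) ** c2 = 0.
  have := congr1 star (z2 (star a)); rewrite starM starK star0.
  rewrite -(oz_star hA hM hpsi); congr (psi _ ** _ = _).
  by congr pair; rewrite /= ?star0 ?starK.
exists (c1 + c2) => x xX.
have xE : x = inj1 x.1 + inj2 x.2.
  by case: x {xX} => a b; congr pair; rewrite /= ?addr0 ?add0r.
have -> : star (c1 + c2) ** psi x ** (c1 + c2) - phi x =
    (star c1 ** psi (inj1 x.1) ** c1 - phi (inj1 x.1))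
    + (star c2 ** psi (inj2 x.2) ** c2 - phi (inj2 x.2)).
  rewrite {1 2}xE (ozD hpsi) (ozD hphi) starD smulDl !(smulDr (star _)) z1 z2.
  rewrite addr0 add0r smulDl !(smulDr (_ ** _)) -!smulA z1' z2' !smulr0.
  by rewrite addr0 add0r opprD addrACA.
have b1 := ap1 x.1 (map_f _ xX); have b2 := ap2 x.2 (map_f _ xX).
have N1 : cnorm x.1 <= K by rewrite (le_trans _ (hK x xX)) // pair_cnormE le_max lexx.
have N2 : cnorm x.2 <= K by rewrite (le_trans _ (hK x xX)) // pair_cnormE le_max lexx orbT.
have half (r : R) : r <= K -> eps / (2 * (K + 2)) * (r + 2) <= eps / 2.
  move=> rK; rewrite (@le_trans _ _ (eps / (2 * (K + 2)) * (K + 2))) //.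
    by rewrite ler_wpM2l ?(ltW t0) // lerD2r.
  by rewrite invfM mulrA mulfVK // gt_eqF // addr_gt0.
rewrite (le_trans (cnD nM _ _)) // [leRHS]splitr; apply: lerD.
  exact: le_trans b1 (half _ N1).
exact: le_trans b2 (half _ N2).
Qed.

End ProductAlgebra.

(** Operations on classes are unions over representatives; independence of the representative is
    what collapses such a union to one class. *)
Lemma bigcup_constant (T U : Type) (S : set T) (F : T -> set U) (C : set U) :
  (exists x, S x) -> (forall x, S x -> F x = C) -> \bigcup_(x in S) F x = C.
Proof.
move=> [x Sx] h; apply/seteqP; split=> u; first by move=> [y Sy]; rewrite h.
by move=> Cu; exists x => //; rewrite h.
Qed.

(** * Equivalence classes and their addition *)

Section Classes.
Context {R : realType} {A B : normedStarAlgType R}.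
Hypothesis hA : local_cstar_norm (@cnorm R A).
Hypothesis hM : local_cstar_norm (@cnorm R (Minf B)).
Hypothesis sA : cnorm_separable (@cnorm R A).
Implicit Types (phi psi chi : A -> Minf B).

Lemma csubequivP phi psi : cpc_order_zero phi -> cpc_order_zero psi ->
  csubequiv phi psi <-> fin_subequiv phi psi.
Proof. by move=> *; split; [exact: csubequiv_fin|exact: fin_csubequiv]. Qed.

Lemma cequiv_refl phi : cpc_order_zero phi -> cequiv phi phi.
Proof.
by move=> hphi; split; apply/csubequivP => //; apply: fin_subequiv_refl.
Qed.

Lemma cequiv_sym phi psi : cequiv phi psi -> cequiv psi phi.
Proof. by case. Qed.

Lemma cequiv_trans phi psi chi : cpc_order_zero phi -> cpc_order_zero psi ->
  cpc_order_zero chi -> cequiv phi psi -> cequiv psi chi -> cequiv phi chi.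
Proof.
move=> h1 h2 h3 [/csubequivP-/(_ h1 h2) a /csubequivP-/(_ h2 h1) b].
move=> [/csubequivP-/(_ h2 h3) c /csubequivP-/(_ h3 h2) d].
by split; apply/csubequivP => //; apply: (fin_subequiv_trans hM (psi := psi)).
Qed.

Lemma Wclass_mem phi : cpc_order_zero phi -> Wclass phi phi.
Proof. by move=> h; split=> //; apply: cequiv_refl. Qed.

Lemma Wclass_eq phi psi : cpc_order_zero phi -> cpc_order_zero psi ->
  cequiv phi psi -> Wclass phi = Wclass psi.
Proof.
move=> h1 h2 e; apply/seteqP; split=> chi [h3 e3]; split=> //.
  exact: cequiv_trans e3 e.
exact: cequiv_trans e3 (cequiv_sym e).
Qed.

Lemma Wclass_inj phi psi : cpc_order_zero phi -> Wclass phi = Wclass psi ->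
  cequiv phi psi.
Proof. by move=> h e; have := Wclass_mem h; rewrite e => -[]. Qed.

Lemma map_hsum_cequiv phi psi phi' psi' :
  cpc_order_zero phi -> cpc_order_zero psi -> cpc_order_zero phi' ->
  cpc_order_zero psi' -> cequiv phi phi' -> cequiv psi psi' ->
  cequiv (map_hsum phi psi) (map_hsum phi' psi').
Proof.
move=> h1 h2 h3 h4 [/csubequivP-/(_ h1 h3) a /csubequivP-/(_ h3 h1) b].
move=> [/csubequivP-/(_ h2 h4) c /csubequivP-/(_ h4 h2) d].
have k1 := map_hsum_oz hM h1 h2; have k2 := map_hsum_oz hM h3 h4.
by split; apply/csubequivP => //; apply: map_hsum_sub.
Qed.

Lemma Wadd_class phi psi : cpc_order_zero phi -> cpc_order_zero psi ->
  Wadd (Wclass phi) (Wclass psi) = Wclass (map_hsum phi psi).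
Proof.
move=> h1 h2; apply: bigcup_constant; first by exists phi; apply: Wclass_mem.
move=> phi' [h3 e1]; apply: bigcup_constant; first by exists psi; apply: Wclass_mem.
move=> psi' [h4 e2]; apply: (Wclass_eq (phi := map_hsum phi' psi')).
- exact: map_hsum_oz.
- exact: map_hsum_oz.
exact: map_hsum_cequiv.
Qed.

End Classes.

(** * The decomposition isomorphism *)

Section Decomposition.
Context {R : realType} {A1 A2 B : normedStarAlgType R}.
Hypotheses (h1 : local_cstar_norm (@cnorm R A1))
  (h2 : local_cstar_norm (@cnorm R A2))
  (s1 : cnorm_separable (@cnorm R A1)) (s2 : cnorm_separable (@cnorm R A2)).

Lemma decomposition_of_norm : local_cstar_norm (@cnorm R (Minf B)) ->
  semigroup_isomorphic (W (A1 * A2)%type B) Wadd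
    (W A1 B `*` W A2 B) (pair_add Wadd Wadd).
Proof.
move=> hM; have hA := pair_local_cstar_norm h1 h2; have sA := pair_separable s1 s2.
(* Defined as a union on arbitrary sets, the map needs no choice of representatives. *)
pose f (S : set (A1 * A2 -> Minf B)) :=
  (\bigcup_(phi in S) Wclass (phi \o inj1), \bigcup_(phi in S) Wclass (phi \o inj2)).
have i1 := @inj1_oz _ _ _ h1 h2 B; have i2 := @inj2_oz _ _ _ h1 h2 B.
have comp1 (phi psi : A1 * A2 -> Minf B) : cequiv phi psi ->
    cequiv (phi \o inj1) (psi \o inj1) /\ cequiv (phi \o inj2) (psi \o inj2).
  by move=> [[b hb] [c hc]]; do 2 split; [exists b|exists c|exists b|exists c] => a;
    [apply: hb|apply: hc|apply: hb|apply: hc].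
have fE phi : cpc_order_zero phi ->
    f (Wclass phi) = (Wclass (phi \o inj1), Wclass (phi \o inj2)).
  move=> hphi; congr pair; apply: bigcup_constant.
  - by exists phi; apply: Wclass_mem.
  - move=> psi [hpsi e]; have [e1 _] := comp1 _ _ e.
    by apply: (Wclass_eq h1 hM s1) => //; apply: i1.
  - by exists phi; apply: Wclass_mem.
  - move=> psi [hpsi e]; have [_ e2] := comp1 _ _ e.
    by apply: (Wclass_eq h2 hM s2) => //; apply: i2.
exists f; split; first split.
- move=> _ [phi hphi <-]; rewrite fE //; split=> /=.
    by exists (phi \o inj1) => //; apply: i1.
  by exists (phi \o inj2) => //; apply: i2.
- move=> S T /set_mem[phi hphi <-] /set_mem[psi hpsi <-].
  rewrite !fE // => -[e1 e2]; apply: (Wclass_eq hA hM sA) => //.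
  have [a1 b1] := Wclass_inj h1 hM s1 (i1 _ hphi) e1.
  have [a2 b2] := Wclass_inj h2 hM s2 (i2 _ hphi) e2.
  by split; apply: (fin_csubequiv hA hM sA) => //;
    apply: (pair_fin_subequiv h1 h2 hM) => //; apply: csubequiv_fin.
- move=> [S T] [/= [phi hphi <-] [psi hpsi <-]].
  pose chi := map_hsum (fun x : A1 * A2 => phi x.1) (fun x : A1 * A2 => psi x.2).
  have hchi : cpc_order_zero chi.
    by apply: (map_hsum_oz hM); [apply: fst_oz|apply: snd_oz].
  exists (Wclass chi); first by exists chi.
  have psi0 : psi 0 = 0 by exact: (oz0 hpsi).
  have phi0 : phi 0 = 0 by exact: (oz0 hphi).
  have M0 : cnorm (0 : Minf B) = 0 by exact: (cn0 (proj1 hM)).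
  have z0 : cpc_order_zero (fun _ : A1 => 0 : Minf B).
    by apply: zero_oz => a; rewrite M0 (cn_ge0 (proj1 h1)).
  have z0' : cpc_order_zero (fun _ : A2 => 0 : Minf B).
    by apply: zero_oz => a; rewrite M0 (cn_ge0 (proj1 h2)).
  rewrite fE //; congr pair.
    (* Restricting [chi] recovers [phi] only up to a zero summand, which does not change the
       class. *)
    have -> : chi \o inj1 = map_hsum phi (fun=> 0).
      by apply/funext => a; rewrite /chi /map_hsum /= psi0.
    have [a b] := hsuml_sub h1 hM hphi.
    have z := map_hsum_oz hM hphi z0.
    by apply: (Wclass_eq h1 hM s1) => //; split; apply: (fin_csubequiv h1 hM s1).
  have -> : chi \o inj2 = map_hsum (fun=> 0) psi.
    by apply/funext => a; rewrite /chi /map_hsum /= phi0.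
  have [a b] := hsumr_sub h2 hM hpsi.
  have z := map_hsum_oz hM z0' hpsi.
  by apply: (Wclass_eq h2 hM s2) => //; split; apply: (fin_csubequiv h2 hM s2).
move=> _ _ [phi hphi <-] [psi hpsi <-].
(* Restriction commutes with [map_hsum] by conversion, so both sides agree once the unions are
   evaluated. *)
rewrite (Wadd_class hA hM sA hphi hpsi) !fE //; last exact: map_hsum_oz.
rewrite /pair_add /= (Wadd_class h1 hM s1 (i1 _ hphi) (i1 _ hpsi)).
by rewrite (Wadd_class h2 hM s2 (i2 _ hphi) (i2 _ hpsi)).
Qed.

(* The case where [Minf_norm] takes its default value; treating it spares the
   construction of a C*-norm on M_oo(B). *)
Lemma W_norm0 (A : normedStarAlgType R) : cstar_norm (@cnorm R A) ->
  (forall x : Minf B, cnorm x = 0) ->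
  exists C : set (A -> Minf B), W A B = [set C] /\ Wadd C C = C.
Proof.
move=> hA M0; pose z : A -> Minf B := fun=> 0.
have hz : cpc_order_zero z by apply: zero_oz => a; rewrite M0 (cn_ge0 hA).
have eqv (phi psi : A -> Minf B) : cequiv phi psi.
  by split; exists (fun=> 0) => a; under eq_fun do rewrite M0; exact: cvg_cst.
have cE phi : Wclass phi = [set psi : A -> Minf B | cpc_order_zero psi].
  by apply/seteqP; split=> [psi []//|psi h]; split.
exists [set psi | cpc_order_zero psi]; split.
  apply/seteqP; split=> [_ [phi _ <-]|_ ->]; first by rewrite cE.
  by exists z => //; rewrite cE.
apply: bigcup_constant => [|phi _]; first by exists z.
by apply: bigcup_constant => [|psi _]; [exists z|exact: cE].
Qed.

Lemma decomposition_norm0 : (forall x : Minf B, cnorm x = 0) ->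
  semigroup_isomorphic (W (A1 * A2)%type B) Wadd
    (W A1 B `*` W A2 B) (pair_add Wadd Wadd).
Proof.
move=> M0.
have [C [CE CC]] := W_norm0 (pair_cstar_norm h1 h2) M0.
have [C1 [CE1 CC1]] := W_norm0 (proj1 h1) M0.
have [C2 [CE2 CC2]] := W_norm0 (proj1 h2) M0.
exists (fun=> (C1, C2)); rewrite CE CE1 CE2; split; first split.
- by move=> _ _.
- by move=> S T /set_mem -> /set_mem ->.
- by move=> [_ _] [/= -> ->]; exists C.
by move=> _ _ _ _; rewrite /pair_add /= CC1 CC2.
Qed.

End Decomposition.

Theorem theorem2p18 (R : realType) (A1 A2 B : normedStarAlgType R)
  (hA1 : separable_local_cstar A1) (hA2 : separable_local_cstar A2)
  (hB : separable_local_cstar B) :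
  semigroup_isomorphic
    (W (A1 * A2)%type B) Wadd
    (W A1 B `*` W A2 B) (pair_add Wadd Wadd).
Proof.
have [h1 s1] := hA1; have [h2 s2] := hA2.
(* If some norm meets the specification, [xget] returns one that does; otherwise it returns the zero
   function. *)
have [[N hN]|noN] := pselect (exists N : Minf B -> R,
    local_cstar_norm N /\ forall b, N (Minf_corner_embed b) = cnorm b).
  apply: decomposition_of_norm => //.
  by have [] := @xgetPex _ (fun=> 0) [set N : Minf B -> R | local_cstar_norm N /\
      forall b, N (Minf_corner_embed b) = cnorm b] (ex_intro _ N hN).
apply: decomposition_norm0 => // x.
rewrite -[cnorm x]/(Minf_norm x) /Minf_norm xgetPN // => N hN.
by apply: noN; exists N.
Qed.
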